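(* Let $m>1$, $N\ge 2$, and $\chi>C_N$. Let $X_0\in\mathcal R^N$ and let $X$ be the maximal solution in $\mathcal R^N$, defined on $[0,T)$, of the gradient flow system with $X(0)=X_0$. Then: (1) If $\chi\neq C_p$ for every integer $p\in[1,N-1]$, then $X$ blows up in finite time (in particular $T<+\infty$). (2) If there exists an integer $p\in[1,N-1]$ with $\chi=C_p$, then either $X$ blows up in finite time, or $T=+\infty$ and the renormalized trajectory $Y=X/|X|$ blows up in infinite time, i.e. there are an index $i_0$ and times $t_n\to+\infty$ with $Y_{i_0+1}(t_n)-Y_{i_0}(t_n)\to0$. Moreover, in the latter case, any relative blow-up set $\mathcal I$ of a sequence $(Y(t_n))$ with $t_n\to\infty$ (obtained after extraction of a subsequence) contains exactly $p$ indices, and the restriction of $Y(t_n)$ to $\mathcal I$, after renormalization (i.e. its limit profile $Z\in\mathcal R^p$), is the unique (with this normalization) critical point of $\mathcal F^p_m$ in $\mathcal R^p$.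
   Context: $\mathcal R^p=\{X\in\mathbb R^p: X_1<\dots<X_p,\ \sum_iX_i=0\}$; $|\cdot|$ is the Euclidean norm. For $p\ge2$, $\mathcal F^p_m(X)=\frac1{m-1}\sum_{i=1}^{p-1}(X_{i+1}-X_i)^{1-m}-\frac{\chi}{m-1}\sum_{1\le i\ne j\le p}|X_i-X_j|^{1-m}$ on $\mathcal R^p$, and $C_p>0$ is defined by $\frac1{C_p}=\max_{X\in\mathcal R^p}\frac{\sum_{1\le i\ne j\le p}|X_j-X_i|^{1-m}}{\sum_{i=1}^{p-1}(X_{i+1}-X_i)^{1-m}}$ (for $p=1$ these sums are empty, so no finite value $C_1$ arises). Gradient flow system: for $i=1,\dots,N$, $\dot X_i=-(X_{i+1}-X_i)^{-m}+(X_i-X_{i-1})^{-m}+2\chi\sum_{j\ne i}\mathrm{sign}(j-i)|X_j-X_i|^{-m}$, where the first term is absent for $i=N$ and the second for $i=1$; this is $\dot X=-\nabla\mathcal F^N_m(X)$. Blow-up: $X$ blows up (at its maximal time $T$) if there exist an index $i_0$ and $t_n\to T$ with $X_{i_0+1}(t_n)-X_{i_0}(t_n)\to0$; ''in finite time'' means moreover $T<\infty$. Relative blow-up set of a sequence $(X^n)$ in $\mathcal R^N$: a set $\mathcal I=[l,r]$ of consecutive integers in $[1,N]$, with $\mathcal J=[l,r-1]$ and $\partial\mathcal J=(\{l-1\}\cup\{r\})\cap[1,N-1]$, such that (i) $X^n_{i+1}-X^n_i\to0$ for all $i\in\mathcal J$; (ii) for all $i\in\mathcal J$ and $k\in[1,N-1]$,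 $\lim_n\frac{X^n_{i+1}-X^n_i}{X^n_{k+1}-X^n_k}$ exists and is finite; (iii) for all $i\in\mathcal J$ and $j\in\partial\mathcal J$, $\lim_n\frac{X^n_{i+1}-X^n_i}{X^n_{j+1}-X^n_j}=0$. Limit profile: with $p=|\mathcal I|$ and $\Pi_{\mathcal I}(X^n)=\big(\sum_{i\in\mathcal J}(X^n_{i+1}-X^n_i)^2\big)^{1/2}$, it is the unique $Z\in\mathcal R^p$ whose consecutive gaps (indexed by $\mathcal J$) are $\lim_n (X^n_{i+1}-X^n_i)/\Pi_{\mathcal I}(X^n)>0$. *)

(* Defs.v *)
From Stdlib Require Import Reals Lra Lia Arith.
From Coquelicot Require Import Coquelicot.
Open Scope R_scope.

(* Points of R^p are functions nat -> R; coordinates are indexed 0..p-1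
   (paper index i corresponds to i-1 here). *)

Fixpoint rsum (n : nat) (f : nat -> R) : R :=
  match n with
  | O => 0
  | S k => rsum k f + f k
  end.

Definition pairsum (p : nat) (f : nat -> nat -> R) : R :=
  rsum p (fun i => rsum p (fun j => if Nat.eqb i j then 0 else f i j)).

Definition inR (p : nat) (X : nat -> R) : Prop :=
  (forall i, (S i < p)%nat -> X i < X (S i)) /\ rsum p X = 0.

Definition enorm (p : nat) (X : nat -> R) : R :=
  sqrt (rsum p (fun i => (X i) ^ 2)).

Definition Fpm (p : nat) (m chi : R) (X : nat -> R) : R :=
  / (m - 1) * rsum (p - 1) (fun i => Rpower (X (S i) - X i) (1 - m))
  - chi / (m - 1) * pairsum p (fun i j => Rpower (Rabs (X i - X j)) (1 - m)).

Definition Cratio (p : nat) (m : R) (X : nat -> R) : R :=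
  pairsum p (fun i j => Rpower (Rabs (X j - X i)) (1 - m))
  / rsum (p - 1) (fun i => Rpower (X (S i) - X i) (1 - m)).

(* 1 / C_p = max_{X in R^p} Cratio p m X  (taken as the supremum, which is
   attained according to the paper); meaningful for p >= 2. *)
Definition Cp (p : nat) (m : R) : R :=
  / real (Lub_Rbar (fun r => exists X, inR p X /\ r = Cratio p m X)).

Definition vfield (N : nat) (m chi : R) (X : nat -> R) (i : nat) : R :=
  (if Nat.ltb (S i) N then - Rpower (X (S i) - X i) (- m) else 0)
  + (if Nat.ltb 0 i then Rpower (X i - X (pred i)) (- m) else 0)
  + 2 * chi * rsum N (fun j =>
       if Nat.eqb j i then 0
       else if Nat.ltb i j then Rpower (Rabs (X j - X i)) (- m)
       else - Rpower (Rabs (X j - X i)) (- m)).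

Definition is_sol (N : nat) (m chi : R) (X0 : nat -> R)
    (X : R -> nat -> R) (T : Rbar) : Prop :=
  Rbar_lt 0 T /\
  (forall i, (i < N)%nat -> X 0 i = X0 i) /\
  (forall t, 0 <= t -> Rbar_lt t T -> inR N (X t)) /\
  (forall i, (i < N)%nat -> forall t, 0 < t -> Rbar_lt t T ->
      is_derive (fun s => X s i) t (vfield N m chi (X t) i)) /\
  (forall i, (i < N)%nat ->
      filterlim (fun s => X s i) (at_right 0) (locally (X0 i))).

Definition is_maximal_sol (N : nat) (m chi : R) (X0 : nat -> R)
    (X : R -> nat -> R) (T : Rbar) : Prop :=
  is_sol N m chi X0 X T /\
  (forall (Y : R -> nat -> R) (T' : Rbar), is_sol N m chi X0 Y T' -> Rbar_le T' T).

Definition blows_up (N : nat) (X : R -> nat -> R) (T : Rbar) : Prop :=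
  exists (i0 : nat) (t : nat -> R),
    (S i0 < N)%nat /\
    (forall n, 0 <= t n /\ Rbar_lt (t n) T) /\
    is_lim_seq t T /\
    is_lim_seq (fun n => X (t n) (S i0) - X (t n) i0) 0.

Definition blows_up_finite_time (N : nat) (X : R -> nat -> R) (T : Rbar) : Prop :=
  blows_up N X T /\ is_finite T.

Definition renorm (N : nat) (X : R -> nat -> R) : R -> nat -> R :=
  fun t i => X t i / enorm N (X t).

Definition gap (Xs : nat -> nat -> R) (n i : nat) : R := Xs n (S i) - Xs n i.

(* Relative blow-up set I = [l, r] (0-based, l <= r <= N-1) of the sequence
   Xs in R^N; J = [l, r-1], dJ = ({l-1} u {r}) n [0, N-2].
   We require |I| >= 2 (l < r). *)
Definition rel_blowup_set (N : nat) (Xs : nat -> nat -> R) (l r : nat) : Prop :=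
  (l < r)%nat /\ (r < N)%nat /\
  (forall i, (l <= i < r)%nat -> is_lim_seq (fun n => gap Xs n i) 0) /\
  (forall i k, (l <= i < r)%nat -> (S k < N)%nat ->
      ex_finite_lim_seq (fun n => gap Xs n i / gap Xs n k)) /\
  (forall i j, (l <= i < r)%nat -> (S j < N)%nat -> (S j = l \/ j = r) ->
      is_lim_seq (fun n => gap Xs n i / gap Xs n j) 0).

Definition limit_profile (Xs : nat -> nat -> R) (l r : nat) (Z : nat -> R) : Prop :=
  inR (r - l + 1) Z /\
  forall k, (k < r - l)%nat ->
    is_lim_seq
      (fun n => gap Xs n (l + k) /
                sqrt (rsum (r - l) (fun k' => (gap Xs n (l + k')) ^ 2)))
      (Z (S k) - Z k).

(* Z is a critical point of F^p_m in R^p: all partial derivatives vanish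
   (F^p_m is translation invariant, so its gradient is tangent to the
   hyperplane sum = 0). *)
Definition is_critical_point (p : nat) (m chi : R) (Z : nat -> R) : Prop :=
  inR p Z /\
  forall i, (i < p)%nat ->
    is_derive (fun h => Fpm p m chi (fun j => if Nat.eqb j i then Z j + h else Z j))
              0 0.

Definition gap_normalized (p : nat) (Z : nat -> R) : Prop :=
  sqrt (rsum (p - 1) (fun k => (Z (S k) - Z k) ^ 2)) = 1.

(* Main.v *)
(* The flow is the gradient flow of a function homogeneous of degree [1 - m], so that
   [(|X|^2)' = 2 (m - 1) F(X)] and [F(X)] decreases. A maximal solution with [T] finite blows up,
   because a lower bound on the gaps gives a uniform existence time. If [T] is infinite then
   [F(X) >= 0] for all time, and [Y = X / |X|] follows, up to a change of time, the gradient flow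
   of [F] on the unit sphere; the dissipation of [F(Y)] forces the tangential gradient to be
   [o(eps^-m)], where [eps] is the smallest gap of [Y].
   If the gaps of [Y] stayed bounded below, then [Y] would almost satisfy the Euler-Lagrange
   inequality at [chi], which by Jensen's inequality gives [chi <= C_N]. So [Y] blows up, and
   the rescaled limit on a relative blow-up set is a critical point of [F^p].
   By the same Jensen argument a critical point of [F^p] exists only for [chi = C_p], for a
   single [p], and by a maximum principle it is unique up to dilation. *)
Require Import Defs.
From Stdlib Require Import Reals Lra Lia Arith Bool ClassicalEpsilon.
From Coquelicot Require Import Coquelicot.
Open Scope R_scope.

(** * Finite sums *)

(** Two obstacles shape the argument. The conclusion concerns every sequence of times tending to
    infinity, whereas finite dissipation controls the tangential gradient [W] only along some times.
    The remedy is to weight [|W|^2] by [A^(-beta)], where [A], twice the sum of the [gap^(1-m)], is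
    a smooth substitute for the smallest gap and [A^beta] has the size of the Hessian. The growth of
    this product [g] is paid for by dissipation, so [g + K F(Y)] is nonincreasing and smallness at
    one late time persists. This gives [|W| = o(eps^(-(m+1)/2))], stronger than [o(eps^(-m))]
    because [m > 1]. Moreover a small [W] makes [Y] nearly critical on the sphere only, with
    multiplier [(m-1) F(Y)]. Since [F(Y) >= 0] and [Y] is centred, the multiplier has a favourable
    sign in the equation of each gap; on a collapsing block the rescaling kills it. A single size
    [p] is possible because a critical point with [p] particles forces [C_q > chi] for [2 <= q < p]
    and [C_q < chi] for [q > p]. *)

Lemma rsum_ext n f g :
  (forall i, (i < n)%nat -> f i = g i) -> rsum n f = rsum n g.
Proof.
  induction n as [|n IH]; intros H; simpl; [reflexivity|].
  rewrite IH by (intros; apply H; lia). rewrite (H n) by lia. reflexivity.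
Qed.

Lemma rsum_plus n f g :
  rsum n (fun i => f i + g i) = rsum n f + rsum n g.
Proof. induction n as [|n IH]; simpl; [|rewrite IH]; ring. Qed.

Lemma rsum_scal n c f : rsum n (fun i => c * f i) = c * rsum n f.
Proof. induction n as [|n IH]; simpl; [|rewrite IH]; ring. Qed.

Lemma rsum_le n f g :
  (forall i, (i < n)%nat -> f i <= g i) -> rsum n f <= rsum n g.
Proof.
  induction n as [|n IH]; intros H; simpl; [lra|].
  apply Rplus_le_compat; [apply IH; intros; apply H; lia | apply H; lia].
Qed.

Lemma rsum_const n c : rsum n (fun _ => c) = INR n * c.
Proof.
  induction n as [|n IH]; [simpl; ring|].
  change (rsum (S n) (fun _ => c)) with (rsum n (fun _ => c) + c).
  rewrite IH, S_INR. ring.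
Qed.

Lemma rsum_zero n f : (forall i, (i < n)%nat -> f i = 0) -> rsum n f = 0.
Proof.
  intros H. rewrite (rsum_ext n f (fun _ => 0)) by auto. rewrite rsum_const. ring.
Qed.

Lemma rsum_nonneg n f : (forall i, (i < n)%nat -> 0 <= f i) -> 0 <= rsum n f.
Proof.
  intros H. rewrite <- (rsum_zero n (fun _ => 0)) by auto. apply rsum_le; auto.
Qed.

Lemma rsum_pos n f :
  (0 < n)%nat -> (forall i, (i < n)%nat -> 0 < f i) -> 0 < rsum n f.
Proof.
  intros Hn H. destruct n as [|n]; [lia|]. simpl.
  assert (0 <= rsum n f) by (apply rsum_nonneg; intros; left; apply H; lia).
  assert (0 < f n) by (apply H; lia). lra.
Qed.

Lemma rsum_abs n f c :
  (forall i, (i < n)%nat -> Rabs (f i) <= c) -> Rabs (rsum n f) <= INR n * c.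
Proof.
  intros H. rewrite <- rsum_const.
  induction n as [|n IH]; simpl; [rewrite Rabs_R0; lra|].
  eapply Rle_trans; [apply Rabs_triang|].
  apply Rplus_le_compat; [apply IH; intros; apply H; lia | apply H; lia].
Qed.

Lemma rsum_term_le n f k :
  (forall i, (i < n)%nat -> 0 <= f i) -> (k < n)%nat -> f k <= rsum n f.
Proof.
  induction n as [|n IH]; intros H Hk; [lia|]. simpl.
  assert (0 <= rsum n f) by (apply rsum_nonneg; intros; apply H; lia).
  assert (0 <= f n) by (apply H; lia).
  destruct (Nat.eq_dec k n) as [->|Hn]; [lra|].
  assert (f k <= rsum n f) by (apply IH; [intros; apply H|]; lia). lra.
Qed.

Lemma rsum_swap n p f :
  rsum n (fun i => rsum p (fun j => f i j))
  = rsum p (fun j => rsum n (fun i => f i j)).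
Proof.
  induction n as [|n IH]; simpl.
  - symmetry. apply rsum_zero. reflexivity.
  - rewrite IH, <- rsum_plus. reflexivity.
Qed.

Lemma rsum_single n k (f : nat -> R) :
  (k < n)%nat -> rsum n (fun i => if (i =? k)%nat then f i else 0) = f k.
Proof.
  induction n as [|n IH]; intros Hk; [lia|]. simpl.
  destruct (Nat.eqb_spec n k) as [<-|Hn].
  - rewrite rsum_zero; [ring|]. intros i Hi.
    destruct (Nat.eqb_spec i n); [lia|reflexivity].
  - rewrite IH by lia. ring.
Qed.

Lemma rsum_is_derive n (f : nat -> R -> R) (df : nat -> R) (t : R) :
  (forall i, (i < n)%nat -> is_derive (f i) t (df i)) ->
  is_derive (fun s => rsum n (fun i => f i s)) t (rsum n df).
Proof.
  induction n as [|n IH]; intros H; simpl.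
  - apply (is_derive_const (V := R_NormedModule)).
  - apply (is_derive_plus (V := R_NormedModule)); [apply IH; intros; apply H | apply H]; lia.
Qed.

Lemma rsum_is_lim_seq n (u : nat -> nat -> R) (l : nat -> R) :
  (forall i, (i < n)%nat -> is_lim_seq (u i) (l i)) ->
  is_lim_seq (fun q => rsum n (fun i => u i q)) (rsum n l).
Proof.
  induction n as [|n IH]; intros H; simpl.
  - apply is_lim_seq_const.
  - apply is_lim_seq_plus'; [apply IH; intros; apply H | apply H]; lia.
Qed.

Lemma rsum_add l n f :
  rsum (l + n) f = rsum l f + rsum n (fun i => f (l + i)%nat).
Proof.
  induction n as [|n IH]; [rewrite Nat.add_0_r; simpl; ring|].
  rewrite Nat.add_succ_r. simpl. rewrite IH. ring.
Qed.

Lemma rsum_S_first n f : rsum (S n) f = f O + rsum n (fun i => f (S i)).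
Proof.
  replace (S n) with (1 + n)%nat by lia. rewrite rsum_add. simpl. ring.
Qed.

(** The Boolean mask keeps the summation range independent of the pair [(i, j)], so that sums over
    pairs and sums over gaps can later be exchanged. *)
Lemma rsum_telescope p i j (X : nat -> R) :
  (i <= j)%nat -> (j < p)%nat ->
  rsum (p - 1) (fun k => if (i <=? k)%nat && (k <? j)%nat
                         then X (S k) - X k else 0) = X j - X i.
Proof.
  intros Hij Hjp. replace (p - 1)%nat with (i + (p - 1 - i))%nat by lia.
  rewrite rsum_add, rsum_zero.
  2:{ intros k Hk. destruct (Nat.leb_spec i k); [lia|reflexivity]. }
  replace (p - 1 - i)%nat with ((j - i) + (p - 1 - j))%nat by lia.
  rewrite rsum_add, (rsum_zero (p - 1 - j)).
  2:{ intros k Hk. destruct (Nat.ltb_spec (i + (j - i + k)) j); [lia|].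
      rewrite andb_false_r. reflexivity. }
  rewrite (rsum_ext (j - i) _ (fun k => X (S (i + k)) - X (i + k)%nat)).
  2:{ intros k Hk. destruct (Nat.leb_spec i (i + k)); [|lia].
      destruct (Nat.ltb_spec (i + k) j); [reflexivity|lia]. }
  replace (X j) with (X (i + (j - i))%nat) by (f_equal; lia).
  clear Hjp Hij. induction (j - i)%nat as [|n IH]; simpl.
  - rewrite Nat.add_0_r. ring.
  - rewrite Nat.add_succ_r. lra.
Qed.

Lemma pairsum_ext p f g :
  (forall i j, (i < p)%nat -> (j < p)%nat -> i <> j -> f i j = g i j) ->
  pairsum p f = pairsum p g.
Proof.
  intros H. apply rsum_ext; intros i Hi. apply rsum_ext; intros j Hj.
  destruct (Nat.eqb_spec i j); auto.
Qed.

Lemma pairsum_plus p f g :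
  pairsum p (fun i j => f i j + g i j) = pairsum p f + pairsum p g.
Proof.
  unfold pairsum. rewrite <- rsum_plus. apply rsum_ext; intros i Hi.
  rewrite <- rsum_plus. apply rsum_ext; intros j Hj.
  destruct (i =? j)%nat; ring.
Qed.

Lemma pairsum_scal p c f :
  pairsum p (fun i j => c * f i j) = c * pairsum p f.
Proof.
  unfold pairsum. rewrite <- rsum_scal. apply rsum_ext; intros i Hi.
  rewrite <- rsum_scal. apply rsum_ext; intros j Hj.
  destruct (i =? j)%nat; ring.
Qed.

Lemma pairsum_swap p f : pairsum p f = pairsum p (fun i j => f j i).
Proof.
  unfold pairsum. rewrite rsum_swap. apply rsum_ext; intros i Hi.
  apply rsum_ext; intros j Hj. rewrite Nat.eqb_sym. reflexivity.
Qed.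

Lemma pairsum_is_derive p (f : nat -> nat -> R -> R) (df : nat -> nat -> R) t :
  (forall i j, (i < p)%nat -> (j < p)%nat -> i <> j ->
     is_derive (f i j) t (df i j)) ->
  is_derive (fun s => pairsum p (fun i j => f i j s)) t (pairsum p df).
Proof.
  intros H. unfold pairsum.
  apply (rsum_is_derive p (fun i s => rsum p (fun j => if (i =? j)%nat then 0 else f i j s))).
  intros i Hi.
  apply (rsum_is_derive p (fun j s => if (i =? j)%nat then 0 else f i j s)).
  intros j Hj. destruct (Nat.eqb_spec i j); auto.
  apply (is_derive_const (V := R_NormedModule)).
Qed.

Lemma pairsum_upper p f :
  (forall i j, f i j = f j i) ->
  pairsum p f = 2 * rsum p (fun i => rsum p (fun j => if (i <? j)%nat then f i j else 0)).
Proof.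
  intros Hs.
  replace (pairsum p f) with
    (rsum p (fun i => rsum p (fun j => if (i <? j)%nat then f i j else 0))
     + rsum p (fun i => rsum p (fun j => if (j <? i)%nat then f j i else 0))).
  - rewrite (rsum_swap p p (fun i j => if (j <? i)%nat then f j i else 0)). ring.
  - unfold pairsum. rewrite <- rsum_plus. apply rsum_ext; intros i Hi.
    rewrite <- rsum_plus. apply rsum_ext; intros j Hj. rewrite (Hs j i).
    destruct (Nat.eqb_spec i j), (Nat.ltb_spec i j), (Nat.ltb_spec j i); try lia; ring.
Qed.

(** * Pair interactions *)

Definition incr (p : nat) (X : nat -> R) : Prop :=
  forall i, (S i < p)%nat -> X i < X (S i).

Lemma incr_lt p X i j : incr p X -> (i < j)%nat -> (j < p)%nat -> X i < X j.
Proof.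
  intros HX Hij. induction Hij as [|j Hij IH]; intros Hj; [auto|].
  apply Rlt_trans with (X j); [apply IH; lia | apply HX; lia].
Qed.

Lemma incr_le p X i j : incr p X -> (i <= j)%nat -> (j < p)%nat -> X i <= X j.
Proof.
  intros HX Hij Hj. destruct (Nat.eq_dec i j) as [->|Hn]; [lra|].
  left. apply (incr_lt p); auto; lia.
Qed.

(** The sign is read off the indices: for [i <> j] on an increasing configuration it is the sign of
    [X j - X i], and it stays constant under differentiation. *)
Definition sgn (i j : nat) : R := if (i <? j)%nat then 1 else -1.

Lemma sgn_opp i j : i <> j -> sgn j i = - sgn i j.
Proof.
  intros H. unfold sgn. destruct (Nat.ltb_spec i j), (Nat.ltb_spec j i); try lia; ring.
Qed.

Lemma sgn_sqr i j : sgn i j * sgn i j = 1.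
Proof. unfold sgn. destruct (i <? j)%nat; ring. Qed.

Lemma Rabs_sgn i j : Rabs (sgn i j) = 1.
Proof.
  unfold sgn. destruct (i <? j)%nat;
    [apply Rabs_R1 | rewrite Rabs_left; lra].
Qed.

Lemma incr_abs p X i j :
  incr p X -> (i < p)%nat -> (j < p)%nat -> i <> j ->
  Rabs (X j - X i) = sgn i j * (X j - X i) /\ 0 < sgn i j * (X j - X i).
Proof.
  intros HX Hi Hj Hij. unfold sgn. destruct (Nat.ltb_spec i j).
  - assert (X i < X j) by (apply (incr_lt p); auto).
    rewrite Rabs_pos_eq; lra.
  - assert (X j < X i) by (apply (incr_lt p); auto; lia).
    rewrite Rabs_left; lra.
Qed.

Lemma is_derive_Rpower (e x : R) :
  0 < x -> is_derive (fun y => Rpower y e) x (e * Rpower x (e - 1)).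
Proof.
  intros Hx. apply is_derive_Reals. apply derivable_pt_lim_power. exact Hx.
Qed.

(** The sign of a nonzero difference is locally constant, so near [t] the absolute value coincides
    with the signed difference, which is differentiable. *)
Lemma is_derive_pair p (c : R -> nat -> R) (dc : nat -> R) t e i j :
  incr p (c t) -> (i < p)%nat -> (j < p)%nat -> i <> j ->
  is_derive (fun s => c s i) t (dc i) -> is_derive (fun s => c s j) t (dc j) ->
  is_derive (fun s => Rpower (Rabs (c s j - c s i)) e) t
    (e * Rpower (Rabs (c t j - c t i)) (e - 1) * (sgn i j * (dc j - dc i))).
Proof.
  intros HX Hi Hj Hij Di Dj.
  destruct (incr_abs p (c t) i j HX Hi Hj Hij) as [Ha Hp].
  assert (D : is_derive (fun s => sgn i j * (c s j - c s i)) t (sgn i j * (dc j - dc i))).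
  { apply (is_derive_scal (fun s => c s j - c s i)).
    apply (is_derive_minus (V := R_NormedModule)); auto. }
  apply (is_derive_ext_loc (fun s => Rpower (sgn i j * (c s j - c s i)) e)).
  - assert (Cn : continuous (fun s => sgn i j * (c s j - c s i)) t).
    { apply (ex_derive_continuous (V := R_NormedModule)). eexists; exact D. }
    assert (L : locally t (fun s => 0 < sgn i j * (c s j - c s i))).
    { apply (Cn (fun y => 0 < y)). apply (open_gt 0). exact Hp. }
    revert L. apply filter_imp. intros s Hs. f_equal.
    rewrite <- (Rabs_pos_eq _ (Rlt_le _ _ Hs)), Rabs_mult, Rabs_sgn. ring.
  - rewrite Ha.
    replace (e * Rpower (sgn i j * (c t j - c t i)) (e - 1) * (sgn i j * (dc j - dc i)))
      with (scal (sgn i j * (dc j - dc i)) (e * Rpower (sgn i j * (c t j - c t i)) (e - 1))).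
    2:{ unfold scal; simpl; unfold mult; simpl; ring. }
    apply (is_derive_comp (fun y => Rpower y e) (fun s => sgn i j * (c s j - c s i))); auto.
    apply is_derive_Rpower. exact Hp.
Qed.

(* The pair interaction of the gradient system: its vector field is [force]
   with [kap chi] and the kernel [x^(-m)], and its energy is [-energy/(2(m-1))]. *)
Definition force (N : nat) (ka : nat -> nat -> R) (phi : R -> R)
    (X : nat -> R) (i : nat) : R :=
  rsum N (fun j => if (i =? j)%nat then 0
                   else ka i j * sgn i j * phi (Rabs (X j - X i))).

Definition energy (N : nat) (ka : nat -> nat -> R) (m : R) (X : nat -> R) : R :=
  pairsum N (fun i j => ka i j * Rpower (Rabs (X i - X j)) (1 - m)).

Definition pw (m x : R) : R := Rpower x (- m).

Definition adj (i j : nat) : R :=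
  if ((S i =? j)%nat || (S j =? i)%nat)%bool then 1 else 0.

(** Attraction of strength [2 chi] between all particles minus the unit repulsion between
    neighbours: one symmetric weight carries the whole system. *)
Definition kap (chi : R) (i j : nat) : R := 2 * chi - adj i j.

Definition sym (ka : nat -> nat -> R) : Prop := forall i j, ka i j = ka j i.

Lemma adj_sym : sym adj.
Proof. intros i j. unfold adj. rewrite orb_comm. reflexivity. Qed.

Lemma kap_sym chi : sym (kap chi).
Proof. intros i j. unfold kap. rewrite adj_sym. reflexivity. Qed.

Lemma adj_bound i j : Rabs (adj i j) <= 1.
Proof.
  unfold adj. destruct (_ || _)%bool; [rewrite Rabs_R1 | rewrite Rabs_R0]; lra.
Qed.

Lemma kap_bound chi i j : Rabs (kap chi i j) <= 2 * Rabs chi + 1.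
Proof.
  unfold kap. pose proof (adj_bound i j).
  eapply Rle_trans; [apply Rabs_triang|]. rewrite Rabs_Ropp, Rabs_mult.
  rewrite (Rabs_pos_eq 2) by lra. lra.
Qed.

(** Action equals reaction: the two orders of each pair are added. The choice of [d] yields the
    basic identities: [d = 1] gives conservation of the centre of mass, [d = X] Euler's identity,
    and the indicator of the indices above [k] the equation of gap [k]. *)
Lemma force_pairsum N ka phi X d :
  sym ka ->
  2 * rsum N (fun i => d i * force N ka phi X i)
  = pairsum N (fun i j => (d i - d j) * (ka i j * sgn i j * phi (Rabs (X j - X i)))).
Proof.
  intros Hs.
  assert (E : rsum N (fun i => d i * force N ka phi X i)
     = pairsum N (fun i j => d i * (ka i j * sgn i j * phi (Rabs (X j - X i))))).
  { apply rsum_ext; intros i Hi. unfold force. rewrite <- rsum_scal.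
    apply rsum_ext; intros j Hj. destruct (i =? j)%nat; ring. }
  rewrite E. replace (2 * pairsum N _) with
    (pairsum N (fun i j => d i * (ka i j * sgn i j * phi (Rabs (X j - X i))))
     + pairsum N (fun i j => d i * (ka i j * sgn i j * phi (Rabs (X j - X i))))) by ring.
  rewrite (pairsum_swap N) at 1. rewrite <- pairsum_plus. apply pairsum_ext.
  intros i j Hi Hj Hij. rewrite (Hs j i), (sgn_opp i j) by auto.
  rewrite (Rabs_minus_sym (X i)). ring.
Qed.

Lemma force_sum N ka phi X : sym ka -> rsum N (force N ka phi X) = 0.
Proof.
  intros Hs. pose proof (force_pairsum N ka phi X (fun _ => 1) Hs) as E.
  rewrite (pairsum_ext N _ (fun i j => 0 * 0)) in E by (intros; ring).
  rewrite pairsum_scal in E.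
  rewrite (rsum_ext N _ (force N ka phi X)) in E by (intros; ring). lra.
Qed.

(** An arbitrary curve and an arbitrary weight are allowed because the formula serves for partial
    derivatives, for the dissipation of [Fpm], and for the energy of weight [adj] along a flow
    driven by [kap chi]. *)
Lemma energy_is_derive N ka m (c : R -> nat -> R) (dc : nat -> R) t :
  sym ka -> incr N (c t) ->
  (forall i, (i < N)%nat -> is_derive (fun s => c s i) t (dc i)) ->
  is_derive (fun s => energy N ka m (c s)) t
    (2 * (m - 1) * rsum N (fun i => dc i * force N ka (pw m) (c t) i)).
Proof.
  intros Hs HX D.
  replace (2 * (m - 1) * rsum N (fun i => dc i * force N ka (pw m) (c t) i)) with
    (pairsum N (fun i j => ka i j * ((1 - m) * Rpower (Rabs (c t i - c t j)) (1 - m - 1)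
        * (sgn j i * (dc i - dc j))))).
  - apply (pairsum_is_derive N (fun i j s => ka i j * Rpower (Rabs (c s i - c s j)) (1 - m))).
    intros i j Hi Hj Hij.
    apply (is_derive_scal (fun s => Rpower (Rabs (c s i - c s j)) (1 - m))).
    apply (is_derive_pair N); auto.
  - rewrite (Rmult_comm 2), Rmult_assoc, force_pairsum, <- pairsum_scal by auto.
    apply pairsum_ext. intros i j Hi Hj Hij. unfold pw.
    rewrite (sgn_opp i j), (Rabs_minus_sym (c t i)) by auto.
    replace (1 - m - 1) with (- m) by ring. ring.
Qed.

Lemma Rpower_pred (x e : R) : 0 < x -> x * Rpower x (e - 1) = Rpower x e.
Proof.
  intros Hx. rewrite <- (Rpower_1 x Hx) at 1. rewrite <- Rpower_plus.
  f_equal. ring.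
Qed.

Lemma Rpower_pos x e : 0 < Rpower x e.
Proof. apply exp_pos. Qed.

Lemma energy_force N ka m X :
  sym ka -> incr N X ->
  rsum N (fun i => X i * force N ka (pw m) X i) = - / 2 * energy N ka m X.
Proof.
  intros Hs HX. pose proof (force_pairsum N ka (pw m) X X Hs) as E.
  rewrite (pairsum_ext N _ (fun i j => -1 * (ka i j * Rpower (Rabs (X i - X j)) (1 - m)))) in E.
  - rewrite pairsum_scal in E. unfold energy. lra.
  - intros i j Hi Hj Hij. unfold pw. rewrite (Rabs_minus_sym (X i)).
    destruct (incr_abs N X i j HX Hi Hj Hij) as [Ha Hp].
    rewrite Ha. rewrite <- (Rpower_pred _ (1 - m)) by lra.
    replace (1 - m - 1) with (- m) by ring. ring.
Qed.

Lemma adj_sum N i (g : nat -> R) :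
  (i < N)%nat ->
  rsum N (fun j => if (i =? j)%nat then 0 else adj i j * g j)
  = (if (S i <? N)%nat then g (S i) else 0) + (if (0 <? i)%nat then g (pred i) else 0).
Proof.
  intros Hi.
  rewrite (rsum_ext N _ (fun j => (if (j =? S i)%nat then g j else 0)
      + (if (j =? pred i)%nat then (if (0 <? i)%nat then g j else 0) else 0))).
  - rewrite rsum_plus. f_equal.
    + destruct (Nat.ltb_spec (S i) N).
      * apply rsum_single; auto.
      * apply rsum_zero. intros j Hj. destruct (Nat.eqb_spec j (S i)); [lia|reflexivity].
    + apply (rsum_single N (pred i) (fun j => if (0 <? i)%nat then g j else 0)). lia.
  - intros j Hj. unfold adj.
    destruct (Nat.eqb_spec i j), (Nat.eqb_spec (S i) j), (Nat.eqb_spec (S j) i),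
      (Nat.eqb_spec j (S i)), (Nat.eqb_spec j (pred i)), (Nat.ltb_spec 0 i);
      simpl; try lia; ring.
Qed.

Lemma vfield_force N m chi X i :
  incr N X -> (i < N)%nat -> vfield N m chi X i = force N (kap chi) (pw m) X i.
Proof.
  intros HX Hi. unfold vfield, force.
  rewrite (rsum_ext N (fun j => if (i =? j)%nat then 0 else _) (fun j =>
     2 * chi * (if (j =? i)%nat then 0
       else if (i <? j)%nat then Rpower (Rabs (X j - X i)) (- m)
       else - Rpower (Rabs (X j - X i)) (- m))
     + -1 * (if (i =? j)%nat then 0 else adj i j * (sgn i j * pw m (Rabs (X j - X i)))))).
  - rewrite rsum_plus, !rsum_scal, adj_sum by auto. unfold pw.
    replace (if (S i <? N)%nat then sgn i (S i) * Rpower (Rabs (X (S i) - X i)) (- m) else 0)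
      with (if (S i <? N)%nat then Rpower (X (S i) - X i) (- m) else 0).
    replace (if (0 <? i)%nat then sgn i (pred i) * Rpower (Rabs (X (pred i) - X i)) (- m) else 0)
      with (if (0 <? i)%nat then - Rpower (X i - X (pred i)) (- m) else 0).
    + destruct (S i <? N)%nat, (0 <? i)%nat; ring.
    + destruct (Nat.ltb_spec 0 i); [|reflexivity].
      assert (X (pred i) < X i) by (apply (incr_lt N); auto; lia).
      unfold sgn. destruct (Nat.ltb_spec i (pred i)); [lia|].
      rewrite Rabs_left by lra. rewrite Ropp_minus_distr. ring.
    + destruct (Nat.ltb_spec (S i) N); [|reflexivity].
      unfold sgn. destruct (Nat.ltb_spec i (S i)); [|lia].
      rewrite Rabs_pos_eq by (specialize (HX i ltac:(auto)); lra). ring.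
  - intros j Hj. rewrite (Nat.eqb_sym j i). unfold kap, sgn, pw.
    destruct (i =? j)%nat; [ring|]. destruct (i <? j)%nat; ring.
Qed.

Definition gapsum (p : nat) (m : R) (X : nat -> R) : R :=
  rsum (p - 1) (fun i => Rpower (X (S i) - X i) (1 - m)).

Definition pairpow (p : nat) (m : R) (X : nat -> R) : R :=
  pairsum p (fun i j => Rpower (Rabs (X i - X j)) (1 - m)).

Lemma energy_adj p m X : incr p X -> energy p adj m X = 2 * gapsum p m X.
Proof.
  intros HX. unfold energy, pairsum, gapsum.
  rewrite (rsum_ext p _ (fun i =>
     (if (S i <? p)%nat then Rpower (X (S i) - X i) (1 - m) else 0)
     + (if (0 <? i)%nat then Rpower (X i - X (pred i)) (1 - m) else 0))).
  - destruct p as [|p]; [simpl; ring|].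
    rewrite rsum_plus. rewrite (rsum_S_first p (fun i => if (0 <? i)%nat then _ else 0)).
    simpl. rewrite (proj2 (Nat.ltb_ge (S p) (S p))) by lia. rewrite Nat.sub_0_r.
    rewrite (rsum_ext p (fun i => if (S i <? S p)%nat then _ else 0)
      (fun i => Rpower (X (S i) - X i) (1 - m))).
    + rewrite (rsum_ext p (fun i => Rpower (X (S i) - X i) (1 - m))
       (fun i => if (0 <? S i)%nat then Rpower (X (S i) - X i) (1 - m) else 0)) at 2; [|reflexivity].
      simpl. ring.
    + intros i Hi. destruct (Nat.ltb_spec (S i) (S p)); [reflexivity|lia].
  - intros i Hi. rewrite (adj_sum p i (fun j => Rpower (Rabs (X i - X j)) (1 - m))) by auto.
    f_equal.
    + destruct (Nat.ltb_spec (S i) p); [|reflexivity]. specialize (HX i ltac:(auto)).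
      rewrite Rabs_left by lra. rewrite Ropp_minus_distr. reflexivity.
    + destruct (Nat.ltb_spec 0 i); [|reflexivity].
      assert (X (pred i) < X i) by (apply (incr_lt p); auto; lia).
      rewrite Rabs_pos_eq by lra. reflexivity.
Qed.

Lemma energy_kap p m chi X :
  incr p X -> energy p (kap chi) m X = 2 * (chi * pairpow p m X - gapsum p m X).
Proof.
  intros HX. replace (2 * (chi * pairpow p m X - gapsum p m X)) with
    (2 * chi * pairpow p m X + -1 * energy p adj m X) by (rewrite energy_adj by auto; ring).
  unfold energy, pairpow. rewrite <- !pairsum_scal, <- pairsum_plus.
  apply pairsum_ext. intros. unfold kap. ring.
Qed.

Lemma Fpm_gapsum p m chi X :
  Fpm p m chi X = (gapsum p m X - chi * pairpow p m X) / (m - 1).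
Proof. unfold Fpm, gapsum, pairpow, Rdiv. ring. Qed.

Lemma Fpm_energy p m chi X :
  incr p X -> 1 < m -> Fpm p m chi X = - energy p (kap chi) m X / (2 * (m - 1)).
Proof.
  intros HX Hm. rewrite Fpm_gapsum, energy_kap by auto. field. lra.
Qed.

(** * Critical points and the constants [C_p] *)

(* The derivative of [pairpow] in the gap [Z (k+1) - Z k] is [- 2 (m - 1) cross]. *)
Definition cross (p : nat) (m : R) (Z : nat -> R) (k : nat) : R :=
  rsum p (fun i => rsum p (fun j =>
    if (i <=? k)%nat && (k <? j)%nat then Rpower (Z j - Z i) (- m) else 0)).

(** Internal forces of the group above [k] cancel, so only pairs straddling gap [k] contribute.
    Equations for positions become an equation for a single gap. *)
Lemma force_above N ka m X k :
  sym ka -> incr N X ->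
  rsum N (fun i => (if (k <? i)%nat then 1 else 0) * force N ka (pw m) X i)
  = - rsum N (fun i => rsum N (fun j =>
        if (i <=? k)%nat && (k <? j)%nat then ka i j * Rpower (X j - X i) (- m) else 0)).
Proof.
  intros Hs HX.
  pose proof (force_pairsum N ka (pw m) X (fun i => if (k <? i)%nat then 1 else 0) Hs) as E.
  rewrite pairsum_upper in E.
  - apply (Rmult_eq_reg_l 2); [|lra]. rewrite E. apply f_equal.
    match goal with |- _ = - ?s => replace (- s) with (-1 * s) by ring end.
    rewrite <- rsum_scal. apply rsum_ext; intros i Hi.
    rewrite <- rsum_scal. apply rsum_ext; intros j Hj. unfold pw, sgn.
    destruct (Nat.ltb_spec i j) as [Hij|Hij].
    + assert (X i < X j) by (apply (incr_lt N); auto).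
      rewrite Rabs_pos_eq by lra.
      destruct (Nat.ltb_spec k i), (Nat.ltb_spec k j), (Nat.leb_spec i k); try lia; simpl; ring.
    + destruct (Nat.leb_spec i k), (Nat.ltb_spec k j); try lia; simpl; ring.
  - intros i j. rewrite (Hs j i), (Rabs_minus_sym (X i)).
    destruct (Nat.eq_dec i j) as [->|Hij]; [ring|]. rewrite (sgn_opp i j) by auto. ring.
Qed.

Lemma force_above_kap N m chi X k :
  incr N X -> (S k < N)%nat ->
  rsum N (fun i => (if (k <? i)%nat then 1 else 0) * force N (kap chi) (pw m) X i)
  = Rpower (X (S k) - X k) (- m) - 2 * chi * cross N m X k.
Proof.
  intros HX Hk. rewrite force_above by (auto using kap_sym).
  rewrite (rsum_ext N _ (fun i =>
    2 * chi * rsum N (fun j => if (i <=? k)%nat && (k <? j)%nat then Rpower (X j - X i) (- m) else 0)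
    + -1 * (if (i =? k)%nat then Rpower (X (S k) - X k) (- m) else 0))).
  - rewrite rsum_plus, !rsum_scal.
    rewrite (rsum_single N k (fun _ => Rpower (X (S k) - X k) (- m))) by lia.
    unfold cross. ring.
  - intros i Hi. rewrite <- rsum_scal.
    replace (if (i =? k)%nat then Rpower (X (S k) - X k) (- m) else 0) with
      (rsum N (fun j => if (j =? S k)%nat then
          (if (i =? k)%nat then Rpower (X (S k) - X k) (- m) else 0) else 0))
      by (apply (rsum_single N (S k) (fun _ => if (i =? k)%nat then Rpower (X (S k) - X k) (- m) else 0)); auto).
    rewrite <- rsum_scal, <- rsum_plus. apply rsum_ext; intros j Hj.
    unfold kap, adj.
    destruct (Nat.eqb_spec j (S k)) as [->|Hj'].
    + destruct (Nat.eqb_spec i k) as [->|Hi'].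
      * rewrite (proj2 (Nat.leb_le k k)), (proj2 (Nat.ltb_lt k (S k))), Nat.eqb_refl by lia.
        simpl. ring.
      * destruct (Nat.leb_spec i k), (Nat.ltb_spec k (S k)), (Nat.eqb_spec (S i) (S k)),
         (Nat.eqb_spec (S (S k)) i); try lia; simpl; ring.
    + destruct (Nat.leb_spec i k), (Nat.ltb_spec k j), (Nat.eqb_spec (S i) j),
         (Nat.eqb_spec (S j) i); try lia; simpl; ring.
Qed.

(** * Jensen's inequality for the pair interaction *)

Lemma Rpower_base_1 e : Rpower 1 e = 1.
Proof. unfold Rpower. rewrite ln_1, Rmult_0_r. apply exp_0. Qed.

(** Convexity of [t^(1-m)] in the form of its tangent at 1, from two uses of [1 + x <= exp x]. *)
Lemma Rpower_Bernoulli m t : 1 < m -> 0 < t -> 1 + (1 - m) * (t - 1) <= Rpower t (1 - m).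
Proof.
  intros Hm Ht. unfold Rpower.
  assert (ln t <= t - 1).
  { pose proof (exp_ineq1_le (ln t)) as H. rewrite exp_ln in H by auto. lra. }
  pose proof (exp_ineq1_le ((1 - m) * ln t)). nra.
Qed.

(** This is the tangent of the power [1 - m] at [v], evaluated at the ratio [x / z] and multiplied
    by the weight [z]. *)
Lemma Rpower_tangent m x z v :
  1 < m -> 0 < x -> 0 < z -> 0 < v ->
  z * Rpower v (1 - m) + (1 - m) * Rpower v (- m) * (x - v * z)
  <= Rpower x (1 - m) * Rpower z m.
Proof.
  intros Hm Hx Hz Hv.
  assert (Hzv : 0 < z * v) by (apply Rmult_lt_0_compat; auto).
  assert (Ht : 0 < x / (z * v)) by (apply Rdiv_lt_0_compat; auto).
  set (t := x / (z * v)) in *.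
  assert (Ex : x = t * (z * v)) by (unfold t; field; lra).
  rewrite Ex. rewrite <- !Rpower_mult_distr by auto.
  rewrite <- (Rpower_pred v (1 - m)) by auto.
  replace (1 - m - 1) with (- m) by ring.
  assert (Ez : Rpower z (1 - m) * Rpower z m = z).
  { rewrite <- Rpower_plus. replace (1 - m + m) with 1 by ring. apply Rpower_1; auto. }
  replace (Rpower t (1 - m) * (Rpower z (1 - m) * (v * Rpower v (- m))) * Rpower z m)
    with ((Rpower z (1 - m) * Rpower z m) * (v * Rpower v (- m)) * Rpower t (1 - m)) by ring.
  rewrite Ez.
  replace (z * (v * Rpower v (- m)) + (1 - m) * Rpower v (- m) * (t * (z * v) - v * z))
    with (z * (v * Rpower v (- m)) * (1 + (1 - m) * (t - 1))) by ring.
  apply Rmult_le_compat_l.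
  - apply Rmult_le_pos; [lra|]. apply Rmult_le_pos; [lra|left; apply Rpower_pos].
  - apply Rpower_Bernoulli; auto.
Qed.

Lemma Rpower_opp_cancel x e : Rpower x (- e) * Rpower x e = 1.
Proof.
  rewrite <- Rpower_plus. replace (- e + e) with 0 by ring.
  unfold Rpower. rewrite Rmult_0_l. apply exp_0.
Qed.

(* Jensen's inequality for [x^(1-m)] applied to the ratios
   [(X (k+1) - X k) / (Z (k+1) - Z k)] with weights [Z (k+1) - Z k]. *)
Lemma pair_jensen p m X Z i j :
  1 < m -> incr p X -> incr p Z -> (i < j)%nat -> (j < p)%nat ->
  Rpower (X j - X i) (1 - m) <=
  Rpower (Z j - Z i) (- m) * rsum (p - 1) (fun k =>
    if (i <=? k)%nat && (k <? j)%nat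
    then Rpower (X (S k) - X k) (1 - m) * Rpower (Z (S k) - Z k) m else 0).
Proof.
  intros Hm HX HZ Hij Hj.
  assert (HS : 0 < X j - X i) by (pose proof (incr_lt p X i j HX Hij Hj); lra).
  assert (HT : 0 < Z j - Z i) by (pose proof (incr_lt p Z i j HZ Hij Hj); lra).
  assert (Hv : 0 < (X j - X i) / (Z j - Z i)) by (apply Rdiv_lt_0_compat; auto).
  (* By telescoping, [v] is the mean of the gap ratios with the gaps of [Z] as weights; with this
     choice the linear terms of the tangents sum to zero. *)
  set (v := (X j - X i) / (Z j - Z i)) in *.
  assert (ES : X j - X i = v * (Z j - Z i)) by (unfold v; field; lra).
  assert (Hlow : (Z j - Z i) * Rpower v (1 - m) <= rsum (p - 1) (fun k =>
    if (i <=? k)%nat && (k <? j)%nat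
    then Rpower (X (S k) - X k) (1 - m) * Rpower (Z (S k) - Z k) m else 0)).
  { replace ((Z j - Z i) * Rpower v (1 - m)) with
      (rsum (p - 1) (fun k => if (i <=? k)%nat && (k <? j)%nat then
         (Z (S k) - Z k) * Rpower v (1 - m)
         + (1 - m) * Rpower v (- m) * ((X (S k) - X k) - v * (Z (S k) - Z k)) else 0)).
    - apply rsum_le; intros k Hk.
      destruct (_ && _); [|lra].
      apply Rpower_tangent; auto; [specialize (HX k ltac:(lia)) | specialize (HZ k ltac:(lia))]; lra.
    - rewrite (rsum_ext _ _ (fun k =>
        Rpower v (1 - m) * (if (i <=? k)%nat && (k <? j)%nat then Z (S k) - Z k else 0)
        + ((1 - m) * Rpower v (- m)) * ((if (i <=? k)%nat && (k <? j)%nat then X (S k) - X k else 0)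
           + (- v) * (if (i <=? k)%nat && (k <? j)%nat then Z (S k) - Z k else 0)))).
      2:{ intros k Hk. destruct (_ && _); ring. }
      rewrite rsum_plus, !rsum_scal, rsum_plus, rsum_scal, !rsum_telescope by lia.
      rewrite ES. ring. }
  rewrite ES. rewrite <- Rpower_mult_distr by auto.
  replace (Rpower v (1 - m) * Rpower (Z j - Z i) (1 - m)) with
    (Rpower (Z j - Z i) (- m) * ((Z j - Z i) * Rpower v (1 - m))).
  - apply Rmult_le_compat_l; [left; apply Rpower_pos | exact Hlow].
  - rewrite <- (Rpower_pred (Z j - Z i) (1 - m)) by auto.
    replace (1 - m - 1) with (- m) by ring. ring.
Qed.

Lemma pairpow_upper p m X :
  incr p X -> pairpow p m X = 2 * rsum p (fun i => rsum p (fun j =>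
     if (i <? j)%nat then Rpower (X j - X i) (1 - m) else 0)).
Proof.
  intros HX. unfold pairpow. rewrite pairsum_upper.
  - f_equal. apply rsum_ext; intros i Hi. apply rsum_ext; intros j Hj.
    destruct (Nat.ltb_spec i j); [|reflexivity].
    assert (X i < X j) by (apply (incr_lt p); auto).
    rewrite Rabs_left by lra. f_equal. ring.
  - intros i j. rewrite Rabs_minus_sym. reflexivity.
Qed.

(** Summing [pair_jensen] over all pairs collects exactly the weight [cross] at gap [k], so
    inequalities at the gaps of one [Z] control every [X]. Here [theta] is 1 for a critical [Z],
    above 1 for a nearly critical one, and below 1 when removed particles leave slack. *)
Lemma pairpow_le_of_cross p m chi theta Z X :
  1 < m -> 0 <= chi -> incr p Z -> incr p X ->
  (forall k, (S k < p)%nat ->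
     2 * chi * cross p m Z k <= theta * Rpower (Z (S k) - Z k) (- m)) ->
  chi * pairpow p m X <= theta * gapsum p m X.
Proof.
  intros Hm Hchi HZ HX H.
  (* The power [m] of the gap of [Z] comes from Jensen and cancels the power [- m] in the
     hypothesis. *)
  set (a := fun k => Rpower (X (S k) - X k) (1 - m) * Rpower (Z (S k) - Z k) m).
  assert (Hp : pairpow p m X <= 2 * rsum (p - 1) (fun k => a k * cross p m Z k)).
  { rewrite pairpow_upper by auto. apply Rmult_le_compat_l; [lra|].
    apply Rle_trans with (rsum p (fun i => rsum p (fun j => rsum (p - 1) (fun k =>
      a k * if (i <=? k)%nat && (k <? j)%nat then Rpower (Z j - Z i) (- m) else 0)))).
    - apply rsum_le; intros i Hi. apply rsum_le; intros j Hj.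
      destruct (Nat.ltb_spec i j).
      + eapply Rle_trans; [apply (pair_jensen p m X Z i j); auto|].
        rewrite <- rsum_scal. apply Req_le. apply rsum_ext; intros k Hk. unfold a.
        destruct (_ && _); ring.
      + apply rsum_nonneg; intros k Hk.
        destruct (Nat.leb_spec i k), (Nat.ltb_spec k j); try lia; simpl; lra.
    - apply Req_le. unfold cross.
      rewrite (rsum_ext p _ (fun i => rsum (p - 1) (fun k => rsum p (fun j =>
        a k * if (i <=? k)%nat && (k <? j)%nat then Rpower (Z j - Z i) (- m) else 0)))).
      2:{ intros i Hi. apply rsum_swap. }
      rewrite rsum_swap. apply rsum_ext; intros k Hk.
      rewrite <- rsum_scal. apply rsum_ext; intros i Hi. apply rsum_scal. }
  apply Rle_trans with (chi * (2 * rsum (p - 1) (fun k => a k * cross p m Z k))).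
  - apply Rmult_le_compat_l; auto.
  - unfold gapsum. rewrite <- Rmult_assoc, <- !rsum_scal. apply rsum_le; intros k Hk.
    replace (theta * Rpower (X (S k) - X k) (1 - m)) with
      (a k * (theta * Rpower (Z (S k) - Z k) (- m))).
    + replace (chi * 2 * (a k * cross p m Z k)) with (a k * (2 * chi * cross p m Z k)) by ring.
      apply Rmult_le_compat_l; [|apply H; lia].
      apply Rmult_le_pos; left; apply Rpower_pos.
    + unfold a. pose proof (Rpower_opp_cancel (Z (S k) - Z k) m) as E.
      replace (Rpower (X (S k) - X k) (1 - m) * Rpower (Z (S k) - Z k) m
                 * (theta * Rpower (Z (S k) - Z k) (- m)))
        with (theta * Rpower (X (S k) - X k) (1 - m)
           * (Rpower (Z (S k) - Z k) (- m) * Rpower (Z (S k) - Z k) m)) by ring.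
      rewrite E. ring.
Qed.

Lemma gapsum_pos p m X : (2 <= p)%nat -> 0 < gapsum p m X.
Proof. intros Hp. apply rsum_pos; [lia|]. intros. apply Rpower_pos. Qed.

Lemma Rpower_opp_le x y e : 0 <= e -> 0 < x -> x <= y -> Rpower y (- e) <= Rpower x (- e).
Proof.
  intros He Hx Hxy. rewrite !Rpower_Ropp. apply Rinv_le_contravar; [apply Rpower_pos|].
  apply Rle_Rpower_l; lra.
Qed.

(** For [i < j] the distance is at least gap [i], and at most [p - 1] indices follow [i]. This makes
    the supremum behind [Cp] finite and later yields [2 chi (p - 1) >= 1]. *)
Lemma pairpow_le p m X :
  1 < m -> incr p X -> (2 <= p)%nat -> pairpow p m X <= 2 * INR (p - 1) * gapsum p m X.
Proof.
  intros Hm HX Hp. rewrite pairpow_upper by auto.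
  rewrite Rmult_assoc. apply Rmult_le_compat_l; [lra|].
  destruct p as [|p]; [lia|]. rewrite Nat.sub_succ, Nat.sub_0_r.
  unfold gapsum. rewrite Nat.sub_succ, Nat.sub_0_r.
  match goal with |- rsum (S p) ?f <= _ => change (rsum (S p) f) with (rsum p f + f p) end.
  cbv beta. rewrite (rsum_zero (S p)).
  2:{ intros j Hj. destruct (Nat.ltb_spec p j); [lia|reflexivity]. }
  rewrite Rplus_0_r, <- rsum_scal. apply rsum_le; intros i Hi.
  rewrite rsum_S_first. simpl. rewrite Rplus_0_l, <- rsum_const.
  apply rsum_le; intros j Hj. destruct (Nat.ltb_spec i (S j)); [|left; apply Rpower_pos].
  replace (1 - m) with (- (m - 1)) by ring.
  assert (X i < X (S i)) by (apply HX; lia).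
  assert (X (S i) <= X (S j)) by (apply (incr_le (S p)); auto; lia).
  apply Rpower_opp_le; lra.
Qed.

(** * The constant [Cp] as an optimal constant *)

Lemma inR_incr p X : inR p X -> incr p X.
Proof. intros [H _]; exact H. Qed.

Definition center (p : nat) (X : nat -> R) : nat -> R :=
  fun i => X i - rsum p X / INR p.

Lemma center_inR p X : (0 < p)%nat -> incr p X -> inR p (center p X).
Proof.
  intros Hp HX. assert (INR p <> 0) by (apply not_0_INR; lia). split.
  - intros i Hi. specialize (HX i Hi). unfold center. lra.
  - unfold center. rewrite (rsum_ext p _ (fun i => X i + - (rsum p X / INR p))) by (intros; ring).
    rewrite rsum_plus, rsum_const. field; auto.
Qed.

Lemma gapsum_center p q m X : gapsum p m (center q X) = gapsum p m X.
Proof. apply rsum_ext; intros. unfold center. f_equal. ring. Qed.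

Lemma pairpow_center p q m X : pairpow p m (center q X) = pairpow p m X.
Proof. apply pairsum_ext; intros. unfold center. do 2 f_equal. ring. Qed.

Lemma Cratio_eq p m X : Cratio p m X = pairpow p m X / gapsum p m X.
Proof.
  unfold Cratio, pairpow, gapsum. f_equal. apply pairsum_ext; intros.
  rewrite Rabs_minus_sym. reflexivity.
Qed.

Lemma pairpow_pos p m X : (2 <= p)%nat -> 0 < pairpow p m X.
Proof.
  intros Hp. unfold pairpow, pairsum. apply rsum_pos; [lia|]. intros i Hi.
  assert (Hnn : forall j, (j < p)%nat -> 0 <=
    if (i =? j)%nat then 0 else Rpower (Rabs (X i - X j)) (1 - m)).
  { intros j Hj. destruct (i =? j)%nat; [lra|left; apply Rpower_pos]. }
  set (k := if (i =? 0)%nat then 1%nat else 0%nat).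
  assert (Hk : (k < p)%nat /\ i <> k).
  { unfold k. destruct (Nat.eqb_spec i 0); lia. }
  eapply Rlt_le_trans; [|apply (rsum_term_le p _ k Hnn); apply Hk].
  simpl. destruct (Nat.eqb_spec i k); [tauto|apply Rpower_pos].
Qed.

(** [Cp] reads its supremum through [real], which sends infinite values to 0. Equally spaced points
    make the set nonempty and [pairpow_le] bounds it, so [/ Cp p m] is a genuine least constant
    [L]. *)
Lemma Cp_lub p m :
  1 < m -> (2 <= p)%nat ->
  exists L, 0 < L /\ Cp p m = / L /\
    (forall X, inR p X -> pairpow p m X <= L * gapsum p m X) /\
    (forall L', (forall X, inR p X -> pairpow p m X <= L' * gapsum p m X) -> L <= L').
Proof.
  intros Hm Hp. unfold Cp.
  set (E := fun r => exists X, inR p X /\ r = Cratio p m X).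
  destruct (Lub_Rbar_correct E) as [Hub Hlub].
  assert (Hx0 : inR p (center p INR)).
  { apply center_inR; [lia|]. intros i Hi. apply lt_INR. lia. }
  assert (Hr : forall X L, inR p X -> (Cratio p m X <= L <-> pairpow p m X <= L * gapsum p m X)).
  { intros X L HX. rewrite Cratio_eq. pose proof (gapsum_pos p m X Hp). split; intros HL.
    - apply Rmult_le_compat_r with (r := gapsum p m X) in HL; [|lra].
      unfold Rdiv in HL. rewrite Rmult_assoc, Rinv_l, Rmult_1_r in HL by lra. exact HL.
    - apply Rmult_le_reg_r with (gapsum p m X); auto.
      unfold Rdiv. rewrite Rmult_assoc, Rinv_l, Rmult_1_r by lra. exact HL. }
  assert (H1 : Rbar_le (Cratio p m (center p INR)) (Lub_Rbar E)).
  { apply Hub. eexists; split; [exact Hx0|reflexivity]. }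
  assert (H2 : Rbar_le (Lub_Rbar E) (2 * INR (p - 1))).
  { apply Hlub. intros r [X [HX ->]]. simpl. apply Hr; auto.
    apply pairpow_le; auto using inR_incr. }
  destruct (Lub_Rbar E) as [L| |]; simpl in *; try contradiction.
  exists L. repeat split.
  - eapply Rlt_le_trans; [|apply H1]. rewrite Cratio_eq.
    apply Rdiv_lt_0_compat; [apply pairpow_pos | apply gapsum_pos]; auto.
  - intros X HX. apply Hr; auto. apply (Hub (Cratio p m X)).
    eexists; split; [exact HX|reflexivity].
  - intros L' HL'. apply (Hlub L'). intros r [X [HX ->]]. simpl. apply Hr; auto.
Qed.

Lemma Cp_pos p m : 1 < m -> (2 <= p)%nat -> 0 < Cp p m.
Proof.
  intros Hm Hp. destruct (Cp_lub p m Hm Hp) as (L & HL & -> & _).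
  apply Rinv_0_lt_compat; auto.
Qed.

Lemma lt_Cp_witness p m chi :
  1 < m -> (2 <= p)%nat -> Cp p m < chi ->
  exists X, inR p X /\ gapsum p m X < chi * pairpow p m X.
Proof.
  intros Hm Hp Hchi. pose proof (Cp_pos p m Hm Hp) as Hc.
  destruct (Cp_lub p m Hm Hp) as (L & HL & E & _ & Hlub). rewrite E in *.
  apply Classical_Prop.NNPP. intros Hn.
  assert (HLL : L <= / chi).
  { apply Hlub. intros X HX. apply Rnot_lt_le. intros Hlt. apply Hn. exists X.
    split; auto. apply Rmult_lt_reg_l with (/ chi); [apply Rinv_0_lt_compat; lra|].
    rewrite <- Rmult_assoc, Rinv_l, Rmult_1_l by lra. exact Hlt. }
  apply Rinv_le_contravar in HLL; [|auto]. rewrite Rinv_inv in HLL. lra.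
Qed.

Lemma Cp_ge p m chi theta :
  1 < m -> (2 <= p)%nat -> 0 < chi ->
  (forall X, inR p X -> chi * pairpow p m X <= theta * gapsum p m X) ->
  chi <= theta * Cp p m.
Proof.
  intros Hm Hp Hchi H.
  destruct (Cp_lub p m Hm Hp) as (L & HL & E & _ & Hlub). rewrite E.
  assert (HLL : L <= theta / chi).
  { apply Hlub. intros X HX. apply Rmult_le_reg_l with chi; [auto|].
    eapply Rle_trans; [apply H; auto|]. apply Req_le. field. lra. }
  apply Rmult_le_reg_r with L; [auto|]. rewrite Rmult_assoc, Rinv_l, Rmult_1_r by lra.
  apply Rmult_le_compat_l with (r := chi) in HLL; [|lra].
  replace (chi * (theta / chi)) with theta in HLL by (field; lra). exact HLL.
Qed.

Lemma Cp_le p m chi X :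
  1 < m -> (2 <= p)%nat -> 0 < chi -> incr p X ->
  gapsum p m X <= chi * pairpow p m X -> Cp p m <= chi.
Proof.
  intros Hm Hp Hchi HX H.
  destruct (Cp_lub p m Hm Hp) as (L & HL & -> & Hub & _).
  specialize (Hub _ (center_inR p X ltac:(lia) HX)).
  rewrite gapsum_center, pairpow_center in Hub. pose proof (gapsum_pos p m X Hp) as Hg.
  apply Rmult_le_reg_r with (L * gapsum p m X); [apply Rmult_lt_0_compat; auto|].
  rewrite <- Rmult_assoc, Rinv_l, Rmult_1_l by lra.
  eapply Rle_trans; [exact H|]. apply Rmult_le_compat_l; lra.
Qed.

Lemma Cp_lt p m chi X :
  1 < m -> (2 <= p)%nat -> 0 < chi -> incr p X ->
  gapsum p m X < chi * pairpow p m X -> Cp p m < chi.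
Proof.
  intros Hm Hp Hchi HX H.
  pose proof (pairpow_pos p m X Hp) as HB. pose proof (gapsum_pos p m X Hp) as HA.
  apply Rle_lt_trans with (gapsum p m X / pairpow p m X).
  - apply (Cp_le p m _ X); auto; [apply Rdiv_lt_0_compat; auto|].
    apply Req_le. field. lra.
  - apply Rmult_lt_reg_r with (pairpow p m X); auto.
    unfold Rdiv. rewrite Rmult_assoc, Rinv_l, Rmult_1_r by lra. exact H.
Qed.

(** Moving one coordinate leaves the hyperplane of centred points, but [Fpm] sees differences only;
    the order survives small [h], so the form [Fpm_energy] remains valid near 0. *)
Lemma Fpm_partial p m chi Z i :
  1 < m -> incr p Z -> (i < p)%nat ->
  is_derive (fun h => Fpm p m chi (fun j => if Nat.eqb j i then Z j + h else Z j)) 0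
    (- force p (kap chi) (pw m) Z i).
Proof.
  intros Hm HZ Hi.
  set (c := fun (h : R) (j : nat) => if Nat.eqb j i then Z j + h else Z j).
  assert (Hc0 : forall j, c 0 j = Z j).
  { intros j. unfold c. destruct (j =? i)%nat; ring. }
  assert (Dc : forall j, (j < p)%nat -> is_derive (fun h => c h j) 0 (if (j =? i)%nat then 1 else 0)).
  { intros j Hj. unfold c. destruct (j =? i)%nat; auto_derive; auto. }
  assert (Hinc : incr p (c 0)).
  { intros j Hj. rewrite !Hc0. auto. }
  assert (Hloc : locally 0 (fun h => incr p (c h))).
  { assert (Hq : forall q, (q <= p)%nat -> locally 0 (fun h => incr q (c h))).
    { induction q as [|q IH]; intros Hq.
      - apply filter_forall. intros h k Hk. lia.
      - destruct q as [|q].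
        + apply filter_forall. intros h k Hk. lia.
        + assert (Hg : locally 0 (fun h => 0 < c h (S q) - c h q)).
          { assert (Cn : continuous (fun h => c h (S q) - c h q) 0).
            { apply (ex_derive_continuous (V := R_NormedModule)). eexists.
              apply (is_derive_minus (V := R_NormedModule)); apply Dc; lia. }
            apply (Cn (fun y => 0 < y)). apply (open_gt 0).
            rewrite !Hc0. specialize (HZ q ltac:(lia)). lra. }
          assert (IH' := IH ltac:(lia)).
          generalize (filter_and (F := locally (0 : R)) _ _ IH' Hg). apply filter_imp.
          intros h [H1 H2] k Hk. destruct (Nat.eq_dec k q) as [->|Hk']; [lra|].
          apply H1. lia. }
    apply Hq. lia. }
  apply (is_derive_ext_loc (fun h => - / (2 * (m - 1)) * energy p (kap chi) m (c h))).
  - revert Hloc. apply filter_imp. intros h Hh. fold (c h).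
    change (fun j => if (j =? i)%nat then Z j + h else Z j) with (c h).
    rewrite Fpm_energy by auto.
    match goal with |- ?a = ?b => change (@eq R a b) end. field. lra.
  - pose proof (energy_is_derive p (kap chi) m c _ 0 (kap_sym chi) Hinc Dc) as D.
    apply (is_derive_scal _ _ (- / (2 * (m - 1)))) in D.
    rewrite (rsum_ext p _ (fun j => if (j =? i)%nat then force p (kap chi) (pw m) (c 0) j else 0)) in D.
    2:{ intros j Hj. destruct (j =? i)%nat; ring. }
    rewrite rsum_single in D by auto.
    replace (- force p (kap chi) (pw m) Z i) with
      (- / (2 * (m - 1)) * (2 * (m - 1) * force p (kap chi) (pw m) (c 0) i)); [exact D|].
    replace (force p (kap chi) (pw m) (c 0) i) with (force p (kap chi) (pw m) Z i).
    + field. lra.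
    + apply rsum_ext. intros j Hj. rewrite !Hc0. reflexivity.
Qed.

Lemma critical_force p m chi Z :
  1 < m ->
  is_critical_point p m chi Z <->
  inR p Z /\ forall i, (i < p)%nat -> force p (kap chi) (pw m) Z i = 0.
Proof.
  intros Hm. split; intros [HZ H]; split; auto; intros i Hi.
  - pose proof (Fpm_partial p m chi Z i Hm (inR_incr _ _ HZ) Hi) as D.
    apply is_derive_unique in D. specialize (H i Hi). apply is_derive_unique in H. lra.
  - pose proof (Fpm_partial p m chi Z i Hm (inR_incr _ _ HZ) Hi) as D.
    rewrite H, Ropp_0 in D by auto. exact D.
Qed.

Lemma critical_cross p m chi Z k :
  1 < m -> is_critical_point p m chi Z -> (S k < p)%nat ->
  2 * chi * cross p m Z k = Rpower (Z (S k) - Z k) (- m).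
Proof.
  intros Hm HZ Hk. apply critical_force in HZ; auto. destruct HZ as [HZ Hf].
  pose proof (force_above_kap p m chi Z k (inR_incr _ _ HZ) Hk) as E.
  rewrite rsum_zero in E; [lra|]. intros i Hi. rewrite Hf by auto. ring.
Qed.

(** Euler's identity: by homogeneity, the energy vanishes where all forces do. *)
Lemma critical_balance p m chi Z :
  1 < m -> is_critical_point p m chi Z -> gapsum p m Z = chi * pairpow p m Z.
Proof.
  intros Hm HZ. apply critical_force in HZ; auto. destruct HZ as [HZ Hf].
  pose proof (energy_force p (kap chi) m Z (kap_sym chi) (inR_incr _ _ HZ)) as E.
  rewrite energy_kap in E by (apply inR_incr; auto).
  rewrite rsum_zero in E; [lra|]. intros i Hi. rewrite Hf by auto. ring.
Qed.

(** By the balance identity the critical point itself has ratio [1 / chi], and Jensen with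
    [theta = 1] shows that no configuration exceeds it. *)
Lemma critical_Cp p m chi Z :
  1 < m -> (2 <= p)%nat -> 0 < chi -> is_critical_point p m chi Z -> Cp p m = chi.
Proof.
  intros Hm Hp Hchi HZ.
  assert (HZi : incr p Z) by (apply inR_incr, HZ).
  apply Rle_antisym.
  - apply (Cp_le p m chi Z); auto. rewrite (critical_balance p m chi Z) by auto. lra.
  - rewrite <- (Rmult_1_l (Cp p m)). apply Cp_ge; auto. intros X HX.
    apply (pairpow_le_of_cross p m chi 1 Z); auto using inR_incr; [lra|].
    intros k Hk. rewrite (critical_cross p m chi Z) by auto. lra.
Qed.

(* The pairs [(i, p' - 1)] are lost in the restriction of [Z] to its first [p] points,
   so that the criterion of [pairpow_le_of_cross] holds with some [theta < 1]. *)
Lemma critical_Cp_smaller p p' m chi Z :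
  1 < m -> (2 <= p < p')%nat -> 0 < chi -> is_critical_point p' m chi Z -> chi < Cp p m.
Proof.
  intros Hm Hp Hchi HZ.
  assert (HZi : incr p' Z) by (apply inR_incr, HZ).
  assert (HZp : incr p Z) by (intros i Hi; apply HZi; lia).
  (* The pair [(0, p' - 1)] straddles every gap [k] and is lost by the restriction; its share of the
     gap equation is [e0]. Since [M] dominates each [gap^(-m)], the loss is at least the fraction
     [e0 / M] of it, whence [theta = 1 - e0 / M]. *)
  set (M := rsum (p - 1) (fun k => Rpower (Z (S k) - Z k) (- m))).
  assert (HM : 0 < M) by (apply rsum_pos; [lia|]; intros; apply Rpower_pos).
  set (e0 := 2 * chi * Rpower (Z (p' - 1)%nat - Z 0%nat) (- m)).
  assert (He0 : 0 < e0).
  { apply Rmult_lt_0_compat; [lra|apply Rpower_pos]. }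
  assert (HC : chi <= (1 - e0 / M) * Cp p m).
  { apply Cp_ge; auto; [lia|]. intros X HX.
    apply (pairpow_le_of_cross p m chi _ Z); auto using inR_incr; [lra|].
    intros k Hk.
    assert (Hkm : Rpower (Z (S k) - Z k) (- m) <= M).
    { apply (rsum_term_le (p - 1) (fun k => Rpower (Z (S k) - Z k) (- m)) k); [|lia].
      intros; left; apply Rpower_pos. }
    assert (Hcr : cross p m Z k + Rpower (Z (p' - 1)%nat - Z 0%nat) (- m) <= cross p' m Z k).
    { unfold cross.
      assert (Hnn : forall i j, 0 <= (if (i <=? k)%nat && (k <? j)%nat
                                  then Rpower (Z j - Z i) (- m) else 0)).
      { intros i j. destruct (_ && _); [left; apply Rpower_pos|lra]. }
      replace p' with (p + (p' - p))%nat at 2 by lia. rewrite rsum_add.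
      apply Rle_trans with (rsum p (fun i => rsum p' (fun j => if (i <=? k)%nat && (k <? j)%nat
                                  then Rpower (Z j - Z i) (- m) else 0))).
      - rewrite <- (rsum_single p 0 (fun _ => Rpower (Z (p' - 1)%nat - Z 0%nat) (- m))) by lia.
        rewrite <- rsum_plus. apply rsum_le; intros i Hi.
        replace p' with (p + (p' - p))%nat at 2 by lia. rewrite rsum_add.
        apply Rplus_le_compat_l.
        destruct (Nat.eqb_spec i 0) as [->|Hi0]; [|apply rsum_nonneg; auto].
        pose proof (rsum_term_le (p' - p) (fun j => if (0 <=? k)%nat && (k <? p + j)%nat
                                  then Rpower (Z (p + j)%nat - Z 0%nat) (- m) else 0) (p' - p - 1)) as Ht.
        cbv beta in Ht.
        replace (p + (p' - p - 1))%nat with (p' - 1)%nat in Ht by lia.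
        rewrite (proj2 (Nat.ltb_lt k (p' - 1))) in Ht by lia.
        apply Ht; [|lia]. intros; apply Hnn.
      - assert (0 <= rsum (p' - p) (fun i => rsum p' (fun j => if (p + i <=? k)%nat && (k <? j)%nat
             then Rpower (Z j - Z (p + i)%nat) (- m) else 0))).
        { apply rsum_nonneg; intros. apply rsum_nonneg; intros. apply Hnn. }
        lra. }
    pose proof (critical_cross p' m chi Z k Hm HZ ltac:(lia)) as Ec.
    assert (e0 / M * Rpower (Z (S k) - Z k) (- m) <= e0).
    { apply Rle_trans with (e0 / M * M).
      - apply Rmult_le_compat_l; [|exact Hkm]. left. apply Rdiv_lt_0_compat; auto.
      - apply Req_le. field. lra. }
    unfold e0 in *. nra. }
  pose proof (Cp_pos p m Hm ltac:(lia)).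
  assert (0 < e0 / M) by (apply Rdiv_lt_0_compat; auto). nra.
Qed.

Lemma pairpow_S p m X :
  pairpow (S p) m X
  = pairpow p m X + 2 * rsum p (fun i => Rpower (Rabs (X i - X p)) (1 - m)).
Proof.
  unfold pairpow, pairsum. simpl. rewrite rsum_plus, Nat.eqb_refl.
  rewrite (rsum_ext p (fun i => if (i =? p)%nat then 0 else _) (fun i => Rpower (Rabs (X i - X p)) (1 - m))).
  - rewrite (rsum_ext p (fun j => if (p =? j)%nat then 0 else _) (fun i => Rpower (Rabs (X i - X p)) (1 - m))).
    + ring.
    + intros j Hj. destruct (Nat.eqb_spec p j); [lia|]. rewrite Rabs_minus_sym. reflexivity.
  - intros j Hj. destruct (Nat.eqb_spec j p); [lia|reflexivity].
Qed.

(* A point far to the right interacts with all the others at nearly the same distance. *)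
Lemma extend_far p m chi X :
  1 < m -> (2 <= p)%nat -> 0 < chi -> incr p X ->
  gapsum p m X <= chi * pairpow p m X ->
  exists X', incr (S p) X' /\ gapsum (S p) m X' < chi * pairpow (S p) m X'.
Proof.
  intros Hm Hp Hchi HX H.
  pose proof (gapsum_pos p m X Hp) as HA.
  (* The crude bound [pairpow_le] gives [2 chi (p - 1) >= 1], hence the strict [2 chi p > 1] that
     leaves room for one more particle. *)
  assert (Hc : 1 <= 2 * chi * INR (p - 1)).
  { pose proof (pairpow_le p m X Hm HX Hp).
    apply Rmult_le_reg_r with (gapsum p m X); auto. nra. }
  assert (Hc' : 1 < 2 * chi * INR p).
  { replace p with (S (p - 1)) by lia. rewrite S_INR. nra. }
  set (D := X (p - 1)%nat - X 0%nat).
  assert (HD : 0 < D) by (pose proof (incr_lt p X 0 (p - 1) HX ltac:(lia) ltac:(lia)); unfold D; lra).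
  (* Here [r^(m-1) = 2 chi p], and [g] is large enough for [g + D < r g]. The new gap then costs
     [g^(1-m)], less than the [2 chi p (g + D)^(1-m)] gained from the [p] old particles. *)
  set (r := Rpower (2 * chi * INR p) (/ (m - 1))).
  assert (Hinv : 0 < / (m - 1)) by (apply Rinv_0_lt_compat; lra).
  assert (Hr : 1 < r).
  { apply Rle_lt_trans with (Rpower (2 * chi * INR p) 0).
    - rewrite Rpower_O; lra.
    - apply Rpower_lt; lra. }
  set (g := (D + 1) / (r - 1)).
  assert (Hg : 0 < g) by (apply Rdiv_lt_0_compat; lra).
  assert (Hgr : g + D < r * g).
  { assert (g * (r - 1) = D + 1) by (unfold g; field; lra). lra. }
  exists (fun i => if (i <? p)%nat then X i else X (p - 1)%nat + g).
  set (X' := fun i => if (i <? p)%nat then X i else X (p - 1)%nat + g).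
  assert (E1 : forall i, (i < p)%nat -> X' i = X i).
  { intros i Hi. unfold X'. destruct (Nat.ltb_spec i p); [reflexivity|lia]. }
  assert (E2 : X' p = X (p - 1)%nat + g).
  { unfold X'. destruct (Nat.ltb_spec p p); [lia|reflexivity]. }
  split.
  - intros i Hi. destruct (Nat.eq_dec (S i) p) as [Hip|Hip].
    + rewrite Hip, E2, E1 by lia. assert (Ei : i = (p - 1)%nat) by lia. rewrite Ei. lra.
    + rewrite !E1 by lia. apply HX. lia.
  - rewrite pairpow_S.
    assert (EA : gapsum (S p) m X' = gapsum p m X + Rpower g (1 - m)).
    { unfold gapsum. replace (S p - 1)%nat with (S (p - 1)) by lia. simpl. f_equal.
      - apply rsum_ext; intros i Hi. rewrite !E1 by lia. reflexivity.
      - replace (S (p - 1)) with p by lia. rewrite E2, E1 by lia. f_equal. ring. }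
    assert (EB : pairpow p m X' = pairpow p m X).
    { apply pairsum_ext; intros. rewrite !E1 by lia. reflexivity. }
    rewrite EA, EB.
    assert (HL : INR p * Rpower (g + D) (1 - m)
                 <= rsum p (fun i => Rpower (Rabs (X' i - X' p)) (1 - m))).
    { rewrite <- rsum_const. apply rsum_le; intros i Hi. rewrite E2, E1 by auto.
      assert (X i <= X (p - 1)%nat) by (apply (incr_le p); auto; lia).
      assert (X 0%nat <= X i) by (apply (incr_le p); auto; lia).
      rewrite Rabs_left by lra. replace (1 - m) with (- (m - 1)) by ring.
      apply Rpower_opp_le; unfold D; lra. }
    assert (HK : Rpower g (1 - m) < 2 * chi * INR p * Rpower (g + D) (1 - m)).
    { assert (Er : Rpower r (m - 1) = 2 * chi * INR p).
      { unfold r. rewrite Rpower_mult, Rinv_l by lra. apply Rpower_1. lra. }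
      rewrite <- Er. replace (1 - m) with (- (m - 1)) by ring.
      rewrite !Rpower_Ropp.
      assert (Rpower (g + D) (m - 1) < Rpower r (m - 1) * Rpower g (m - 1)).
      { rewrite Rpower_mult_distr by lra. apply Rlt_Rpower_l; lra. }
      pose proof (Rpower_pos g (m - 1)). pose proof (Rpower_pos (g + D) (m - 1)).
      apply Rmult_lt_reg_r with (Rpower (g + D) (m - 1)); auto.
      rewrite Rmult_assoc, Rinv_l, Rmult_1_r by lra.
      apply Rmult_lt_reg_l with (Rpower g (m - 1)); auto.
      rewrite <- Rmult_assoc, Rinv_r, Rmult_1_l by lra. lra. }
    nra.
Qed.

(** The balance identity is an equality at size [p']; the first added particle makes it strict, and
    each further one keeps it so. *)
Lemma critical_Cp_larger p p' m chi Z :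
  1 < m -> (2 <= p' < p)%nat -> 0 < chi -> is_critical_point p' m chi Z -> Cp p m < chi.
Proof.
  intros Hm Hp Hchi HZ.
  assert (Hex : exists X, incr p X /\ gapsum p m X < chi * pairpow p m X).
  { destruct Hp as [Hp' Hp]. induction Hp as [|q Hq IH].
    - apply (extend_far p' m chi Z); auto; [apply inR_incr, HZ|].
      rewrite (critical_balance p' m chi Z) by auto. lra.
    - destruct IH as (X & HX & HX'). apply (extend_far q m chi X); auto; [lia|lra]. }
  destruct Hex as (X & HX & HX'). apply (Cp_lt p m chi X); auto. lia.
Qed.

Lemma critical_size p p' m chi Z :
  1 < m -> (2 <= p)%nat -> (2 <= p')%nat -> 0 < chi ->
  is_critical_point p' m chi Z -> chi = Cp p m -> p' = p.
Proof.
  intros Hm Hp Hp' Hchi HZ E. destruct (lt_eq_lt_dec p p') as [[Hlt|Heq]|Hgt]; auto.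
  - pose proof (critical_Cp_smaller p p' m chi Z Hm ltac:(lia) Hchi HZ). lra.
  - pose proof (critical_Cp_larger p p' m chi Z Hm ltac:(lia) Hchi HZ). lra.
Qed.

(** * Uniqueness of critical points up to dilation *)

Lemma argmax n (u : nat -> R) :
  exists k, (k <= n)%nat /\ forall i, (i <= n)%nat -> u i <= u k.
Proof.
  induction n as [|n (k & Hk & IH)].
  - exists O. split; [lia|]. intros i Hi. replace i with O by lia. lra.
  - destruct (Rle_dec (u (S n)) (u k)) as [H|H].
    + exists k. split; [lia|]. intros i Hi.
      destruct (Nat.eq_dec i (S n)) as [->|Hi']; [auto|apply IH; lia].
    + exists (S n). split; [lia|]. intros i Hi.
      destruct (Nat.eq_dec i (S n)) as [->|Hi']; [lra|].
      specialize (IH i ltac:(lia)). lra.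
Qed.

Lemma rsum_eq_le n f g k :
  (forall i, (i < n)%nat -> f i <= g i) -> rsum n g <= rsum n f ->
  (k < n)%nat -> f k = g k.
Proof.
  intros H Hs Hk.
  pose proof (rsum_term_le n (fun i => g i + -1 * f i) k) as Ht.
  rewrite rsum_plus, rsum_scal in Ht. cbv beta in Ht.
  assert (f k <= g k) by auto.
  assert (g k + -1 * f k <= rsum n g + -1 * rsum n f).
  { apply Ht; auto. intros i Hi. specialize (H i Hi). lra. }
  lra.
Qed.

(* Maximum principle: compare the equations of [Z] and [Z'] at the gap
   where the ratio of the gaps of [Z'] and [Z] is largest. *)
Lemma critical_proportional p m chi Z Z' :
  1 < m -> (2 <= p)%nat -> 0 < chi ->
  is_critical_point p m chi Z -> is_critical_point p m chi Z' ->
  exists u, 0 < u /\ forall k, (S k < p)%nat -> Z' (S k) - Z' k = u * (Z (S k) - Z k).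
Proof.
  intros Hm Hp Hchi HZ HZ'.
  assert (Hi : incr p Z) by (apply inR_incr, HZ).
  assert (Hi' : incr p Z') by (apply inR_incr, HZ').
  set (r := fun k => (Z' (S k) - Z' k) / (Z (S k) - Z k)).
  destruct (argmax (p - 2) r) as (k & Hk & Hmax).
  assert (Hgp : forall q, (S q < p)%nat -> 0 < Z (S q) - Z q /\ 0 < Z' (S q) - Z' q).
  { intros q Hq. specialize (Hi q Hq). specialize (Hi' q Hq). lra. }
  assert (Hu : 0 < r k).
  { destruct (Hgp k ltac:(lia)). apply Rdiv_lt_0_compat; auto. }
  assert (Hgap : forall q, (S q < p)%nat -> Z' (S q) - Z' q <= r k * (Z (S q) - Z q)).
  { intros q Hq. destruct (Hgp q Hq) as [H1 H2]. specialize (Hmax q ltac:(lia)).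
    apply Rmult_le_compat_r with (r := Z (S q) - Z q) in Hmax; [|lra].
    replace (r q * (Z (S q) - Z q)) with (Z' (S q) - Z' q) in Hmax; [exact Hmax|].
    unfold r. field. lra. }
  assert (Hpair : forall i j, (i <= j)%nat -> (j < p)%nat -> Z' j - Z' i <= r k * (Z j - Z i)).
  { intros i j Hij Hj. rewrite <- (rsum_telescope p i j Z'), <- (rsum_telescope p i j Z) by auto.
    rewrite <- rsum_scal. apply rsum_le; intros q Hq. destruct (_ && _); [|lra].
    apply Hgap. lia. }
  (* [F] holds the terms of gap equation [k] for [Z] dilated by [r k], and [G] those for [Z']. By
     maximality the distances of [Z'] are the shorter ones, so [F <= G] termwise. *)
  set (F := fun i j => if (i <=? k)%nat && (k <? j)%nat
              then Rpower (r k) (- m) * Rpower (Z j - Z i) (- m) else 0).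
  set (G := fun i j => if (i <=? k)%nat && (k <? j)%nat
              then Rpower (Z' j - Z' i) (- m) else 0).
  assert (HFG : forall i j, (i < p)%nat -> (j < p)%nat -> F i j <= G i j).
  { intros i j Hip Hjp. unfold F, G.
    destruct (Nat.leb_spec i k), (Nat.ltb_spec k j); simpl; try lra.
    assert (Z i < Z j) by (apply (incr_lt p); auto; lia).
    assert (Z' i < Z' j) by (apply (incr_lt p); auto; lia).
    rewrite Rpower_mult_distr by lra. apply Rpower_opp_le; try lra.
    apply Hpair; lia. }
  assert (HSF : rsum p (fun i => rsum p (F i)) = Rpower (r k) (- m) * cross p m Z k).
  { unfold cross. rewrite <- rsum_scal. apply rsum_ext; intros i Hip.
    rewrite <- rsum_scal. apply rsum_ext; intros j Hjp. unfold F. destruct (_ && _); ring. }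
  (* At gap [k] itself the dilated gap of [Z] equals that of [Z'], so the two gap equations have the
     same total. *)
  assert (Heq : rsum p (fun i => rsum p (G i)) <= rsum p (fun i => rsum p (F i))).
  { rewrite HSF. change (rsum p (fun i => rsum p (G i))) with (cross p m Z' k).
    apply Rmult_le_reg_l with (2 * chi); [lra|].
    rewrite (critical_cross p m chi Z') by (auto; lia).
    replace (2 * chi * (Rpower (r k) (- m) * cross p m Z k)) with
      (Rpower (r k) (- m) * (2 * chi * cross p m Z k)) by ring.
    rewrite (critical_cross p m chi Z) by (auto; lia).
    destruct (Hgp k ltac:(lia)).
    rewrite Rpower_mult_distr by auto. apply Req_le. f_equal. unfold r. field. lra. }
  (* Equal totals force termwise equality. The extreme pair straddles any [k], so the total lengths
     agree; as each gap of [Z'] is at most the dilated gap of [Z], all of them agree. *)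
  assert (E0 : F O (p - 1)%nat = G O (p - 1)%nat).
  { apply (rsum_eq_le p (F O) (G O)); [intros; apply HFG; lia| |lia].
    apply Req_le. symmetry.
    apply (rsum_eq_le p (fun i => rsum p (F i)) (fun i => rsum p (G i))); [|auto|lia].
    intros i Hip. apply rsum_le. intros. apply HFG; auto. }
  unfold F, G in E0. simpl in E0. rewrite (proj2 (Nat.ltb_lt k (p - 1))) in E0 by lia.
  simpl in E0.
  assert (HZ0 : Z O < Z (p - 1)%nat) by (apply (incr_lt p); auto; lia).
  assert (HZ0' : Z' O < Z' (p - 1)%nat) by (apply (incr_lt p); auto; lia).
  rewrite Rpower_mult_distr in E0 by lra.
  assert (Etot : Z' (p - 1)%nat - Z' O = r k * (Z (p - 1)%nat - Z O)).
  { apply Rle_antisym; [apply Hpair; lia|]. apply Rnot_lt_le. intros Hlt.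
    assert (Rpower (Z' (p - 1)%nat - Z' O) m < Rpower (r k * (Z (p - 1)%nat - Z O)) m)
      by (apply Rlt_Rpower_l; lra).
    rewrite !Rpower_Ropp in E0. apply Rinv_eq_reg in E0. lra. }
  exists (r k). split; auto. intros q Hq.
  pose proof (rsum_telescope p 0 (p - 1) Z ltac:(lia) ltac:(lia)) as T1.
  pose proof (rsum_telescope p 0 (p - 1) Z' ltac:(lia) ltac:(lia)) as T2.
  pose proof (rsum_eq_le (p - 1)
     (fun q => if (0 <=? q)%nat && (q <? p - 1)%nat then Z' (S q) - Z' q else 0)
     (fun q => r k * if (0 <=? q)%nat && (q <? p - 1)%nat then Z (S q) - Z q else 0) q) as E.
  cbv beta in E. rewrite rsum_scal, T1, T2 in E.
  rewrite (proj2 (Nat.ltb_lt q (p - 1))) in E by lia. simpl in E. apply E; [|lra|lia].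
  intros i Hip. rewrite (proj2 (Nat.ltb_lt i (p - 1))) by lia. apply Hgap. lia.
Qed.

Lemma inR_eq_of_gaps p Z Z' :
  inR p Z -> inR p Z' ->
  (forall k, (S k < p)%nat -> Z' (S k) - Z' k = Z (S k) - Z k) ->
  forall i, (i < p)%nat -> Z' i = Z i.
Proof.
  intros [_ H1] [_ H2] Hg.
  assert (Hd : forall i, (i < p)%nat -> Z' i = Z i + (Z' O - Z O)).
  { induction i as [|i IH]; intros Hi; [ring|].
    specialize (Hg i Hi). specialize (IH ltac:(lia)). lra. }
  intros i Hi.
  assert (E : rsum p Z' = rsum p Z + INR p * (Z' O - Z O)).
  { rewrite <- rsum_const, <- rsum_plus. apply rsum_ext. auto. }
  assert (0 < INR p) by (apply lt_0_INR; lia).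
  assert (INR p * (Z' O - Z O) = 0) by lra.
  apply Rmult_integral in H0. rewrite (Hd i Hi). lra.
Qed.

Lemma critical_unique p m chi Z Z' :
  1 < m -> (2 <= p)%nat -> 0 < chi ->
  is_critical_point p m chi Z -> is_critical_point p m chi Z' ->
  gap_normalized p Z -> gap_normalized p Z' ->
  forall i, (i < p)%nat -> Z' i = Z i.
Proof.
  intros Hm Hp Hchi HZ HZ' HN HN'.
  destruct (critical_proportional p m chi Z Z') as (u & Hu & Hgap); auto.
  assert (E : u = 1).
  { unfold gap_normalized in *.
    rewrite (rsum_ext (p - 1) (fun k => (Z' (S k) - Z' k) ^ 2)
      (fun k => u ^ 2 * (Z (S k) - Z k) ^ 2)) in HN'.
    - rewrite rsum_scal, sqrt_mult, HN, sqrt_pow2 in HN'; [lra|lra|nra|].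
      apply rsum_nonneg. intros. apply pow2_ge_0.
    - intros k Hk. rewrite Hgap by lia. ring. }
  apply inR_eq_of_gaps; [apply HZ|apply HZ'|]. intros k Hk. rewrite Hgap, E by auto. ring.
Qed.

(** * Decay of the tangential gradient *)

Lemma is_derive_Rmult (f g : R -> R) t df dg :
  is_derive f t df -> is_derive g t dg ->
  is_derive (fun s => f s * g s) t (df * g t + f t * dg).
Proof.
  intros Hf Hg. apply is_derive_Reals. apply is_derive_Reals in Hf, Hg.
  apply (derivable_pt_lim_mult f g); auto.
Qed.

Lemma decreasing_of_derive (f df : R -> R) a b :
  a <= b -> (forall t, a <= t <= b -> is_derive f t (df t)) ->
  (forall t, a <= t <= b -> df t <= 0) -> f b <= f a.
Proof.
  intros Hab D Hd.
  destruct (MVT_gen f a b df) as (c & Hc & E); rewrite Rmin_left, Rmax_right in * by auto.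
  - intros x Hx. apply D. lra.
  - intros x Hx. apply continuity_pt_filterlim.
    apply (ex_derive_continuous (V := R_NormedModule)). exists (df x). apply D. lra.
  - specialize (Hd c Hc). nra.
Qed.

Lemma Fpm_is_derive N m chi (c : R -> nat -> R) (dc : nat -> R) t :
  1 < m -> locally t (fun s => incr N (c s)) ->
  (forall i, (i < N)%nat -> is_derive (fun s => c s i) t (dc i)) ->
  is_derive (fun s => Fpm N m chi (c s)) t
    (- rsum N (fun i => dc i * force N (kap chi) (pw m) (c t) i)).
Proof.
  intros Hm HX D.
  apply (is_derive_ext_loc (fun s => - / (2 * (m - 1)) * energy N (kap chi) m (c s))).
  - revert HX. apply filter_imp. intros s Hs. rewrite Fpm_energy by auto.
    match goal with |- ?a = ?b => change (@eq R a b) end. field. lra.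
  - replace (- rsum N (fun i => dc i * force N (kap chi) (pw m) (c t) i)) with
      (- / (2 * (m - 1)) * (2 * (m - 1) * rsum N (fun i => dc i * force N (kap chi) (pw m) (c t) i)))
      by (field; lra).
    apply (is_derive_scal (fun s => energy N (kap chi) m (c s))).
    apply energy_is_derive; auto using kap_sym. apply (locally_singleton t (fun s => incr N (c s))). exact HX.
Qed.

Lemma force_is_derive N ka m (c : R -> nat -> R) (dc : nat -> R) t i :
  incr N (c t) -> (i < N)%nat ->
  (forall j, (j < N)%nat -> is_derive (fun s => c s j) t (dc j)) ->
  is_derive (fun s => force N ka (pw m) (c s) i) t
    (rsum N (fun j => if (i =? j)%nat then 0 else
        - m * ka i j * Rpower (Rabs (c t j - c t i)) (- (m + 1)) * (dc j - dc i))).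
Proof.
  intros HX Hi D. unfold force.
  apply (rsum_is_derive N (fun j s => if (i =? j)%nat then 0
     else ka i j * sgn i j * pw m (Rabs (c s j - c s i)))).
  intros j Hj. destruct (Nat.eqb_spec i j) as [Hij|Hij].
  - apply (is_derive_const (V := R_NormedModule)).
  - pose proof (is_derive_pair N c dc t (- m) i j HX Hi Hj Hij (D i Hi) (D j Hj)) as Dp.
    apply (is_derive_scal _ _ (ka i j * sgn i j)) in Dp.
    replace (- m * ka i j * Rpower (Rabs (c t j - c t i)) (- (m + 1)) * (dc j - dc i)) with
      (ka i j * sgn i j * (- m * Rpower (Rabs (c t j - c t i)) (- m - 1) * (sgn i j * (dc j - dc i)))).
    + exact Dp.
    + replace (- m - 1) with (- (m + 1)) by ring.
      replace (ka i j * sgn i j * (- m * Rpower (Rabs (c t j - c t i)) (- (m + 1)) * (sgn i j * (dc j - dc i))))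
        with ((sgn i j * sgn i j) * (- m * ka i j * Rpower (Rabs (c t j - c t i)) (- (m + 1)) * (dc j - dc i)))
        by ring.
      rewrite sgn_sqr. ring.
Qed.

(* Tangential part on the unit sphere of the gradient field: the direction of [X/|X|]. *)
Definition tanfield (N : nat) (m chi : R) (Y : nat -> R) (i : nat) : R :=
  force N (kap chi) (pw m) Y i - (m - 1) * Fpm N m chi Y * Y i.

Definition unit_incr (N : nat) (Y : nat -> R) : Prop :=
  incr N Y /\ rsum N (fun i => Y i ^ 2) = 1.

Lemma force_radial N m chi Y :
  1 < m -> incr N Y ->
  rsum N (fun i => Y i * force N (kap chi) (pw m) Y i) = (m - 1) * Fpm N m chi Y.
Proof.
  intros Hm HY. rewrite energy_force, Fpm_energy by (auto using kap_sym).
  field. lra.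
Qed.

Lemma tanfield_orth N m chi Y :
  1 < m -> unit_incr N Y -> rsum N (fun i => Y i * tanfield N m chi Y i) = 0.
Proof.
  intros Hm [HY H1]. unfold tanfield.
  rewrite (rsum_ext N _ (fun i => Y i * force N (kap chi) (pw m) Y i
     + - ((m - 1) * Fpm N m chi Y) * Y i ^ 2)) by (intros; ring).
  rewrite rsum_plus, rsum_scal, H1, force_radial by auto. ring.
Qed.

Lemma tanfield_force N m chi Y :
  1 < m -> unit_incr N Y ->
  rsum N (fun i => tanfield N m chi Y i * force N (kap chi) (pw m) Y i)
  = rsum N (fun i => tanfield N m chi Y i ^ 2).
Proof.
  intros Hm HY.
  rewrite (rsum_ext N _ (fun i => tanfield N m chi Y i ^ 2
     + ((m - 1) * Fpm N m chi Y) * (Y i * tanfield N m chi Y i)))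
     by (intros; unfold tanfield; ring).
  rewrite rsum_plus, rsum_scal, tanfield_orth by auto. ring.
Qed.

Lemma unit_coord N Y i : unit_incr N Y -> (i < N)%nat -> Rabs (Y i) <= 1.
Proof.
  intros [_ H1] Hi.
  pose proof (rsum_term_le N (fun i => Y i ^ 2) i (fun i _ => pow2_ge_0 (Y i)) Hi) as H.
  cbv beta in H. rewrite H1 in H. apply Rabs_le. nra.
Qed.

(** [energy N adj m Y] is twice the sum of the [gap^(1-m)]. Up to constants it is a power of the
    smallest gap, but it is differentiable in time, which a minimum need not be. *)
Lemma pair_dist_bound N m e Y i j :
  1 < m -> 0 <= e -> incr N Y -> (i < N)%nat -> (j < N)%nat -> i <> j ->
  Rpower (Rabs (Y j - Y i)) (- e) <= Rpower (energy N adj m Y) (e / (m - 1)).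
Proof.
  intros Hm He HY Hi Hj Hij.
  assert (Hgap : forall i j, (i < j)%nat -> (j < N)%nat ->
     Rpower (Y j - Y i) (- e) <= Rpower (energy N adj m Y) (e / (m - 1))).
  { clear i j Hi Hj Hij. intros i j Hij Hj.
    assert (H1 : Y i < Y (S i)) by (apply HY; lia).
    assert (H2 : Y (S i) <= Y j) by (apply (incr_le N); auto; lia).
    apply Rle_trans with (Rpower (Y (S i) - Y i) (- e)); [apply Rpower_opp_le; lra|].
    replace (- e) with ((1 - m) * (e / (m - 1))) by (field; lra).
    rewrite <- Rpower_mult. apply Rle_Rpower_l; [apply Rdiv_le_0_compat; lra|].
    split; [apply Rpower_pos|]. rewrite energy_adj by auto.
    pose proof (gapsum_pos N m Y ltac:(lia)).
    pose proof (rsum_term_le (N - 1) (fun i => Rpower (Y (S i) - Y i) (1 - m)) i) as Ht.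
    cbv beta in Ht. unfold gapsum in *.
    assert (Rpower (Y (S i) - Y i) (1 - m) <= rsum (N - 1) (fun i => Rpower (Y (S i) - Y i) (1 - m))).
    { apply Ht; [|lia]. intros; left; apply Rpower_pos. }
    lra. }
  destruct (lt_eq_lt_dec i j) as [[H|H]|H]; [|lia|].
  - assert (Y i < Y j) by (apply (incr_lt N); auto).
    rewrite Rabs_pos_eq by lra. auto.
  - assert (Y j < Y i) by (apply (incr_lt N); auto).
    rewrite Rabs_left, Ropp_minus_distr by lra. auto.
Qed.

Lemma force_bound N ka c m Y i :
  1 < m -> incr N Y -> (i < N)%nat -> (forall i j, Rabs (ka i j) <= c) ->
  Rabs (force N ka (pw m) Y i) <= INR N * (c * Rpower (energy N adj m Y) (m / (m - 1))).
Proof.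
  intros Hm HY Hi Hc. unfold force. apply rsum_abs. intros j Hj.
  assert (0 <= c) by (eapply Rle_trans; [apply Rabs_pos|apply (Hc O O)]).
  destruct (Nat.eqb_spec i j).
  - rewrite Rabs_R0. apply Rmult_le_pos; [auto|left; apply Rpower_pos].
  - rewrite !Rabs_mult, Rabs_sgn, Rmult_1_r.
    rewrite (Rabs_pos_eq (pw m _)) by (left; apply Rpower_pos).
    apply Rmult_le_compat; auto using Rabs_pos; [left; apply Rpower_pos|].
    apply pair_dist_bound; auto; lra.
Qed.

(** Gaps on the unit sphere are at most 2. Constants can therefore be absorbed into positive powers
    of this energy. *)
Lemma energy_lower N m Y :
  1 < m -> (2 <= N)%nat -> unit_incr N Y -> Rpower 2 (1 - m) <= energy N adj m Y.
Proof.
  intros Hm HN HY. pose proof (unit_coord N Y 0 HY ltac:(lia)) as H0.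
  pose proof (unit_coord N Y 1 HY ltac:(lia)) as H1.
  assert (Hg : 0 < Y 1%nat - Y 0%nat) by (pose proof (proj1 HY O ltac:(lia)); lra).
  apply Rabs_le_between in H0, H1. rewrite energy_adj by apply HY.
  pose proof (gapsum_pos N m Y HN).
  assert (Rpower (Y 1%nat - Y 0%nat) (1 - m) <= gapsum N m Y).
  { apply (rsum_term_le (N - 1) (fun i => Rpower (Y (S i) - Y i) (1 - m)) 0); [|lia].
    intros; left; apply Rpower_pos. }
  assert (Rpower 2 (1 - m) <= Rpower (Y 1%nat - Y 0%nat) (1 - m)).
  { replace (1 - m) with (- (m - 1)) by ring. apply Rpower_opp_le; lra. }
  lra.
Qed.

(** The radial term is bounded, and [energy_lower] absorbs it into the power that controls the
    force. *)
Lemma tanfield_bound N m chi P Y i :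
  1 < m -> (2 <= N)%nat -> unit_incr N Y -> 0 <= Fpm N m chi Y <= P -> (i < N)%nat ->
  Rabs (tanfield N m chi Y i)
  <= (INR N * (2 * Rabs chi + 1) + (m - 1) * P * Rpower 2 m)
     * Rpower (energy N adj m Y) (m / (m - 1)).
Proof.
  intros Hm HN HY HP Hi. unfold tanfield.
  match goal with |- Rabs (?a - ?b) <= _ => change (a - b) with (a + - b) end.
  eapply Rle_trans; [apply Rabs_triang|]. rewrite Rmult_plus_distr_r.
  apply Rplus_le_compat.
  - rewrite Rmult_assoc. apply force_bound; auto; [apply HY|apply kap_bound].
  - rewrite Rabs_Ropp, !Rabs_mult.
    rewrite (Rabs_pos_eq (m - 1)), (Rabs_pos_eq (Fpm N m chi Y)) by lra.
    assert (Hlow : 1 <= Rpower 2 m * Rpower (energy N adj m Y) (m / (m - 1))).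
    { apply Rle_trans with (Rpower 2 m * Rpower 2 (- m));
        [rewrite Rmult_comm, Rpower_opp_cancel; lra|].
      apply Rmult_le_compat_l; [left; apply Rpower_pos|].
      replace (- m) with ((1 - m) * (m / (m - 1))) by (field; lra).
      rewrite <- Rpower_mult. apply Rle_Rpower_l; [apply Rdiv_le_0_compat; lra|].
      split; [apply Rpower_pos|apply energy_lower; auto]. }
    pose proof (unit_coord N Y i HY Hi). pose proof (Rabs_pos (Y i)).
    apply Rle_trans with ((m - 1) * P * 1).
    + apply Rmult_le_compat; auto; [apply Rmult_le_pos; lra|apply Rmult_le_compat_l; lra].
    + rewrite (Rmult_assoc _ (Rpower 2 m)). apply Rmult_le_compat_l; auto.
      apply Rmult_le_pos; lra.
Qed.

(** * The flow on the unit sphere, slowed down by the factor [1 / S] *)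

Section RenormalizedFlow.

Variables (N : nat) (m chi : R) (Y : R -> nat -> R) (S : R -> R).
Hypothesis Hm : 1 < m.
Hypothesis HN : (2 <= N)%nat.
Hypothesis HS : forall t, 0 < t -> 0 < S t.
Hypothesis DS : forall t, 0 < t -> is_derive S t ((m * m - 1) * Fpm N m chi (Y t)).
Hypothesis HY : forall t, 0 < t -> unit_incr N (Y t).
Hypothesis DY : forall t i, 0 < t -> (i < N)%nat ->
  is_derive (fun s => Y s i) t (/ S t * tanfield N m chi (Y t) i).
Hypothesis HF : forall t, 0 < t -> 0 <= Fpm N m chi (Y t).

Let Phi t := Fpm N m chi (Y t).
Let q2 t := rsum N (fun i => tanfield N m chi (Y t) i ^ 2).
Let A t := energy N adj m (Y t).
(** As [A] is comparable to [eps^(1-m)], with [eps] the smallest gap, [A^beta] is comparable to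
    [eps^(-(m+1))], the size of second derivatives of the energy. *)
Let beta := (m + 1) / (m - 1).

Lemma locally_positive t : 0 < t -> locally t (fun s => 0 < s).
Proof. intros Ht. apply (open_gt 0). exact Ht. Qed.

Lemma flow_Phi_derive t : 0 < t -> is_derive Phi t (- (/ S t * q2 t)).
Proof.
  intros Ht. unfold Phi, q2. rewrite <- tanfield_force, <- rsum_scal by auto.
  rewrite (rsum_ext N _ (fun i => (/ S t * tanfield N m chi (Y t) i)
     * force N (kap chi) (pw m) (Y t) i)) by (intros; ring).
  apply (Fpm_is_derive N m chi Y); auto.
  generalize (locally_positive t Ht). apply filter_imp. intros s Hs. apply HY; auto.
Qed.

Lemma flow_q2_nonneg t : 0 <= q2 t.
Proof. apply rsum_nonneg. intros. apply pow2_ge_0. Qed.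

Lemma flow_Phi_decr s t : 0 < s <= t -> Phi t <= Phi s.
Proof.
  intros Hst. apply (decreasing_of_derive Phi (fun t => - (/ S t * q2 t))); [lra| |].
  - intros u Hu. apply flow_Phi_derive. lra.
  - intros u Hu. pose proof (Rinv_0_lt_compat _ (HS u ltac:(lra))).
    pose proof (flow_q2_nonneg u). nra.
Qed.

Lemma flow_q2_derive t :
  0 < t -> exists dq, is_derive q2 t dq /\
    dq <= / S t * (4 * INR N * INR N * m * (2 * Rabs chi + 1) * Rpower (A t) beta * q2 t).
Proof.
  intros Ht. set (w := tanfield N m chi (Y t)). set (sg := / S t).
  assert (Hsg : 0 < sg) by (apply Rinv_0_lt_compat; auto).
  set (df := fun i => rsum N (fun j => if (i =? j)%nat then 0 else
        - m * kap chi i j * Rpower (Rabs (Y t j - Y t i)) (- (m + 1)) * (sg * w j - sg * w i))).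
  set (dw := fun i => df i - (m - 1) * (- (sg * q2 t) * Y t i + Phi t * (sg * w i))).
  assert (Dw : forall i, (i < N)%nat -> is_derive (fun s => tanfield N m chi (Y s) i) t (dw i)).
  { intros i Hi. unfold tanfield, dw.
    apply (is_derive_minus (V := R_NormedModule)
       (fun s => force N (kap chi) (pw m) (Y s) i) (fun s => (m - 1) * Fpm N m chi (Y s) * Y s i)).
    - unfold df. apply (force_is_derive N (kap chi) m Y (fun j => sg * w j)); auto. apply HY; auto.
    - apply (is_derive_ext (fun s => (m - 1) * (Fpm N m chi (Y s) * Y s i)));
        [intros s; match goal with |- ?a = ?b => change (@eq R a b) end; ring|].
      apply (is_derive_scal (fun s => Fpm N m chi (Y s) * Y s i)).
      apply (is_derive_Rmult (fun s => Fpm N m chi (Y s)) (fun s => Y s i)).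
      + apply flow_Phi_derive; auto.
      + apply DY; auto. }
  exists (rsum N (fun i => dw i * w i + w i * dw i)). split.
  - unfold q2. apply (rsum_is_derive N (fun i s => tanfield N m chi (Y s) i ^ 2)).
    intros i Hi. apply (is_derive_ext (fun s => tanfield N m chi (Y s) i * tanfield N m chi (Y s) i)).
    + intros s. simpl. match goal with |- ?a = ?b => change (@eq R a b) end. ring.
    + apply (is_derive_Rmult (fun s => tanfield N m chi (Y s) i) (fun s => tanfield N m chi (Y s) i));
        apply Dw; auto.
  - set (B := m * (2 * Rabs chi + 1) * Rpower (A t) beta * (sg * (2 * q2 t))).
    assert (Hq : forall i, (i < N)%nat -> w i ^ 2 <= q2 t).
    { intros i Hi. apply (rsum_term_le N (fun i => w i ^ 2) i); auto.
      intros. apply pow2_ge_0. }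
    pose proof (flow_q2_nonneg t) as Hq0.
    assert (HB : rsum N (fun i => w i * df i) <= INR N * (INR N * B)).
    { eapply Rle_trans; [apply Rle_abs|]. apply rsum_abs. intros i Hi.
      unfold df. rewrite <- rsum_scal. apply rsum_abs. intros j Hj.
      assert (HB0 : 0 <= B).
      { unfold B. repeat apply Rmult_le_pos; try lra; [|left; apply Rpower_pos].
        pose proof (Rabs_pos chi). lra. }
      destruct (Nat.eqb_spec i j) as [Hij|Hij].
      - rewrite Rmult_0_r, Rabs_R0. exact HB0.
      - replace (w i * (- m * kap chi i j * Rpower (Rabs (Y t j - Y t i)) (- (m + 1)) * (sg * w j - sg * w i)))
          with (- (m * kap chi i j * Rpower (Rabs (Y t j - Y t i)) (- (m + 1)) * (sg * (w i * (w j - w i))))) by ring.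
        rewrite Rabs_Ropp, !Rabs_mult.
        rewrite (Rabs_pos_eq m), (Rabs_pos_eq sg), (Rabs_pos_eq (Rpower _ _)); try lra;
          [|left; apply Rpower_pos].
        unfold B. pose proof (Rabs_pos (kap chi i j)). pose proof (Rabs_pos (w i)).
        pose proof (Rabs_pos (w j - w i)).
        assert (0 <= Rpower (Rabs (Y t j - Y t i)) (- (m + 1))) by (left; apply Rpower_pos).
        apply Rmult_le_compat.
        + repeat apply Rmult_le_pos; auto; lra.
        + repeat apply Rmult_le_pos; auto; lra.
        + apply Rmult_le_compat; auto.
          * apply Rmult_le_pos; auto; lra.
          * apply Rmult_le_compat_l; [lra|apply kap_bound].
          * unfold beta. apply pair_dist_bound; auto; [lra|apply HY; auto].
        (* Here [|w i (w j - w i)| <= 2 q2]; with the 2 from the square and the [N^2] pairs, this is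
           the origin of the factor [4 N^2]. *)
        + apply Rmult_le_compat_l; [lra|]. rewrite <- Rabs_mult. apply Rabs_le.
          pose proof (Hq i Hi). pose proof (Hq j Hj).
          pose proof (pow2_ge_0 (w i + w j)). pose proof (pow2_ge_0 (w i - w j)). nra. }
    assert (E : rsum N (fun i => dw i * w i + w i * dw i)
       = 2 * rsum N (fun i => w i * df i) - 2 * (m - 1) * Phi t * sg * q2 t).
    { rewrite (rsum_ext N _ (fun i => 2 * (w i * df i) +
        (2 * (m - 1) * (sg * q2 t) * (Y t i * w i) + - (2 * (m - 1) * Phi t * sg) * w i ^ 2)))
        by (intros; unfold dw; ring).
      rewrite !rsum_plus, !rsum_scal. unfold w at 2. rewrite tanfield_orth by auto.
      change (rsum N (fun i => w i ^ 2)) with (q2 t). ring. }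
    rewrite E. assert (0 <= Phi t) by (apply HF; auto).
    assert (0 <= 2 * (m - 1) * Phi t * sg * q2 t).
    { repeat apply Rmult_le_pos; lra. }
    replace (sg * (4 * INR N * INR N * m * (2 * Rabs chi + 1) * Rpower (A t) beta * q2 t))
      with (2 * (INR N * (INR N * B))) by (unfold B; ring).
    lra.
Qed.

Let g t := Rpower (A t) (- beta) * q2 t.

Lemma flow_A_pos t : 0 < t -> 0 < A t.
Proof.
  intros Ht. eapply Rlt_le_trans; [|apply energy_lower; auto]. apply Rpower_pos.
Qed.

(* Along the flow the weight [A^(-beta)] compensates the blow-up of the Hessian of the
   energy, so that [g' <= K |W|^2 / S = - K Phi']. *)
Lemma flow_g_derive :
  exists K, 0 < K /\ forall t, 1 <= t ->
    exists dg, is_derive g t dg /\ dg <= K * (/ S t * q2 t).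
Proof.
  set (C1 := INR N * (2 * Rabs chi + 1) + (m - 1) * Phi 1 * Rpower 2 m).
  set (K2 := 4 * INR N * INR N * m * (2 * Rabs chi + 1)).
  assert (HNp : 0 < INR N) by (apply lt_0_INR; lia).
  pose proof (Rabs_pos chi) as Hchi.
  assert (HP1 : 0 <= Phi 1) by (apply HF; lra).
  assert (HC1 : 0 <= C1).
  { unfold C1. apply Rplus_le_le_0_compat; repeat apply Rmult_le_pos; try lra.
    left; apply Rpower_pos. }
  set (K1 := 2 * (m + 1) * (INR N * (C1 * INR N))).
  assert (HK1 : 0 <= K1) by (unfold K1; repeat apply Rmult_le_pos; lra).
  assert (HK2 : 0 < K2) by (unfold K2; repeat apply Rmult_lt_0_compat; lra).
  exists (K1 + K2). split; [lra|]. intros t Ht.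
  set (w := tanfield N m chi (Y t)). set (sg := / S t).
  assert (Hsg : 0 < sg) by (apply Rinv_0_lt_compat; apply HS; lra).
  pose proof (flow_A_pos t ltac:(lra)) as HA.
  pose proof (flow_q2_nonneg t) as Hq0.
  set (sA := rsum N (fun i => w i * force N adj (pw m) (Y t) i)).
  assert (DA : is_derive A t (2 * (m - 1) * (sg * sA))).
  { unfold sA. rewrite <- rsum_scal.
    rewrite (rsum_ext N _ (fun i => (sg * w i) * force N adj (pw m) (Y t) i)) by (intros; ring).
    apply (energy_is_derive N adj m Y); [apply adj_sym|apply HY; lra|].
    intros i Hi. apply DY; auto; lra. }
  destruct (flow_q2_derive t ltac:(lra)) as (dq & Dq & Hdq).
  exists ((2 * (m - 1) * (sg * sA)) * (- beta * Rpower (A t) (- beta - 1)) * q2 t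
          + Rpower (A t) (- beta) * dq). split.
  - apply (is_derive_Rmult (fun t => Rpower (A t) (- beta)) q2); auto.
    apply (is_derive_comp (fun y => Rpower y (- beta)) A); auto.
    apply is_derive_Rpower; auto.
  - assert (Hb : beta * (m - 1) = m + 1) by (unfold beta; field; lra).
    rewrite Rmult_plus_distr_r. apply Rplus_le_compat.
    + assert (HsA : Rabs sA <= INR N * ((C1 * Rpower (A t) (m / (m - 1)))
                      * (INR N * Rpower (A t) (m / (m - 1))))).
      { unfold sA. apply rsum_abs. intros i Hi. rewrite Rabs_mult.
        apply Rmult_le_compat; auto using Rabs_pos.
        - unfold C1. apply tanfield_bound; auto; [apply HY; lra|].
          split; [apply HF; lra|]. apply flow_Phi_decr; lra.
        - rewrite <- (Rmult_1_l (Rpower (A t) (m / (m - 1)))).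
          apply force_bound; auto; [apply HY; lra|apply adj_bound]. }
      (* The exponents balance, [2 m / (m-1) = beta + 1]: the same [beta] fits both the Hessian and
         the derivative of the weight. *)
      assert (EA : Rpower (A t) (m / (m - 1)) * Rpower (A t) (m / (m - 1)) * Rpower (A t) (- beta - 1) = 1).
      { rewrite <- !Rpower_plus.
        replace (m / (m - 1) + m / (m - 1) + (- beta - 1)) with 0 by (unfold beta; field; lra).
        apply Rpower_O; auto. }
      pose proof (Rpower_pos (A t) (- beta - 1)) as HAb.
      assert (HsA' : Rabs sA * Rpower (A t) (- beta - 1) <= INR N * (C1 * INR N)).
      { apply Rle_trans with (INR N * ((C1 * Rpower (A t) (m / (m - 1)))
                      * (INR N * Rpower (A t) (m / (m - 1)))) * Rpower (A t) (- beta - 1)).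
        - apply Rmult_le_compat_r; lra.
        - apply Req_le. transitivity (INR N * (C1 * INR N) * (Rpower (A t) (m / (m - 1)) * Rpower (A t) (m / (m - 1)) * Rpower (A t) (- beta - 1))); [ring|].
          rewrite EA. ring. }
      replace (2 * (m - 1) * (sg * sA) * (- beta * Rpower (A t) (- beta - 1)) * q2 t)
        with (2 * (beta * (m - 1)) * (- sA * Rpower (A t) (- beta - 1)) * (sg * q2 t)) by ring.
      rewrite Hb. unfold K1.
      assert (0 <= sg * q2 t) by (apply Rmult_le_pos; lra).
      apply Rmult_le_compat_r; auto. apply Rmult_le_compat_l; [lra|].
      eapply Rle_trans; [|apply HsA']. apply Rmult_le_compat_r; [lra|].
      rewrite <- (Rabs_Ropp sA). apply Rle_abs.
    + apply Rle_trans with (Rpower (A t) (- beta) * (sg * (K2 * Rpower (A t) beta * q2 t))).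
      * apply Rmult_le_compat_l; [left; apply Rpower_pos|]. unfold K2, sg. exact Hdq.
      * apply Req_le.
        transitivity ((Rpower (A t) (- beta) * Rpower (A t) beta) * (K2 * (sg * q2 t))); [ring|].
        rewrite Rpower_opp_cancel. ring.
Qed.

(* If [g] were bounded below then [Phi' <= - c / S] with [S' <= b]. *)
Lemma flow_g_small t1 eps : 1 <= t1 -> 0 < eps -> exists t, t1 <= t /\ g t < eps.
Proof.
  intros Ht1 Heps. apply Classical_Prop.NNPP. intros Hn.
  assert (Hg : forall t, t1 <= t -> eps <= g t).
  { intros t Ht. apply Rnot_lt_le. intros Hlt. apply Hn. exists t. auto. }
  set (M := Rpower 2 (m + 1)).
  assert (HM : 0 < M) by apply Rpower_pos.
  assert (Hw : forall t, 0 < t -> Rpower (A t) (- beta) <= M).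
  { intros t Ht. apply Rle_trans with (Rpower (Rpower 2 (1 - m)) (- beta)).
    - apply Rpower_opp_le; [unfold beta; apply Rdiv_le_0_compat; lra|apply Rpower_pos|].
      apply energy_lower; auto.
    - apply Req_le. rewrite Rpower_mult. unfold M. f_equal. unfold beta. field. lra. }
  set (c := eps / M). assert (Hc : 0 < c) by (apply Rdiv_lt_0_compat; auto).
  assert (Hq : forall t, t1 <= t -> c <= q2 t).
  { intros t Ht. apply Rmult_le_reg_l with M; auto.
    replace (M * c) with eps by (unfold c; field; lra).
    eapply Rle_trans; [apply Hg; eauto|]. unfold g.
    apply Rmult_le_compat_r; [apply flow_q2_nonneg|apply Hw; lra]. }
  (* [b] bounds the derivative of [S] from [t1] on; the added 1 keeps it positive even if
     [Phi t1 = 0]. *)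
  set (b := (m * m - 1) * Phi t1 + 1).
  assert (HP1 : 0 <= Phi t1) by (apply HF; lra).
  assert (Hmm : 0 < m * m - 1) by nra.
  assert (Hb : 0 < b).
  { unfold b. pose proof (Rmult_le_pos (m * m - 1) (Phi t1) ltac:(lra) HP1). lra. }
  (* [Phi] loses at least [c / S] per unit of time while [ln S] gains at most [b / S]. As [Phi]
     stays nonnegative, this bounds [S]. *)
  assert (Hln : forall t, t1 <= t -> Phi t + c / b * ln (S t) <= Phi t1 + c / b * ln (S t1)).
  { intros t Ht.
    apply (decreasing_of_derive (fun t => Phi t + c / b * ln (S t))
       (fun t => - (/ S t * q2 t) + c / b * ((m * m - 1) * Phi t * / S t))); auto.
    - intros u Hu. apply (is_derive_plus (V := R_NormedModule)); [apply flow_Phi_derive; lra|].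
      apply (is_derive_scal (fun u => ln (S u))).
      apply (is_derive_comp ln S); [apply is_derive_ln; apply HS; lra|apply DS; lra].
    - intros u Hu. pose proof (Rinv_0_lt_compat _ (HS u ltac:(lra))) as HSu.
      assert (Phi u <= Phi t1) by (apply flow_Phi_decr; lra).
      assert (Hbu : (m * m - 1) * Phi u <= b) by (unfold b; assert ((m * m - 1) * Phi u <= (m * m - 1) * Phi t1) by (apply Rmult_le_compat_l; lra); lra).
      assert (c / b * ((m * m - 1) * Phi u * / S u) <= c * / S u).
      { replace (c * / S u) with (c / b * (b * / S u)) by (field; split; [apply Rgt_not_eq, HS|]; lra).
        apply Rmult_le_compat_l; [left; apply Rdiv_lt_0_compat; auto|].
        apply Rmult_le_compat_r; lra. }
      specialize (Hq u ltac:(lra)). nra. }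
  set (L := Phi t1 * (b / c) + ln (S t1)).
  assert (HSL : forall t, t1 <= t -> S t <= exp L).
  { intros t Ht. rewrite <- (exp_ln (S t)) by (apply HS; lra).
    assert (HL : ln (S t) <= L); [|destruct HL as [HL|HL];
      [left; apply exp_increasing; exact HL|rewrite HL; lra]].
    specialize (Hln t Ht). assert (0 <= Phi t) by (apply HF; lra).
    assert (c / b * ln (S t) <= c / b * L).
    { unfold L. replace (c / b * (Phi t1 * (b / c) + ln (S t1))) with (Phi t1 + c / b * ln (S t1))
        by (field; lra). lra. }
    apply Rmult_le_reg_l with (c / b); auto. apply Rdiv_lt_0_compat; auto. }
  set (k := c / exp L). pose proof (exp_pos L) as HeL.
  assert (Hk : 0 < k) by (apply Rdiv_lt_0_compat; auto).
  (* Once [S] is bounded, [Phi] decreases at rate at least [k], so at this time it would be at most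
     -1. *)
  set (t := t1 + (Phi t1 + 1) / k).
  assert (Ht : t1 <= t).
  { unfold t. assert (0 <= (Phi t1 + 1) / k) by (apply Rdiv_le_0_compat; lra). lra. }
  assert (Hlin : Phi t + k * t <= Phi t1 + k * t1).
  { apply (decreasing_of_derive (fun t => Phi t + k * t) (fun t => - (/ S t * q2 t) + k)); auto.
    - intros u Hu. apply (is_derive_plus (V := R_NormedModule)); [apply flow_Phi_derive; lra|].
      auto_derive; auto; ring.
    - intros u Hu. specialize (Hq u ltac:(lra)). specialize (HSL u ltac:(lra)).
      assert (HSu : 0 < S u) by (apply HS; lra).
      assert (/ exp L <= / S u) by (apply Rinv_le_contravar; auto).
      assert (0 < / exp L) by (apply Rinv_0_lt_compat; auto).
      unfold k, Rdiv. nra. }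
  assert (0 <= Phi t) by (apply HF; lra).
  assert (k * t = k * t1 + (Phi t1 + 1)) by (unfold t; field; lra). lra.
Qed.

(** [flow_g_small] only provides some late times at which [g] is small. Since [g + K Phi] is
    nonincreasing, after such a time [g] can rise by at most [K] times the remaining drop of [Phi],
    which tends to 0 because [Phi] decreases and is bounded below. *)
Lemma flow_g_vanish eps : 0 < eps -> exists t0, 1 <= t0 /\ forall t, t0 <= t -> g t <= eps.
Proof.
  intros Heps. destruct flow_g_derive as (K & HK & Dg).
  assert (Hmono : forall s t, 1 <= s <= t -> g t + K * Phi t <= g s + K * Phi s).
  { intros s t Hst.
    apply (decreasing_of_derive (fun t => g t + K * Phi t)
      (fun t => Derive (fun t => g t + K * Phi t) t)); [lra| |].
    - intros u Hu. apply Derive_correct. destruct (Dg u ltac:(lra)) as (dg & D & _).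
      eexists. apply (is_derive_plus (V := R_NormedModule)); [exact D|].
      apply (is_derive_scal Phi). apply flow_Phi_derive. lra.
    - intros u Hu. destruct (Dg u ltac:(lra)) as (dg & D & Hdg).
      rewrite (is_derive_unique _ u (dg + K * - (/ S u * q2 u))); [lra|].
      apply (is_derive_plus (V := R_NormedModule)); [exact D|].
      apply (is_derive_scal Phi). apply flow_Phi_derive. lra. }
  set (E := fun x => exists t, 1 <= t /\ x = - Phi t).
  destruct (completeness E) as (l & Hub & Hlub).
  - exists 0. intros x (t & Ht & ->). assert (0 <= Phi t) by (apply HF; lra). lra.
  - exists (- Phi 1), 1. split; [lra|auto].
  - assert (Hd : 0 < eps / (2 * K)) by (apply Rdiv_lt_0_compat; lra).
    assert (Ht1 : exists t1, 1 <= t1 /\ Phi t1 < - l + eps / (2 * K)).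
    { apply Classical_Prop.NNPP. intros Hn.
      assert (l <= l - eps / (2 * K)); [|lra].
      apply Hlub. intros x (t & Ht & ->). apply Rnot_lt_le. intros Hlt. apply Hn.
      exists t. split; [auto|lra]. }
    destruct Ht1 as (t1 & Ht1 & HPt1).
    destruct (flow_g_small t1 (eps / 2) Ht1 ltac:(lra)) as (t0 & Ht0 & Hg0).
    exists t0. split; [lra|]. intros t Ht.
    pose proof (Hmono t0 t ltac:(lra)) as Hmt.
    assert (Phi t0 <= Phi t1) by (apply flow_Phi_decr; lra).
    assert (- l <= Phi t).
    { assert (- Phi t <= l); [|lra]. apply Hub. exists t. split; [lra|auto]. }
    assert (K * (Phi t0 - Phi t) <= eps / 2).
    { replace (eps / 2) with (K * (eps / (2 * K))) by (field; lra).
      apply Rmult_le_compat_l; lra. }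
    lra.
Qed.

(** [rho] is any lower bound for the gaps at time [t], chosen after the threshold [t0]: a constant
    when the gaps stay away from 0, a shrinking scale along a blow-up sequence. *)
Lemma flow_tanfield_vanish eps :
  0 < eps -> exists t0, 1 <= t0 /\ forall t, t0 <= t -> forall rho, 0 < rho ->
    (forall k, (Datatypes.S k < N)%nat -> rho <= Y t (Datatypes.S k) - Y t k) ->
    forall i, (i < N)%nat -> tanfield N m chi (Y t) i ^ 2 * Rpower rho (m + 1) <= eps.
Proof.
  intros Heps.
  set (C := Rpower (2 * INR N) beta). assert (HC : 0 < C) by apply Rpower_pos.
  destruct (flow_g_vanish (eps / C)) as (t0 & Ht0 & Hg); [apply Rdiv_lt_0_compat; auto|].
  exists t0. split; auto. intros t Ht rho Hrho Hgap i Hi.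
  assert (HNp : 0 < INR N) by (apply lt_0_INR; lia).
  pose proof (flow_A_pos t ltac:(lra)) as HA.
  assert (Hb : 0 < beta) by (unfold beta; apply Rdiv_lt_0_compat; lra).
  assert (HAle : A t <= 2 * INR N * Rpower rho (1 - m)).
  { unfold A. rewrite energy_adj by (apply HY; lra). rewrite Rmult_assoc.
    apply Rmult_le_compat_l; [lra|]. unfold gapsum.
    apply Rle_trans with (INR (N - 1) * Rpower rho (1 - m)).
    - rewrite <- rsum_const. apply rsum_le; intros k Hk.
      replace (1 - m) with (- (m - 1)) by ring. apply Rpower_opp_le; try lra.
      apply Hgap. lia.
    - apply Rmult_le_compat_r; [left; apply Rpower_pos|]. apply le_INR. lia. }
  assert (HAb : Rpower (A t) beta <= C * Rpower rho (- (m + 1))).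
  { apply Rle_trans with (Rpower (2 * INR N * Rpower rho (1 - m)) beta).
    - apply Rle_Rpower_l; lra.
    - apply Req_le. rewrite <- Rpower_mult_distr; [|lra|apply Rpower_pos].
      rewrite Rpower_mult. unfold C. do 2 f_equal. unfold beta. field. lra. }
  assert (Hq : q2 t = Rpower (A t) beta * g t).
  { unfold g. rewrite <- Rmult_assoc, (Rmult_comm (Rpower _ _)), Rpower_opp_cancel. ring. }
  assert (Hqi : tanfield N m chi (Y t) i ^ 2 <= q2 t).
  { apply (rsum_term_le N (fun i => tanfield N m chi (Y t) i ^ 2) i); auto.
    intros. apply pow2_ge_0. }
  assert (Hg0 : 0 <= g t).
  { unfold g. apply Rmult_le_pos; [left; apply Rpower_pos|apply flow_q2_nonneg]. }
  specialize (Hg t Ht).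
  pose proof (Rpower_pos rho (m + 1)) as Hr.
  apply Rle_trans with (C * Rpower rho (- (m + 1)) * (eps / C) * Rpower rho (m + 1)).
  - apply Rmult_le_compat_r; [lra|]. eapply Rle_trans; [exact Hqi|]. rewrite Hq.
    apply Rmult_le_compat; auto. left; apply Rpower_pos.
  - apply Req_le.
    transitivity (C * (eps / C) * (Rpower rho (- (m + 1)) * Rpower rho (m + 1))); [ring|].
    rewrite Rpower_opp_cancel. field. lra.
Qed.

End RenormalizedFlow.

(** * Global solutions *)

Lemma Rpower_div x y e : 0 < x -> 0 < y -> Rpower (x / y) e = Rpower x e * Rpower y (- e).
Proof.
  intros Hx Hy. unfold Rdiv. rewrite <- Rpower_mult_distr; auto; [|apply Rinv_0_lt_compat; auto].
  f_equal. unfold Rpower. rewrite ln_Rinv by auto. f_equal. ring.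
Qed.

Lemma force_scale N ka m X r i :
  0 < r -> incr N X -> (i < N)%nat ->
  force N ka (pw m) (fun j => X j / r) i = Rpower r m * force N ka (pw m) X i.
Proof.
  intros Hr HX Hi. unfold force. rewrite <- rsum_scal. apply rsum_ext; intros j Hj.
  destruct (Nat.eqb_spec i j) as [Hij|Hij]; [ring|].
  destruct (incr_abs N X i j HX Hi Hj Hij) as [Ha Hp].
  replace (X j / r - X i / r) with ((X j - X i) / r) by (field; lra).
  rewrite Rabs_div, (Rabs_pos_eq r) by lra. unfold pw. rewrite Rpower_div by lra.
  rewrite Ropp_involutive. ring.
Qed.

Lemma incr_scale N X r : 0 < r -> incr N X -> incr N (fun j => X j / r).
Proof.
  intros Hr HX i Hi. apply Rmult_lt_compat_r; [apply Rinv_0_lt_compat; auto|apply HX; auto].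
Qed.

(** Euler's identity [force_radial] transfers the scaling of the force to the energy. *)
Lemma Fpm_scale N m chi X r :
  1 < m -> 0 < r -> incr N X ->
  Fpm N m chi (fun j => X j / r) = Rpower r (m - 1) * Fpm N m chi X.
Proof.
  intros Hm Hr HX.
  apply (Rmult_eq_reg_l (m - 1)); [|lra].
  rewrite <- force_radial by (auto using incr_scale).
  replace ((m - 1) * (Rpower r (m - 1) * Fpm N m chi X)) with
    (Rpower r (m - 1) * ((m - 1) * Fpm N m chi X)) by ring.
  rewrite <- force_radial by auto. rewrite <- rsum_scal.
  apply rsum_ext; intros i Hi. rewrite force_scale by auto.
  rewrite <- (Rpower_pred r m) by auto. field. lra.
Qed.

Lemma incr_norm_pos N X : (2 <= N)%nat -> incr N X -> 0 < rsum N (fun i => X i ^ 2).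
Proof.
  intros HN HX. pose proof (HX O ltac:(lia)) as H01.
  assert (Hnn : forall i, (i < N)%nat -> 0 <= X i ^ 2) by (intros; apply pow2_ge_0).
  pose proof (rsum_term_le N (fun i => X i ^ 2) 0 Hnn ltac:(lia)) as H0.
  pose proof (rsum_term_le N (fun i => X i ^ 2) 1 Hnn ltac:(lia)) as H1.
  cbv beta in *. destruct (Req_dec (X O) 0) as [E|E]; nra.
Qed.

Lemma enorm_pos N X : (2 <= N)%nat -> incr N X -> 0 < enorm N X.
Proof. intros. apply sqrt_lt_R0. apply incr_norm_pos; auto. Qed.

Section GlobalSolution.

Variables (N : nat) (m chi : R) (X0 : nat -> R) (X : R -> nat -> R).
Hypothesis Hm : 1 < m.
Hypothesis HN : (2 <= N)%nat.
Hypothesis HX : is_sol N m chi X0 X p_infty.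

Lemma sol_inR t : 0 <= t -> inR N (X t).
Proof. intros Ht. destruct HX as (_ & _ & H & _). apply H; simpl; auto. Qed.

Lemma sol_incr t : 0 <= t -> incr N (X t).
Proof. intros Ht. apply inR_incr. apply sol_inR; auto. Qed.

Lemma sol_derive t i :
  0 < t -> (i < N)%nat ->
  is_derive (fun s => X s i) t (force N (kap chi) (pw m) (X t) i).
Proof.
  intros Ht Hi. rewrite <- vfield_force by (auto; apply sol_incr; lra).
  destruct HX as (_ & _ & _ & H & _). apply H; simpl; auto.
Qed.

Lemma sol_norm2_derive t :
  0 < t -> is_derive (fun s => rsum N (fun i => X s i ^ 2)) t (2 * ((m - 1) * Fpm N m chi (X t))).
Proof.
  intros Ht. rewrite <- force_radial, <- rsum_scal by (auto; apply sol_incr; lra).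
  apply (rsum_is_derive N (fun i s => X s i ^ 2)). intros i Hi.
  pose proof (sol_derive t i Ht Hi) as D.
  apply (is_derive_ext (fun s => X s i * X s i)).
  - intros s. simpl. match goal with |- ?a = ?b => change (@eq R a b) end. ring.
  - replace (2 * (X t i * force N (kap chi) (pw m) (X t) i)) with
      (force N (kap chi) (pw m) (X t) i * X t i + X t i * force N (kap chi) (pw m) (X t) i) by ring.
    apply (is_derive_Rmult (fun s => X s i) (fun s => X s i)); auto.
Qed.

Lemma sol_Fpm_decr s t : 0 < s <= t -> Fpm N m chi (X t) <= Fpm N m chi (X s).
Proof.
  intros Hst.
  apply (decreasing_of_derive (fun t => Fpm N m chi (X t))
    (fun t => - rsum N (fun i => force N (kap chi) (pw m) (X t) i * force N (kap chi) (pw m) (X t) i))).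
  - lra.
  - intros u Hu. apply Fpm_is_derive; auto.
    + assert (Hu0 : 0 < u) by lra. generalize (locally_positive u Hu0). apply filter_imp.
      intros v Hv. apply sol_incr. lra.
    + intros i Hi. apply sol_derive; auto; lra.
  - intros u Hu. apply Ropp_le_cancel. rewrite Ropp_0, Ropp_involutive.
    apply rsum_nonneg. intros. apply Rle_0_sqr.
Qed.

(* Otherwise [|X|^2] would decrease at least linearly. *)
Lemma sol_Fpm_nonneg t : 0 < t -> 0 <= Fpm N m chi (X t).
Proof.
  intros Ht. apply Rnot_lt_le. intros Hneg.
  set (n2 := fun s => rsum N (fun i => X s i ^ 2)).
  set (c := 2 * ((m - 1) * Fpm N m chi (X t))).
  assert (Hc : c < 0) by (unfold c; nra).
  (* The time at which the linear upper bound for [|X|^2] reaches 0. *)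
  set (t' := t + n2 t / (- c)).
  assert (Hn : forall s, 0 <= s -> 0 < n2 s).
  { intros s Hs. apply incr_norm_pos; auto. apply sol_incr; auto. }
  pose proof (Hn t ltac:(lra)) as Hnt.
  assert (Htt' : t <= t').
  { unfold t'. assert (0 < n2 t / (- c)) by (apply Rdiv_lt_0_compat; lra). lra. }
  assert (n2 t' + - c * t' <= n2 t + - c * t).
  { apply (decreasing_of_derive (fun s => n2 s + - c * s)
      (fun s => 2 * ((m - 1) * Fpm N m chi (X s)) + - c)); auto.
    - intros u Hu. apply (is_derive_plus (V := R_NormedModule)).
      + apply sol_norm2_derive. lra.
      + auto_derive; auto; ring.
    - intros u Hu. pose proof (sol_Fpm_decr t u ltac:(lra)). unfold c. nra. }
  pose proof (Hn t' ltac:(lra)).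
  assert (- c * t' = - c * t + n2 t) by (unfold t'; field; lra). lra.
Qed.

Let r t := enorm N (X t).
Let Y := renorm N X.

Lemma sol_r_pos t : 0 <= t -> 0 < r t.
Proof. intros Ht. apply enorm_pos; auto. apply sol_incr; auto. Qed.

Lemma sol_r_sqr t : r t ^ 2 = rsum N (fun i => X t i ^ 2).
Proof. unfold r, enorm. apply pow2_sqrt. apply rsum_nonneg. intros. apply pow2_ge_0. Qed.

Lemma sol_r_derive t : 0 < t -> is_derive r t ((m - 1) * Fpm N m chi (X t) / r t).
Proof.
  intros Ht. pose proof (sol_r_pos t ltac:(lra)) as Hr.
  replace ((m - 1) * Fpm N m chi (X t) / r t) with
    (2 * ((m - 1) * Fpm N m chi (X t)) * / (2 * sqrt (rsum N (fun i => X t i ^ 2)))).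
  - unfold r, enorm.
    apply (is_derive_comp sqrt (fun t => rsum N (fun i => X t i ^ 2))).
    + apply is_derive_Reals. apply derivable_pt_lim_sqrt. apply incr_norm_pos; auto.
      apply sol_incr. lra.
    + apply sol_norm2_derive; auto.
  - fold (enorm N (X t)). fold (r t). field. lra.
Qed.

Lemma renorm_unit t : 0 <= t -> unit_incr N (Y t).
Proof.
  intros Ht. pose proof (sol_r_pos t Ht) as Hr. split.
  - apply (incr_scale N (X t) (r t)); auto. apply sol_incr; auto.
  - unfold Y, renorm. fold (r t).
    rewrite (rsum_ext N _ (fun i => / r t ^ 2 * X t i ^ 2)) by (intros; field; lra).
    rewrite rsum_scal, <- sol_r_sqr. field. lra.
Qed.

Lemma renorm_inR t : 0 <= t -> inR N (Y t).
Proof.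
  intros Ht. split; [apply renorm_unit; auto|].
  unfold Y, renorm. rewrite (rsum_ext N _ (fun i => / enorm N (X t) * X t i)) by (intros; unfold Rdiv; ring).
  rewrite rsum_scal. rewrite (proj2 (sol_inR t Ht)). ring.
Qed.

Lemma renorm_Fpm t : 0 <= t -> Fpm N m chi (Y t) = Rpower (r t) (m - 1) * Fpm N m chi (X t).
Proof.
  intros Ht. apply (Fpm_scale N m chi (X t) (r t)); auto; [apply sol_r_pos|apply sol_incr]; auto.
Qed.

Lemma renorm_Fpm_nonneg t : 0 < t -> 0 <= Fpm N m chi (Y t).
Proof.
  intros Ht. rewrite renorm_Fpm by lra.
  apply Rmult_le_pos; [left; apply Rpower_pos|apply sol_Fpm_nonneg; auto].
Qed.

(** In [Y' = W / S], one power of [r] comes from the normalization and [m] from the homogeneity of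
    the force. The name hides the successor, hence [Datatypes.S] below. *)
Let S t := Rpower (r t) (m + 1).

Lemma renorm_S_derive t : 0 < t -> is_derive S t ((m * m - 1) * Fpm N m chi (Y t)).
Proof.
  intros Ht. pose proof (sol_r_pos t ltac:(lra)) as Hr. unfold S.
  rewrite renorm_Fpm by lra.
  replace ((m * m - 1) * (Rpower (r t) (m - 1) * Fpm N m chi (X t))) with
    (((m - 1) * Fpm N m chi (X t) / r t) * ((m + 1) * Rpower (r t) (m + 1 - 1))).
  - apply (is_derive_comp (fun y => Rpower y (m + 1)) r).
    + apply is_derive_Rpower; auto.
    + apply sol_r_derive; auto.
  - replace (m + 1 - 1) with m by ring. rewrite <- (Rpower_pred (r t) m) by auto. field. lra.
Qed.

Lemma renorm_derive t i :
  0 < t -> (i < N)%nat ->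
  is_derive (fun s => Y s i) t (/ S t * tanfield N m chi (Y t) i).
Proof.
  intros Ht Hi. pose proof (sol_r_pos t ltac:(lra)) as Hr.
  unfold tanfield. rewrite renorm_Fpm by lra.
  unfold Y at 2. unfold renorm at 1. fold (r t).
  rewrite force_scale by (auto; apply sol_incr; lra).
  apply (is_derive_ext (fun s => X s i * / r s)); [reflexivity|].
  replace (/ S t * _) with (force N (kap chi) (pw m) (X t) i * / r t
     + X t i * (- ((m - 1) * Fpm N m chi (X t) / r t) / r t ^ 2)).
  - apply (is_derive_Rmult (fun s => X s i) (fun s => / r s)).
    + apply sol_derive; auto.
    + apply (is_derive_inv r); [apply sol_r_derive; auto|lra].
  - unfold S, Y, renorm. fold (r t).
    replace (Rpower (r t) (m + 1)) with (r t * (r t * Rpower (r t) (m - 1))).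
    + rewrite <- (Rpower_pred (r t) m) by auto. pose proof (Rpower_pos (r t) (m - 1)).
      field. lra.
    + rewrite (Rpower_pred (r t) m) by auto. replace m with (m + 1 - 1) at 1 by ring.
      apply Rpower_pred; auto.
Qed.

Lemma renorm_tanfield_vanish eps :
  0 < eps -> exists t0, 1 <= t0 /\ forall t, t0 <= t -> forall rho, 0 < rho ->
    (forall k, (Datatypes.S k < N)%nat -> rho <= Y t (Datatypes.S k) - Y t k) ->
    forall i, (i < N)%nat -> tanfield N m chi (Y t) i ^ 2 * Rpower rho (m + 1) <= eps.
Proof.
  apply (flow_tanfield_vanish N m chi Y S Hm HN).
  - intros t Ht. apply Rpower_pos.
  - apply renorm_S_derive.
  - intros t Ht. apply renorm_unit. lra.
  - apply renorm_derive.
  - apply renorm_Fpm_nonneg.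
Qed.

Lemma renorm_Fpm_bound t : 1 <= t -> Fpm N m chi (Y t) <= Fpm N m chi (Y 1).
Proof.
  intros Ht. apply (flow_Phi_decr N m chi Y S Hm); auto; try lra.
  - intros u Hu. apply Rpower_pos.
  - intros u Hu. apply renorm_unit. lra.
  - apply renorm_derive.
Qed.

End GlobalSolution.

(** * Blow-up of the renormalized trajectory *)

Lemma sum_above_nonneg N Y k :
  incr N Y -> rsum N Y = 0 -> (k < N)%nat ->
  0 <= rsum N (fun i => (if (k <? i)%nat then 1 else 0) * Y i).
Proof.
  intros HY H0 Hk. destruct (Rle_dec 0 (Y k)) as [Hp|Hp].
  - apply rsum_nonneg. intros i Hi. destruct (Nat.ltb_spec k i); [|lra].
    pose proof (incr_lt N Y k i HY ltac:(auto) ltac:(auto)). lra.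
  (* When [Y k < 0], centring turns the sum above [k] into minus the sum of the coordinates up to
     [k], all negative. *)
  - rewrite (rsum_ext N _ (fun i => Y i + (if (k <? i)%nat then 0 else - Y i))).
    + rewrite rsum_plus, H0, Rplus_0_l. apply rsum_nonneg. intros i Hi.
      destruct (Nat.ltb_spec k i); [lra|].
      pose proof (incr_le N Y i k HY ltac:(lia) ltac:(auto)). lra.
    + intros i Hi. destruct (k <? i)%nat; ring.
Qed.

(** Summing the tangential field above [k] gives the equation of gap [k] plus a multiplier term,
    [(m-1) F(Y)] times a sum that is nonnegative for centred [Y]; its sign allows it to be
    discarded. The error [N e] is absorbed into [gap^(-m)] because gaps are at most 2. *)
Lemma cross_bound_of_tanfield N m chi Y e k :
  1 < m -> unit_incr N Y -> rsum N Y = 0 -> 0 <= Fpm N m chi Y ->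
  (forall i, (i < N)%nat -> Rabs (tanfield N m chi Y i) <= e) -> (S k < N)%nat ->
  2 * chi * cross N m Y k <= (1 + INR N * e * Rpower 2 m) * Rpower (Y (S k) - Y k) (- m).
Proof.
  intros Hm HY H0 HF He Hk.
  pose proof (force_above_kap N m chi Y k (proj1 HY) Hk) as E.
  assert (He0 : 0 <= e) by (eapply Rle_trans; [apply Rabs_pos|apply (He k); lia]).
  assert (Hs : Rabs (rsum N (fun i => (if (k <? i)%nat then 1 else 0) * tanfield N m chi Y i)) <= INR N * e).
  { apply rsum_abs. intros i Hi. rewrite Rabs_mult.
    destruct (k <? i)%nat; [rewrite Rabs_R1, Rmult_1_l; auto|rewrite Rabs_R0; lra]. }
  unfold tanfield in Hs.
  rewrite (rsum_ext N _ (fun i => (if (k <? i)%nat then 1 else 0) * force N (kap chi) (pw m) Y i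
    + - ((m - 1) * Fpm N m chi Y) * ((if (k <? i)%nat then 1 else 0) * Y i))) in Hs by (intros; ring).
  rewrite rsum_plus, rsum_scal, E in Hs.
  pose proof (sum_above_nonneg N Y k (proj1 HY) H0 ltac:(lia)) as Hab.
  assert (0 <= (m - 1) * Fpm N m chi Y * rsum N (fun i => (if (k <? i)%nat then 1 else 0) * Y i)).
  { repeat apply Rmult_le_pos; auto; lra. }
  apply Rabs_le_between in Hs.
  assert (Hz : 1 <= Rpower 2 m * Rpower (Y (S k) - Y k) (- m)).
  { apply Rle_trans with (Rpower 2 m * Rpower 2 (- m));
      [rewrite Rmult_comm, Rpower_opp_cancel; lra|].
    apply Rmult_le_compat_l; [left; apply Rpower_pos|].
    pose proof (unit_coord N Y k HY ltac:(lia)) as H1.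
    pose proof (unit_coord N Y (S k) HY Hk) as H2.
    apply Rabs_le_between in H1, H2. pose proof (proj1 HY k Hk).
    apply Rpower_opp_le; lra. }
  assert (INR N * e <= INR N * e * (Rpower 2 m * Rpower (Y (S k) - Y k) (- m))).
  { rewrite <- (Rmult_1_r (INR N * e)) at 1. apply Rmult_le_compat_l; auto.
    apply Rmult_le_pos; [apply pos_INR|auto]. }
  lra.
Qed.

Lemma is_lim_seq_inv_INR : is_lim_seq (fun n => / (INR n + 1)) 0.
Proof.
  apply (is_lim_seq_ext (fun n => / INR (S n))).
  - intros n. rewrite S_INR. reflexivity.
  - apply (is_lim_seq_inv (fun n => INR (S n)) p_infty); [|discriminate].
    apply (is_lim_seq_incr_1 INR). apply is_lim_seq_INR.
Qed.

Lemma left_sequence (T : Rbar) :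
  Rbar_lt 0 T -> exists s : nat -> R,
    (forall n, 0 <= s n /\ Rbar_lt (s n) T) /\ is_lim_seq s T.
Proof.
  intros HT. destruct T as [T| |]; simpl in HT; [|exists INR|contradiction].
  - exists (fun n => T - T * / (INR n + 1)). split.
    + intros n. pose proof (pos_INR n) as Hn.
      assert (0 < / (INR n + 1)) by (apply Rinv_0_lt_compat; lra).
      assert (/ (INR n + 1) <= 1) by (rewrite <- Rinv_1; apply Rinv_le_contravar; lra).
      simpl. nra.
    + replace (Finite T) with (Finite (T - T * 0)) by (f_equal; ring).
      apply is_lim_seq_minus'; [apply is_lim_seq_const|].
      apply (is_lim_seq_scal_l _ T 0). apply is_lim_seq_inv_INR.
  - split; [intros n; split; [apply pos_INR|exact I]|apply is_lim_seq_INR].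
Qed.

(** One gap at a time: if gap [k] fell below [1 / (n+1)] after every [s n], choosing such times
    would give a blow-up sequence. The minimum over finitely many gaps yields [d]. Finite [T] is
    used for continuation, infinite [T] for the renormalized trajectory. *)
Lemma not_blows_up N X T :
  Rbar_lt 0 T -> (forall t, 0 <= t -> Rbar_lt t T -> incr N (X t)) ->
  ~ blows_up N X T ->
  exists s d, 0 <= s /\ Rbar_lt s T /\ 0 < d /\
    forall t k, s < t -> Rbar_lt t T -> (S k < N)%nat -> d <= X t (S k) - X t k.
Proof.
  intros HT HX Hn. destruct (left_sequence T HT) as (s & Hs & Ls).
  assert (Hq : forall q, (q <= N)%nat -> exists s0 d, 0 <= s0 /\ Rbar_lt s0 T /\ 0 < d /\
    forall t k, s0 < t -> Rbar_lt t T -> (S k < q)%nat -> d <= X t (S k) - X t k).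
  { induction q as [|q IH]; intros Hq.
    - exists 0, 1. repeat split; [lra|exact HT|lra|intros; lia].
    - destruct (IH ltac:(lia)) as (s0 & d & Hs0 & Hs0T & Hd & Hg).
      destruct q as [|k].
      { exists 0, 1. repeat split; [lra|exact HT|lra|intros; lia]. }
      assert (Hk : exists n, forall t, s n < t -> Rbar_lt t T -> / (INR n + 1) <= X t (S k) - X t k).
      { apply Classical_Prop.NNPP. intros Hno. apply Hn.
        assert (Hch : forall n, exists t, s n < t /\ Rbar_lt t T /\ X t (S k) - X t k < / (INR n + 1)).
        { intros n. apply Classical_Prop.NNPP. intros Hno'. apply Hno. exists n.
          intros t Ht HtT. apply Rnot_lt_le. intros Hlt. apply Hno'. exists t. auto. }
        set (t := fun n => proj1_sig (constructive_indefinite_description _ (Hch n))).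
        assert (Ht : forall n, s n < t n /\ Rbar_lt (t n) T /\ X (t n) (S k) - X (t n) k < / (INR n + 1)).
        { intros n. exact (proj2_sig (constructive_indefinite_description _ (Hch n))). }
        exists k, t. repeat split.
        - lia.
        - destruct (Hs n), (Ht n). lra.
        - apply Ht.
        - destruct T as [T| |].
          + apply (is_lim_seq_le_le s t (fun _ => T)); [|exact Ls|apply is_lim_seq_const].
            intros n. destruct (Ht n) as (H1 & H2 & _). simpl in H2. lra.
          + apply (is_lim_seq_le_p_loc s t); [|exact Ls].
            exists O. intros n _. left. apply Ht.
          + contradiction.
        - apply (is_lim_seq_le_le (fun _ => 0) _ (fun n => / (INR n + 1)));
            [|apply is_lim_seq_const|apply is_lim_seq_inv_INR].
          intros n. destruct (Ht n) as (H1 & H2 & H3).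
          pose proof (HX (t n) ltac:(destruct (Hs n); lra) H2 k ltac:(lia)). lra. }
      destruct Hk as (n & Hk). destruct (Hs n) as [Hsn HsnT].
      exists (Rmax s0 (s n)), (Rmin d (/ (INR n + 1))).
      assert (0 < / (INR n + 1)).
      { apply Rinv_0_lt_compat. pose proof (pos_INR n). lra. }
      repeat split.
      + eapply Rle_trans; [exact Hs0|apply Rmax_l].
      + unfold Rmax. destruct (Rle_dec s0 (s n)); auto.
      + apply Rmin_glb_lt; auto.
      + intros t j Ht HtT Hj. apply Rmax_Rlt in Ht.
        destruct (Nat.eq_dec j k) as [->|Hjk].
        * eapply Rle_trans; [apply Rmin_r|]. apply Hk; tauto.
        * eapply Rle_trans; [apply Rmin_l|]. apply Hg; [tauto|auto|lia]. }
  apply Hq. lia.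
Qed.

Lemma renorm_blows_up N m chi X0 X :
  1 < m -> (2 <= N)%nat -> Cp N m < chi -> is_sol N m chi X0 X p_infty ->
  blows_up N (renorm N X) p_infty.
Proof.
  intros Hm HN Hchi HX. apply Classical_Prop.NNPP. intros Hn.
  pose proof (Cp_pos N m Hm HN) as HC.
  destruct (not_blows_up N (renorm N X) p_infty) as (s & d & Hs & _ & Hd & Hg); auto; [exact I| |].
  { intros t Ht _. apply (renorm_unit N m chi X0 X); auto. }
  destruct (lt_Cp_witness N m chi Hm HN Hchi) as (V & HV & HVlt).
  pose proof (gapsum_pos N m V HN) as HA.
  (* Half of the relative excess of [V]: an inequality with [theta = 1 + eta] still contradicts the
     choice of [V]. The value of [e] below makes [cross_bound_of_tanfield] produce exactly this
     [theta]. *)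
  set (eta := (chi * pairpow N m V - gapsum N m V) / (2 * gapsum N m V)).
  assert (Heta : 0 < eta) by (apply Rdiv_lt_0_compat; lra).
  assert (HNp : 0 < INR N) by (apply lt_0_INR; lia).
  pose proof (Rpower_pos 2 m) as H2m. pose proof (Rpower_pos d (m + 1)) as Hdm.
  set (e := eta / (INR N * Rpower 2 m)).
  assert (He : 0 < e) by (apply Rdiv_lt_0_compat; auto; apply Rmult_lt_0_compat; auto).
  destruct (renorm_tanfield_vanish N m chi X0 X Hm HN HX (e ^ 2 * Rpower d (m + 1))) as (t0 & Ht0 & Hv).
  { apply Rmult_lt_0_compat; auto. apply pow_lt; auto. }
  set (t := t0 + s + 1).
  assert (HW : forall i, (i < N)%nat -> Rabs (tanfield N m chi (renorm N X t) i) <= e).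
  { intros i Hi. specialize (Hv t ltac:(unfold t; lra) d Hd).
    assert (H : tanfield N m chi (renorm N X t) i ^ 2 * Rpower d (m + 1) <= e ^ 2 * Rpower d (m + 1)).
    { apply Hv; auto. intros k Hk. apply Hg; auto; [unfold t; lra|exact I]. }
    apply Rmult_le_reg_r in H; auto.
    apply Rabs_le. split; nra. }
  assert (HJ : chi * pairpow N m V <= (1 + INR N * e * Rpower 2 m) * gapsum N m V).
  { apply (pairpow_le_of_cross N m chi _ (renorm N X t)); auto using inR_incr; [lra| |].
    - apply (renorm_unit N m chi X0 X); auto. unfold t; lra.
    - intros k Hk. apply cross_bound_of_tanfield; auto.
      + apply (renorm_unit N m chi X0 X); auto. unfold t; lra.
      + apply (renorm_inR N m chi X0 X); auto. unfold t; lra.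
      + apply (renorm_Fpm_nonneg N m chi X0 X); auto. unfold t; lra. }
  replace (INR N * e * Rpower 2 m) with eta in HJ by (unfold e; field; lra).
  assert (eta * gapsum N m V = (chi * pairpow N m V - gapsum N m V) / 2) by (unfold eta; field; lra).
  lra.
Qed.

(** * Limit profiles *)

Lemma is_lim_seq_Rpower_pos (u : nat -> R) (l e : R) :
  0 < l -> is_lim_seq u l -> is_lim_seq (fun n => Rpower (u n) e) (Rpower l e).
Proof.
  intros Hl Hu. apply (is_lim_seq_continuous (fun x => Rpower x e) u l); auto.
  apply continuity_pt_filterlim. apply (ex_derive_continuous (V := R_NormedModule) (fun x => Rpower x e) l).
  eexists. exact (is_derive_Rpower e l Hl).
Qed.

Lemma is_lim_seq_Rpower_0 (u : nat -> R) (e : R) :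
  0 < e -> (forall n, 0 < u n) -> is_lim_seq u 0 -> is_lim_seq (fun n => Rpower (u n) e) 0.
Proof.
  intros He Hp Hu. apply is_lim_seq_spec. intros eps.
  apply is_lim_seq_spec in Hu.
  destruct (Hu (mkposreal _ (Rpower_pos eps (/ e)))) as (n0 & Hn0). simpl in Hn0.
  exists n0. intros n Hn. specialize (Hn0 n Hn). rewrite Rminus_0_r in *.
  rewrite Rabs_pos_eq in * by (left; auto using Rpower_pos).
  replace (pos eps) with (Rpower (Rpower eps (/ e)) e).
  - apply Rlt_Rpower_l; auto.
  - rewrite Rpower_mult, Rinv_l by lra. apply Rpower_1. apply cond_pos.
Qed.

Lemma is_lim_seq_sqrt (u : nat -> R) (l : R) :
  0 <= l -> is_lim_seq u l -> is_lim_seq (fun n => sqrt (u n)) (sqrt l).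
Proof.
  intros Hl Hu. apply (is_lim_seq_continuous sqrt u l); auto.
  apply continuity_pt_sqrt. auto.
Qed.

Lemma rel_blowup_lim N Xs l r i k :
  rel_blowup_set N Xs l r -> (l <= i < r)%nat -> (S k < N)%nat ->
  is_lim_seq (fun n => gap Xs n i / gap Xs n k)
    (real (Lim_seq (fun n => gap Xs n i / gap Xs n k))).
Proof.
  intros (_ & _ & _ & H & _) Hi Hk. apply Lim_seq_correct'. auto.
Qed.

Section Profile.

Variables (N : nat) (Xs : nat -> nat -> R) (l r : nat).
Hypothesis Hinc : forall n, incr N (Xs n).
Hypothesis Hrel : rel_blowup_set N Xs l r.

Definition scale (n : nat) : R := sqrt (rsum (r - l) (fun k => gap Xs n (l + k) ^ 2)).

Definition profile_gap (k : nat) : R :=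
  real (Lim_seq (fun n => gap Xs n (l + k) / scale n)).

Lemma rel_lr : (l < r < N)%nat.
Proof. destruct Hrel as (H1 & H2 & _). lia. Qed.

Lemma gap_pos n k : (S k < N)%nat -> 0 < gap Xs n k.
Proof. intros Hk. unfold gap. specialize (Hinc n k Hk). lra. Qed.

Lemma scale_pos n : 0 < scale n.
Proof.
  pose proof rel_lr. apply sqrt_lt_R0. apply rsum_pos; [lia|].
  intros k Hk. apply pow_lt. apply gap_pos. lia.
Qed.

Lemma scale_div n k :
  (S k < N)%nat ->
  scale n / gap Xs n k = sqrt (rsum (r - l) (fun a => (gap Xs n (l + a) / gap Xs n k) ^ 2)).
Proof.
  intros Hk. pose proof (gap_pos n k Hk) as Hg.
  rewrite <- (sqrt_pow2 (gap Xs n k)) at 1 by lra. unfold scale.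
  rewrite <- sqrt_div_alt by (apply pow_lt; auto). f_equal.
  unfold Rdiv at 1. rewrite Rmult_comm, <- rsum_scal. apply rsum_ext. intros. field. lra.
Qed.

(** The ratio condition of a relative blow-up set is imposed against every gap of the configuration,
    so the block scale is at most of the order of any gap, inside or outside the block. *)
Lemma scale_div_lim k :
  (S k < N)%nat -> exists q : R, 0 <= q /\ is_lim_seq (fun n => scale n / gap Xs n k) q.
Proof.
  intros Hk. pose proof rel_lr.
  set (L := fun a => real (Lim_seq (fun n => gap Xs n (l + a) / gap Xs n k))).
  exists (sqrt (rsum (r - l) (fun a => L a ^ 2))). split; [apply sqrt_pos|].
  apply (is_lim_seq_ext (fun n => sqrt (rsum (r - l) (fun a => (gap Xs n (l + a) / gap Xs n k) ^ 2)))).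
  { intros n. symmetry. apply scale_div; auto. }
  apply is_lim_seq_sqrt; [apply rsum_nonneg; intros; apply pow2_ge_0|].
  apply (rsum_is_lim_seq (r - l) (fun a n => (gap Xs n (l + a) / gap Xs n k) ^ 2) (fun a => L a ^ 2)).
  intros a Ha. simpl.
  pose proof (rel_blowup_lim N Xs l r (l + a) k Hrel ltac:(lia) Hk) as HL.
  repeat apply is_lim_seq_mult'; auto. apply is_lim_seq_const.
Qed.

Lemma scale_div_lim_boundary j :
  (S j < N)%nat -> (S j = l \/ j = r) -> is_lim_seq (fun n => scale n / gap Xs n j) 0.
Proof.
  intros Hj Hb. pose proof rel_lr.
  apply (is_lim_seq_ext (fun n => sqrt (rsum (r - l) (fun a => (gap Xs n (l + a) / gap Xs n j) ^ 2)))).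
  { intros n. symmetry. apply scale_div; auto. }
  rewrite <- sqrt_0. apply is_lim_seq_sqrt; [lra|].
  rewrite <- (rsum_zero (r - l) (fun _ => 0)) by auto.
  apply (rsum_is_lim_seq (r - l) (fun a n => (gap Xs n (l + a) / gap Xs n j) ^ 2) (fun _ => 0)).
  intros a Ha. destruct Hrel as (_ & _ & _ & _ & H5).
  specialize (H5 (l + a)%nat j ltac:(lia) Hj Hb).
  replace 0 with (0 * (0 * 1)) by ring. simpl.
  repeat apply is_lim_seq_mult'; auto. apply is_lim_seq_const.
Qed.

(** Positivity comes from inverting the ratio: [scale / gap] has a finite limit by [scale_div_lim],
    and this limit is at least 1 because the scale dominates each gap of the block. *)
Lemma profile_gap_lim k :
  (k < r - l)%nat ->
  0 < profile_gap k /\ is_lim_seq (fun n => gap Xs n (l + k) / scale n) (profile_gap k).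
Proof.
  intros Hk. pose proof rel_lr.
  destruct (scale_div_lim (l + k) ltac:(lia)) as (q & Hq & Lq).
  assert (Hq1 : 1 <= q).
  { assert (Hle : Rbar_le 1 q); [|exact Hle].
    apply (is_lim_seq_le (fun _ => 1) (fun n => scale n / gap Xs n (l + k))); auto;
      [|apply is_lim_seq_const].
    intros n. pose proof (gap_pos n (l + k) ltac:(lia)) as Hg.
    apply Rmult_le_reg_r with (gap Xs n (l + k)); auto.
    unfold Rdiv. rewrite Rmult_assoc, Rinv_l, Rmult_1_l, Rmult_1_r by lra.
    rewrite <- (sqrt_pow2 (gap Xs n (l + k))) at 1 by lra. apply sqrt_le_1_alt.
    apply (rsum_term_le (r - l) (fun k => gap Xs n (l + k) ^ 2) k); auto.
    intros; apply pow2_ge_0. }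
  assert (Lg : is_lim_seq (fun n => gap Xs n (l + k) / scale n) (/ q)).
  { apply (is_lim_seq_ext (fun n => / (scale n / gap Xs n (l + k)))).
    - intros n. pose proof (gap_pos n (l + k) ltac:(lia)). pose proof (scale_pos n). field. lra.
    - apply (is_lim_seq_inv _ q); auto. intros E. injection E. lra. }
  assert (E : profile_gap k = / q).
  { unfold profile_gap. rewrite (is_lim_seq_unique _ _ Lg). reflexivity. }
  rewrite E. split; [apply Rinv_0_lt_compat; lra|exact Lg].
Qed.

Definition profile : nat -> R := center (r - l + 1) (fun i => rsum i profile_gap).

Lemma profile_gap_eq k : profile (S k) - profile k = profile_gap k.
Proof. unfold profile, center. simpl. ring. Qed.

Lemma profile_inR : inR (r - l + 1) profile.
Proof.
  apply center_inR; [lia|]. intros i Hi. simpl.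
  destruct (profile_gap_lim i ltac:(lia)). lra.
Qed.

Lemma profile_limit : limit_profile Xs l r profile.
Proof.
  split; [apply profile_inR|]. intros k Hk. rewrite profile_gap_eq.
  apply profile_gap_lim; auto.
Qed.

Lemma profile_normalized : gap_normalized (r - l + 1) profile.
Proof.
  unfold gap_normalized. replace (r - l + 1 - 1)%nat with (r - l)%nat by lia.
  rewrite <- sqrt_1. f_equal.
  assert (L : is_lim_seq (fun n => rsum (r - l) (fun k => (gap Xs n (l + k) / scale n) ^ 2))
    (rsum (r - l) (fun k => profile_gap k ^ 2))).
  { apply (rsum_is_lim_seq (r - l) (fun k n => (gap Xs n (l + k) / scale n) ^ 2)
      (fun k => profile_gap k ^ 2)).
    intros k Hk. destruct (profile_gap_lim k Hk) as [_ HL]. simpl.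
    repeat apply is_lim_seq_mult'; auto. apply is_lim_seq_const. }
  apply (is_lim_seq_ext _ (fun _ => 1)) in L.
  - apply is_lim_seq_unique in L. rewrite Lim_seq_const in L. injection L as L.
    rewrite (rsum_ext _ _ (fun k => profile_gap k ^ 2)); [auto|].
    intros. rewrite profile_gap_eq. reflexivity.
  - intros n. pose proof (scale_pos n).
    rewrite (rsum_ext _ _ (fun k => / scale n ^ 2 * gap Xs n (l + k) ^ 2)) by (intros; field; lra).
    rewrite rsum_scal. unfold scale at 1. rewrite pow2_sqrt.
    + apply Rinv_l. apply Rgt_not_eq. apply rsum_pos; [pose proof rel_lr; lia|].
      intros k Hk. apply pow_lt. apply gap_pos. pose proof rel_lr. lia.
    + apply rsum_nonneg. intros. apply pow2_ge_0.
Qed.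

Lemma profile_diff_lim a b :
  (a <= b)%nat -> (b <= r - l)%nat ->
  is_lim_seq (fun n => (Xs n (l + b)%nat - Xs n (l + a)%nat) / scale n) (profile b - profile a).
Proof.
  intros Hab Hb.
  replace (profile b - profile a) with
    (rsum (r - l + 1 - 1) (fun k => if (a <=? k)%nat && (k <? b)%nat then profile_gap k else 0)).
  2:{ rewrite <- (rsum_telescope (r - l + 1) a b profile) by lia. apply rsum_ext.
      intros. rewrite profile_gap_eq. reflexivity. }
  apply (is_lim_seq_ext (fun n => rsum (r - l + 1 - 1) (fun k =>
     if (a <=? k)%nat && (k <? b)%nat then gap Xs n (l + k) / scale n else 0))).
  - intros n. rewrite <- (rsum_telescope (r - l + 1) a b (fun k => Xs n (l + k)%nat)) by lia.
    unfold Rdiv at 2. rewrite Rmult_comm, <- rsum_scal. apply rsum_ext. intros k Hk.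
    destruct (_ && _); [|ring]. unfold gap. rewrite Nat.add_succ_r. unfold Rdiv. ring.
  - apply (rsum_is_lim_seq (r - l + 1 - 1) (fun k n =>
      if (a <=? k)%nat && (k <? b)%nat then gap Xs n (l + k) / scale n else 0)
      (fun k => if (a <=? k)%nat && (k <? b)%nat then profile_gap k else 0)).
    intros k Hk. destruct (_ && _); [|apply is_lim_seq_const]. apply profile_gap_lim. lia.
Qed.

Lemma scale_lim : is_lim_seq scale 0.
Proof.
  unfold scale. rewrite <- sqrt_0. apply is_lim_seq_sqrt; [lra|].
  rewrite <- (rsum_zero (r - l) (fun _ => 0)) by auto.
  apply (rsum_is_lim_seq (r - l) (fun a n => gap Xs n (l + a) ^ 2) (fun _ => 0)).
  intros a Ha. destruct Hrel as (_ & _ & H3 & _). specialize (H3 (l + a)%nat ltac:(lia)).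
  replace 0 with (0 * (0 * 1)) by ring. simpl.
  repeat apply is_lim_seq_mult'; auto. apply is_lim_seq_const.
Qed.

(** This makes [scale / M] an admissible [rho] in [renorm_tanfield_vanish], so that the tangential
    field can be measured at the scale of the block. *)
Lemma gap_lower_scale :
  exists M n0, 0 < M /\ forall n k, (n0 <= n)%nat -> (S k < N)%nat -> scale n / M <= gap Xs n k.
Proof.
  assert (Hq : forall q, (q <= N)%nat -> exists M n0, 0 < M /\
     forall n k, (n0 <= n)%nat -> (S k < q)%nat -> scale n / M <= gap Xs n k).
  { induction q as [|q IH]; intros Hq; [exists 1, O; split; [lra|intros; lia]|].
    destruct (IH ltac:(lia)) as (M & n0 & HM & HM').
    destruct q as [|k]; [exists 1, O; split; [lra|intros; lia]|].
    destruct (scale_div_lim k ltac:(lia)) as (c & Hc & Lc).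
    apply is_lim_seq_spec in Lc. destruct (Lc (mkposreal 1 Rlt_0_1)) as (n1 & Hn1).
    exists (Rmax M (c + 1)), (Nat.max n0 n1).
    assert (HR1 : M <= Rmax M (c + 1)) by apply Rmax_l.
    assert (HR2 : c + 1 <= Rmax M (c + 1)) by apply Rmax_r.
    split; [lra|]. intros n j Hn Hj. pose proof (scale_pos n) as Hs.
    assert (Hmono : forall M', 0 < M' -> M' <= Rmax M (c + 1) ->
       scale n / Rmax M (c + 1) <= scale n / M').
    { intros M' HM0 HM1. apply Rmult_le_compat_l; [lra|]. apply Rinv_le_contravar; auto. }
    destruct (Nat.eq_dec j k) as [->|Hjk].
    - eapply Rle_trans; [apply (Hmono (c + 1)); lra|].
      specialize (Hn1 n ltac:(lia)). simpl in Hn1. apply Rabs_def2 in Hn1.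
      pose proof (gap_pos n k ltac:(lia)) as Hg.
      apply Rmult_le_reg_r with (c + 1); [lra|].
      unfold Rdiv. rewrite Rmult_assoc, Rinv_l, Rmult_1_r by lra.
      replace (scale n) with (gap Xs n k * (scale n / gap Xs n k)) by (field; lra).
      apply Rmult_le_compat_l; lra.
    - eapply Rle_trans; [apply (Hmono M); lra|]. apply HM'; lia. }
  apply Hq. lia.
Qed.

(** Inside the block, distances divided by the scale converge to those of the profile. A particle
    outside lies beyond a boundary gap, which is infinitely larger than the scale, so its rescaled
    influence vanishes. *)
Lemma scaled_kernel_lim m a j :
  0 < m -> (a <= r - l)%nat -> (j < N)%nat -> j <> (l + a)%nat ->
  is_lim_seq (fun n => Rpower (Rabs (Xs n j - Xs n (l + a)%nat)) (- m) * Rpower (scale n) m)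
    (Finite (if (l <=? j)%nat && (j <=? r)%nat
     then Rpower (Rabs (profile (j - l) - profile a)) (- m) else 0)).
Proof.
  intros Hm Ha Hj Hja. pose proof rel_lr as Hlr.
  assert (Hpos : forall n, 0 < Rabs (Xs n j - Xs n (l + a)%nat)).
  { intros n. destruct (incr_abs N (Xs n) (l + a) j (Hinc n) ltac:(lia) Hj ltac:(auto)). lra. }
  destruct (Nat.leb_spec l j), (Nat.leb_spec j r); simpl.
  - set (b := (j - l)%nat). replace j with (l + b)%nat in * by (unfold b; lia).
    assert (Hd : is_lim_seq (fun n => Rabs ((Xs n (l + b)%nat - Xs n (l + a)%nat) / scale n))
       (Rabs (profile b - profile a))).
    { apply (is_lim_seq_abs _ (profile b - profile a)).
      destruct (le_lt_dec a b) as [Hab|Hab]; [apply profile_diff_lim; lia|].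
      replace (profile b - profile a) with (- (profile a - profile b)) by ring.
      apply (is_lim_seq_ext (fun n => - ((Xs n (l + a)%nat - Xs n (l + b)%nat) / scale n))).
      - intros n. pose proof (scale_pos n). field. lra.
      - apply (is_lim_seq_opp _ (profile a - profile b)). apply profile_diff_lim; lia. }
    destruct (incr_abs (r - l + 1) profile a b (inR_incr _ _ profile_inR)
       ltac:(lia) ltac:(lia) ltac:(lia)) as [E Ep].
    apply (is_lim_seq_ext (fun n => Rpower (Rabs ((Xs n (l + b)%nat - Xs n (l + a)%nat) / scale n)) (- m))).
    + intros n. pose proof (scale_pos n). rewrite Rabs_div by lra.
      rewrite (Rabs_pos_eq (scale n)) by lra. rewrite Rpower_div, Ropp_involutive; auto.
    + apply is_lim_seq_Rpower_pos; [lra|exact Hd].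
  - apply (is_lim_seq_ext (fun n => Rpower (scale n / Rabs (Xs n j - Xs n (l + a)%nat)) m)).
    { intros n. rewrite Rpower_div by auto using scale_pos. ring. }
    apply is_lim_seq_Rpower_0; [auto|intros; apply Rdiv_lt_0_compat; auto using scale_pos|].
    apply (is_lim_seq_le_le (fun _ => 0) _ (fun n => scale n / gap Xs n r));
      [|apply is_lim_seq_const|apply scale_div_lim_boundary; lia].
    intros n. pose proof (scale_pos n) as Hs.
    split; [left; apply Rdiv_lt_0_compat; auto|].
    apply Rmult_le_compat_l; [lra|]. apply Rinv_le_contravar; [apply gap_pos; lia|].
    assert (Xs n (S r) <= Xs n j) by (apply (incr_le N); auto).
    assert (Xs n (l + a)%nat <= Xs n r) by (apply (incr_le N); auto; lia).
    unfold gap. eapply Rle_trans; [|apply Rle_abs]. lra.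
  - apply (is_lim_seq_ext (fun n => Rpower (scale n / Rabs (Xs n j - Xs n (l + a)%nat)) m)).
    { intros n. rewrite Rpower_div by auto using scale_pos. ring. }
    apply is_lim_seq_Rpower_0; [auto|intros; apply Rdiv_lt_0_compat; auto using scale_pos|].
    apply (is_lim_seq_le_le (fun _ => 0) _ (fun n => scale n / gap Xs n (l - 1)));
      [|apply is_lim_seq_const|apply scale_div_lim_boundary; lia].
    intros n. pose proof (scale_pos n) as Hs.
    split; [left; apply Rdiv_lt_0_compat; auto|].
    apply Rmult_le_compat_l; [lra|]. apply Rinv_le_contravar; [apply gap_pos; lia|].
    assert (Xs n j <= Xs n (l - 1)%nat) by (apply (incr_le N); auto; lia).
    assert (Xs n l <= Xs n (l + a)%nat) by (apply (incr_le N); auto; lia).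
    unfold gap. replace (S (l - 1)) with l by lia.
    rewrite Rabs_minus_sym. eapply Rle_trans; [|apply Rle_abs]. lra.
  - lia.
Qed.

Lemma adj_shift i j : adj (l + i) (l + j) = adj i j.
Proof.
  unfold adj. destruct (Nat.eqb_spec (S (l + i)) (l + j)), (Nat.eqb_spec (S i) j),
    (Nat.eqb_spec (S (l + j)) (l + i)), (Nat.eqb_spec (S j) i); try lia; reflexivity.
Qed.

Lemma sgn_shift i j : sgn (l + i) (l + j) = sgn i j.
Proof.
  unfold sgn. destruct (Nat.ltb_spec (l + i) (l + j)), (Nat.ltb_spec i j); try lia; reflexivity.
Qed.

(** The block decouples in the limit: by homogeneity of degree [- m], the rescaled force becomes
    that of an isolated system of [r - l + 1] particles with the same [chi]. *)
Lemma scaled_force_lim m chi a :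
  0 < m -> (a <= r - l)%nat ->
  is_lim_seq (fun n => force N (kap chi) (pw m) (Xs n) (l + a) * Rpower (scale n) m)
    (force (r - l + 1) (kap chi) (pw m) profile a).
Proof.
  intros Hm Ha. pose proof rel_lr as Hlr.
  set (lam := fun j => if (l + a =? j)%nat then 0 else kap chi (l + a) j * sgn (l + a) j *
     (if (l <=? j)%nat && (j <=? r)%nat
     then Rpower (Rabs (profile (j - l) - profile a)) (- m) else 0)).
  replace (force (r - l + 1) (kap chi) (pw m) profile a) with (rsum N lam).
  - apply (is_lim_seq_ext (fun n => rsum N (fun j => if (l + a =? j)%nat then 0 else
      kap chi (l + a) j * sgn (l + a) j * (Rpower (Rabs (Xs n j - Xs n (l + a)%nat)) (- m) * Rpower (scale n) m)))).
    + intros n. unfold force. rewrite Rmult_comm, <- rsum_scal. apply rsum_ext. intros j Hj.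
      unfold pw. destruct (_ =? _)%nat; ring.
    + apply (rsum_is_lim_seq N (fun j n => if (l + a =? j)%nat then 0 else
        kap chi (l + a) j * sgn (l + a) j * (Rpower (Rabs (Xs n j - Xs n (l + a)%nat)) (- m) * Rpower (scale n) m)) lam).
      intros j Hj. unfold lam. destruct (Nat.eqb_spec (l + a) j) as [E|E]; [apply is_lim_seq_const|].
      match goal with |- is_lim_seq _ (Finite (?c * ?v)) => apply (is_lim_seq_scal_l _ c v) end.
      apply scaled_kernel_lim; auto.
  - replace N with (l + ((r - l + 1) + (N - r - 1)))%nat by lia.
    rewrite (rsum_add l), (rsum_add (r - l + 1)), (rsum_zero l), (rsum_zero (N - r - 1)).
    + rewrite Rplus_0_l, Rplus_0_r. apply rsum_ext. intros b Hb. unfold lam, kap.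
      rewrite adj_shift, sgn_shift.
      destruct (Nat.leb_spec l (l + b)), (Nat.leb_spec (l + b) r); try lia. simpl.
      replace (l + b - l)%nat with b by lia.
      destruct (Nat.eqb_spec (l + a) (l + b)), (Nat.eqb_spec a b); try lia; reflexivity.
    + intros j Hj. unfold lam.
      destruct (Nat.leb_spec (l + (r - l + 1 + j)) r); [lia|]. rewrite andb_false_r.
      destruct (_ =? _)%nat; ring.
    + intros j Hj. unfold lam. destruct (Nat.leb_spec l j); [lia|]. simpl.
      destruct (_ =? _)%nat; ring.
Qed.

End Profile.

Lemma renorm_profile_critical N m chi X0 X (t : nat -> R) l r :
  1 < m -> (2 <= N)%nat -> is_sol N m chi X0 X p_infty ->
  (forall n, 0 <= t n) -> is_lim_seq t p_infty ->
  rel_blowup_set N (fun n => renorm N X (t n)) l r ->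
  exists Z, limit_profile (fun n => renorm N X (t n)) l r Z
    /\ is_critical_point (r - l + 1) m chi Z /\ gap_normalized (r - l + 1) Z.
Proof.
  intros Hm HN HX Ht0 Ht Hrel. set (Xs := fun n => renorm N X (t n)) in *.
  assert (Hinc : forall n, incr N (Xs n)).
  { intros n. apply (renorm_unit N m chi X0 X); auto. }
  exists (profile Xs l r).
  split; [|split]; [apply (profile_limit N); auto| |apply (profile_normalized N); auto].
  apply critical_force; auto. split; [apply (profile_inR N); auto|].
  intros a Ha. pose proof (rel_lr N Xs l r Hrel) as Hlr.
  pose proof (scaled_force_lim N Xs l r Hinc Hrel m chi a ltac:(lra) ltac:(lia)) as L.
  set (sc := scale Xs l r) in *.
  assert (Hsc : forall n, 0 < sc n) by (intros n; apply (scale_pos N); auto).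
  assert (Lsc : is_lim_seq sc 0) by (apply (scale_lim N); auto).
  (* With [rho] of the order of [sc], the square of the tangential field is [o(sc^(-(m+1)))]. Since
     [m > 1], [sc^(2m) <= sc^(m+1)] as soon as [sc < 1]. *)
  assert (LW : is_lim_seq (fun n => tanfield N m chi (Xs n) (l + a) * Rpower (sc n) m) 0).
  { destruct (gap_lower_scale N Xs l r Hinc Hrel) as (M & n0 & HM & Hgap).
    apply is_lim_seq_spec. intros eps. simpl. pose proof (cond_pos eps) as Heps.
    pose proof (Rpower_pos M (m + 1)) as HMm.
    destruct (renorm_tanfield_vanish N m chi X0 X Hm HN HX ((eps / 2) ^ 2 / Rpower M (m + 1)))
      as (t0 & _ & Hv).
    { apply Rdiv_lt_0_compat; auto. apply pow_lt. lra. }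
    apply is_lim_seq_spec in Ht. destruct (Ht t0) as (n1 & Hn1).
    apply is_lim_seq_spec in Lsc. destruct (Lsc (mkposreal 1 Rlt_0_1)) as (n2 & Hn2). simpl in Hn2.
    exists (Nat.max n0 (Nat.max n1 n2)). intros n Hn. rewrite Rminus_0_r.
    specialize (Hn1 n ltac:(lia)). specialize (Hn2 n ltac:(lia)).
    rewrite Rminus_0_r in Hn2. apply Rabs_def2 in Hn2. specialize (Hsc n).
    assert (H : tanfield N m chi (Xs n) (l + a) ^ 2 * Rpower (sc n / M) (m + 1)
                <= (eps / 2) ^ 2 / Rpower M (m + 1)).
    { apply (Hv (t n)); [lra|apply Rdiv_lt_0_compat; auto| |lia].
      intros k Hk. apply Hgap; auto. lia. }
    rewrite Rpower_div, Rpower_Ropp in H by auto.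
    assert (H' : tanfield N m chi (Xs n) (l + a) ^ 2 * Rpower (sc n) (m + 1) <= (eps / 2) ^ 2).
    { apply Rmult_le_reg_r with (/ Rpower M (m + 1)); [apply Rinv_0_lt_compat; auto|].
      rewrite Rmult_assoc. exact H. }
    set (w := tanfield N m chi (Xs n) (l + a)) in *.
    assert (Hw : (w * Rpower (sc n) m) ^ 2 <= (eps / 2) ^ 2).
    { eapply Rle_trans; [|exact H']. rewrite Rpow_mult_distr.
      apply Rmult_le_compat_l; [apply pow2_ge_0|]. simpl. rewrite Rmult_1_r, <- Rpower_plus.
      replace (m + m) with ((m + 1) + (m - 1)) by ring. rewrite Rpower_plus.
      rewrite <- (Rmult_1_r (Rpower (sc n) (m + 1))) at 2.
      apply Rmult_le_compat_l; [left; apply Rpower_pos|].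
      apply Rle_trans with (Rpower 1 (m - 1)); [apply Rle_Rpower_l; lra|].
      rewrite Rpower_base_1. lra. }
    apply Rabs_def1; nra. }
  (* The multiplier stays bounded because [F(Y)] is nonnegative and nonincreasing, so its term
     disappears with the factor [sc^m]. *)
  assert (LF : is_lim_seq (fun n => (m - 1) * Fpm N m chi (Xs n) * Xs n (l + a)%nat * Rpower (sc n) m) 0).
  { set (P := Fpm N m chi (renorm N X 1)).
    assert (Lb : is_lim_seq (fun n => (m - 1) * P * Rpower (sc n) m) 0).
    { replace (Finite 0) with (Rbar_mult ((m - 1) * P) 0) by (simpl; f_equal; ring).
      apply is_lim_seq_scal_l. apply is_lim_seq_Rpower_0; auto. lra. }
    apply is_lim_seq_abs_0.
    apply (is_lim_seq_le_le_loc (fun _ => 0) _ (fun n => (m - 1) * P * Rpower (sc n) m)); auto;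
      [|apply is_lim_seq_const].
    apply is_lim_seq_spec in Ht. destruct (Ht 1) as (n1 & Hn1).
    exists n1. intros n Hn. specialize (Hn1 n Hn). split; [apply Rabs_pos|].
    pose proof (renorm_Fpm_bound N m chi X0 X Hm HN HX (t n) ltac:(lra)).
    pose proof (renorm_Fpm_nonneg N m chi X0 X Hm HN HX (t n) ltac:(lra)).
    pose proof (unit_coord N (Xs n) (l + a) (renorm_unit N m chi X0 X HN HX (t n) ltac:(lra)) ltac:(lia)).
    fold (Xs n) in *. pose proof (Rabs_pos (Xs n (l + a)%nat)).
    rewrite !Rabs_mult, (Rabs_pos_eq (m - 1)), (Rabs_pos_eq (Fpm _ _ _ _)),
      (Rabs_pos_eq (Rpower _ _)); try lra; [|left; apply Rpower_pos].
    apply Rmult_le_compat_r; [left; apply Rpower_pos|].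
    rewrite <- (Rmult_1_r ((m - 1) * P)). apply Rmult_le_compat; auto.
    - apply Rmult_le_pos; lra.
    - apply Rmult_le_compat_l; [lra|auto]. }
  pose proof (is_lim_seq_plus' _ _ _ _ LW LF) as LS. rewrite Rplus_0_r in LS.
  apply (is_lim_seq_ext _ (fun n => force N (kap chi) (pw m) (Xs n) (l + a) * Rpower (sc n) m)) in LS.
  - apply is_lim_seq_unique in LS. apply is_lim_seq_unique in L. rewrite LS in L.
    injection L. auto.
  - intros n. unfold tanfield. ring.
Qed.

(** * Existence of relative blow-up sets *)

(** The upper limit is a cluster point; [psi] picks at rank [n] an index past the previous one with
    value within [1 / (n+1)] of it. *)
Lemma bounded_subsequence (v : nat -> R) :
  (forall n, 0 <= v n <= 1) ->
  exists psi : nat -> nat, (forall n, (psi n < psi (S n))%nat) /\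
    ex_finite_lim_seq (fun n => v (psi n)).
Proof.
  intros Hv. destruct (ex_LimSup_seq v) as [L HL].
  assert (HLf : exists x, is_LimSup_seq v (Finite x)).
  { destruct L as [x| |]; [exists x; auto| |].
    - destruct (HL 1 O) as (n & _ & Hn). specialize (Hv n). lra.
    - destruct (HL 0) as (n & Hn). specialize (Hn n (Nat.le_refl n)). specialize (Hv n). lra. }
  destruct HLf as [x Hx].
  assert (Hh : forall kn : nat * nat, exists n, (snd kn <= n)%nat /\ Rabs (v n - x) < / (INR (fst kn) + 1)).
  { intros [k n0]. assert (Hk : 0 < / (INR k + 1)).
    { apply Rinv_0_lt_compat. pose proof (pos_INR k). lra. }
    destruct (Hx (mkposreal _ Hk)) as [H1 (n1 & H2)].
    destruct (H1 (Nat.max n0 n1)) as (n & Hn & Hn'). specialize (H2 n ltac:(lia)).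
    exists n. simpl in *. split; [lia|]. apply Rabs_def1; lra. }
  set (h := fun k n => proj1_sig (constructive_indefinite_description _ (Hh (k, n)))).
  assert (Hh' : forall k n, (n <= h k n)%nat /\ Rabs (v (h k n) - x) < / (INR k + 1)).
  { intros k n. exact (proj2_sig (constructive_indefinite_description _ (Hh (k, n)))). }
  set (psi := fix psi n := match n with O => h O O | S k => h (S k) (S (psi k)) end).
  exists psi. split.
  - intros n. simpl. destruct (Hh' (S n) (S (psi n))). lia.
  - exists x. apply (is_lim_seq_le_le (fun n => x - / (INR n + 1)) _ (fun n => x + / (INR n + 1))).
    + intros n. assert (H : Rabs (v (psi n) - x) < / (INR n + 1)) by (destruct n; apply Hh').
      apply Rabs_def2 in H. lra.
    + replace (Finite x) with (Finite (x - 0)) by (f_equal; ring).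
      apply is_lim_seq_minus'; [apply is_lim_seq_const|apply is_lim_seq_inv_INR].
    + replace (Finite x) with (Finite (x + 0)) by (f_equal; ring).
      apply is_lim_seq_plus'; [apply is_lim_seq_const|apply is_lim_seq_inv_INR].
Qed.

Lemma bounded_family_subsequence (q : nat) (u : nat -> nat -> R) :
  (forall k n, (k < q)%nat -> 0 <= u k n <= 1) ->
  exists phi : nat -> nat, filterlim phi eventually eventually /\
    forall k, (k < q)%nat -> ex_finite_lim_seq (fun n => u k (phi n)).
Proof.
  induction q as [|q IH]; intros Hu.
  - exists (fun n => n). split; [apply filterlim_id|intros; lia].
  - destruct IH as (phi & Hphi & Hlim); [intros; apply Hu; lia|].
    destruct (bounded_subsequence (fun n => u q (phi n))) as (psi & Hpsi & Hl).
    { intros n. apply Hu. lia. }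
    apply eventually_subseq in Hpsi.
    exists (fun n => phi (psi n)). split.
    + apply (filterlim_comp _ _ _ psi phi _ _ _ Hpsi Hphi).
    + intros k Hk. destruct (Nat.eq_dec k q) as [->|Hkq]; [exact Hl|].
      destruct (Hlim k ltac:(lia)) as [x Hx]. exists x.
      apply (is_lim_seq_subseq (fun n => u k (phi n)) x psi); auto.
Qed.

(** The left boundary is phrased with [S j = l] so that [l = 0] imposes nothing, as in
    [rel_blowup_set]. *)
Lemma maximal_interval (P : nat -> Prop) (q k : nat) :
  (k < q)%nat -> P k ->
  exists l r, (l <= k < r)%nat /\ (r <= q)%nat /\ (forall i, (l <= i < r)%nat -> P i) /\
    (forall j, S j = l -> ~ P j) /\ ((r < q)%nat -> ~ P r).
Proof.
  intros Hk HP.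
  assert (HL : exists l, (l <= k)%nat /\ (forall i, (l <= i <= k)%nat -> P i) /\
     (forall j, S j = l -> ~ P j)).
  { clear Hk. induction k as [|k IH].
    - exists O. repeat split; [lia| |intros; lia]. intros i Hi. replace i with O by lia. auto.
    - destruct (Classical_Prop.classic (P k)) as [Hp|Hp].
      + destruct (IH Hp) as (l & Hl & H1 & H2). exists l. split; [lia|split; [|exact H2]].
        intros i Hi. destruct (Nat.eq_dec i (S k)) as [->|]; auto. apply H1. lia.
      + exists (S k). repeat split; auto.
        * intros i Hi. replace i with (S k) by lia. auto.
        * intros j Hj. injection Hj as ->. auto. }
  assert (HR : forall d, (k + d < q)%nat -> exists r, (k < r <= S (k + d))%nat /\
     (forall i, (k <= i < r)%nat -> P i) /\ ((r <= k + d)%nat -> ~ P r)).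
  { induction d as [|d IH]; intros Hd.
    - exists (S k). repeat split; try lia. intros i Hi. replace i with k by lia. auto.
    - destruct (IH ltac:(lia)) as (r & Hr & H1 & H2).
      destruct (le_lt_dec r (k + d)) as [Hrd|Hrd].
      + exists r. repeat split; auto; lia.
      + destruct (Classical_Prop.classic (P r)) as [Hp|Hp].
        * exists (S r). repeat split; try lia. intros i Hi.
          destruct (Nat.eq_dec i r) as [->|]; auto. apply H1. lia.
        * exists r. repeat split; auto; lia. }
  destruct HL as (l & Hl & H1 & H2). destruct (HR (q - 1 - k)%nat ltac:(lia)) as (r & Hr & H3 & H4).
  exists l, r. repeat split; auto; try lia.
  - intros i Hi. destruct (le_lt_dec i k); [apply H1|apply H3]; lia.
  - intros Hrq. apply H4. lia.
Qed.

(* After extraction the quantities [1 / gap_k], divided by their sum, converge; the gaps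
   with nonzero limit are those of smallest order, and [l, r] is a maximal run of such. *)
Lemma rel_blowup_set_extraction N Xs i0 :
  (forall n, incr N (Xs n)) -> (S i0 < N)%nat -> is_lim_seq (fun n => gap Xs n i0) 0 ->
  exists phi l r, filterlim phi eventually eventually /\
    rel_blowup_set N (fun n => Xs (phi n)) l r.
Proof.
  intros Hinc Hi0 L0.
  assert (Hg : forall n k, (k < N - 1)%nat -> 0 < gap Xs n k).
  { intros n k Hk. unfold gap. specialize (Hinc n k ltac:(lia)). lra. }
  set (s := fun n => rsum (N - 1) (fun k => / gap Xs n k)).
  assert (Hinv : forall n k, (k < N - 1)%nat -> 0 < / gap Xs n k).
  { intros. apply Rinv_0_lt_compat. auto. }
  assert (Hs : forall n, 0 < s n) by (intros n; apply rsum_pos; auto; lia).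
  assert (Hsk : forall n k, (k < N - 1)%nat -> / gap Xs n k <= s n).
  { intros n k Hk. apply (rsum_term_le (N - 1) (fun k => / gap Xs n k) k); auto.
    intros; left; auto. }
  set (u := fun k n => / gap Xs n k / s n).
  assert (Hu : forall k n, (k < N - 1)%nat -> 0 < u k n <= 1).
  { intros k n Hk. split; [apply Rdiv_lt_0_compat; auto|].
    apply Rmult_le_reg_r with (s n); auto. unfold u, Rdiv.
    rewrite Rmult_assoc, Rinv_l, Rmult_1_l, Rmult_1_r by (apply Rgt_not_eq, Hs). auto. }
  destruct (bounded_family_subsequence (N - 1) u) as (phi & Hphi & Hlim).
  { intros k n Hk. destruct (Hu k n Hk). lra. }
  set (b := fun k => real (Lim_seq (fun n => u k (phi n)))).
  assert (Hb : forall k, (k < N - 1)%nat -> is_lim_seq (fun n => u k (phi n)) (b k)).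
  { intros k Hk. apply Lim_seq_correct'. auto. }
  assert (Hb0 : forall k, (k < N - 1)%nat -> 0 <= b k).
  { intros k Hk. assert (H : Rbar_le 0 (b k)); [|exact H].
    apply (is_lim_seq_le (fun _ => 0) (fun n => u k (phi n))); auto; [|apply is_lim_seq_const].
    intros n. destruct (Hu k (phi n) Hk). lra. }
  assert (Hsum : rsum (N - 1) b = 1).
  { pose proof (rsum_is_lim_seq (N - 1) (fun k n => u k (phi n)) b Hb) as L.
    apply (is_lim_seq_ext _ (fun _ => 1)) in L.
    - apply is_lim_seq_unique in L. rewrite Lim_seq_const in L. injection L. auto.
    - intros n. unfold u, Rdiv.
      rewrite (rsum_ext _ _ (fun k => / s (phi n) * / gap Xs (phi n) k)) by (intros; ring).
      rewrite rsum_scal. apply Rinv_l. apply Rgt_not_eq, Hs. }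
  assert (Hk0 : exists k, (k < N - 1)%nat /\ 0 < b k).
  { apply Classical_Prop.NNPP. intros Hn. rewrite rsum_zero in Hsum; [lra|].
    intros k Hk. destruct (Hb0 k Hk) as [H|H]; auto. exfalso. apply Hn. exists k. auto. }
  destruct Hk0 as (k0 & Hk0 & Hbk0).
  destruct (maximal_interval (fun k => 0 < b k) (N - 1) k0 Hk0 Hbk0)
    as (l & r & Hlr & HrN & HP & HPl & HPr).
  assert (Hratio : forall i k, (i < N - 1)%nat -> (k < N - 1)%nat -> 0 < b i ->
    is_lim_seq (fun n => gap (fun n => Xs (phi n)) n i / gap (fun n => Xs (phi n)) n k) (b k / b i)).
  { intros i k Hi Hk Hbi.
    apply (is_lim_seq_ext (fun n => u k (phi n) / u i (phi n))).
    - intros n. unfold u. change (gap (fun n => Xs (phi n)) n) with (gap Xs (phi n)).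
      pose proof (Hg (phi n) i Hi). pose proof (Hg (phi n) k Hk). pose proof (Hs (phi n)).
      field. lra.
    - apply is_lim_seq_div'; auto. lra. }
  exists phi, l, r. split; auto. repeat split; try lia.
  - intros i Hi. pose proof (HP i Hi) as Hbi. simpl in Hbi.
    (* From [/ gap i0 <= s] follows [gap i <= gap i0 / u i]: gaps of the run have the smallest
       order, so they tend to 0 with gap [i0] even if the run does not contain [i0]. *)
    apply (is_lim_seq_le_le (fun _ => 0) _ (fun n => gap Xs (phi n) i0 / u i (phi n))).
    + intros n. change (gap (fun n => Xs (phi n)) n i) with (gap Xs (phi n) i).
      pose proof (Hg (phi n) i ltac:(lia)). pose proof (Hg (phi n) i0 ltac:(lia)) as Hgi0.
      split; [lra|]. unfold u.
      pose proof (Hsk (phi n) i0 ltac:(lia)) as Hle. pose proof (Hs (phi n)).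
      replace (gap Xs (phi n) i0 / (/ gap Xs (phi n) i / s (phi n)))
        with (gap Xs (phi n) i * (gap Xs (phi n) i0 * s (phi n))) by (field; lra).
      rewrite <- (Rmult_1_r (gap Xs (phi n) i)) at 1. apply Rmult_le_compat_l; [lra|].
      rewrite <- (Rinv_r (gap Xs (phi n) i0)) by lra. apply Rmult_le_compat_l; lra.
    + apply is_lim_seq_const.
    + replace (Finite 0) with (Finite (0 / b i)) by (f_equal; field; lra).
      apply is_lim_seq_div'; [|apply Hb; lia|lra].
      apply (is_lim_seq_subseq (fun n => gap Xs n i0) 0 phi); auto.
  - intros i k Hi Hk. exists (b k / b i). apply Hratio; try lia. apply HP; auto.
  - intros i j Hi Hj Hbd. pose proof (HP i Hi) as Hbi. simpl in Hbi.
    assert (Hbj : b j = 0).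
    { assert (~ 0 < b j).
      { destruct Hbd as [Hbd|Hbd]; [apply HPl; auto|subst j; apply HPr; lia]. }
      pose proof (Hb0 j ltac:(lia)). lra. }
    pose proof (Hratio i j ltac:(lia) ltac:(lia) Hbi) as L.
    rewrite Hbj in L. replace (0 / b i) with 0 in L by (field; lra). exact L.
Qed.

(** * Local existence and blow-up in finite time *)

Lemma abs_RInt_le_cst (f : R -> R) (a b M : R) :
  (forall x, continuous f x) -> (forall x, Rabs (f x) <= M) ->
  Rabs (RInt f a b) <= M * Rabs (b - a).
Proof.
  intros Hc HM.
  assert (Hex : forall a b, ex_RInt f a b) by (intros; apply (ex_RInt_continuous f); auto).
  assert (Hle : forall a b, a <= b -> Rabs (RInt f a b) <= M * Rabs (b - a)).
  { clear a b. intros a b Hab. rewrite (Rabs_pos_eq (b - a)), Rmult_comm by lra.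
    apply abs_RInt_le_const; auto. }
  destruct (Rle_dec a b) as [Hab|Hab]; [auto|].
  rewrite <- opp_RInt_swap by auto. rewrite Rabs_minus_sym.
  change (opp (RInt f b a)) with (- RInt f b a). rewrite Rabs_Ropp. apply Hle. lra.
Qed.

Lemma continuous_of_lipschitz (f : R -> R) (K x : R) :
  (forall s t, Rabs (f s - f t) <= K * Rabs (s - t)) -> continuous f x.
Proof.
  intros H. apply continuity_pt_filterlim. intros eps Heps.
  exists (eps / (Rabs K + 1)). pose proof (Rabs_pos K) as HK.
  split; [apply Rdiv_lt_0_compat; lra|]. intros y [_ Hy]. unfold dist, R_met, Rlimit.dist, R_dist in *.
  simpl in *. unfold Rdist in *.
  eapply Rle_lt_trans; [apply H|].
  apply Rle_lt_trans with ((Rabs K + 1) * Rabs (y - x)).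
  - apply Rmult_le_compat_r; [apply Rabs_pos|]. pose proof (Rle_abs K). lra.
  - apply Rmult_lt_compat_l with (r := Rabs K + 1) in Hy; [|lra].
    replace ((Rabs K + 1) * (eps / (Rabs K + 1))) with eps in Hy by (field; lra). exact Hy.
Qed.

(** * Picard iteration for a bounded Lipschitz field *)

Section Picard.

Variables (N : nat) (f : (nat -> R) -> nat -> R) (M L h : R) (x0 : nat -> R).
Hypothesis HM : 0 <= M.
Hypothesis HL : 0 <= L.
Hypothesis Hh : 0 < h.
Hypothesis HhL : h * L <= / 2.
Hypothesis fbound : forall X i, (i < N)%nat -> Rabs (f X i) <= M.
Hypothesis flip : forall X Y d i, (i < N)%nat ->
  (forall j, (j < N)%nat -> Rabs (X j - Y j) <= d) -> Rabs (f X i - f Y i) <= L * d.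

(* Time is truncated to [-h, h] so that the Picard map contracts uniformly on [R]. *)
Let clamp (t : R) : R := Rmax (- h) (Rmin h t).

Let pic (Y : R -> nat -> R) (t : R) (i : nat) : R :=
  x0 i + RInt (fun s => f (Y s) i) 0 (clamp t).

(** A class of curves that the Picard map preserves, that survives pointwise limits, and in which
    all integrands are continuous. *)
Let lip (Y : R -> nat -> R) : Prop :=
  forall s t i, (i < N)%nat -> Rabs (Y s i - Y t i) <= M * Rabs (s - t).

Lemma clamp_lip s t : Rabs (clamp s - clamp t) <= Rabs (s - t).
Proof.
  unfold clamp, Rmax, Rmin. repeat destruct (Rle_dec _ _);
    unfold Rabs; repeat destruct (Rcase_abs _); lra.
Qed.

Lemma clamp_bound t : Rabs (clamp t) <= h.
Proof.
  unfold clamp, Rmax, Rmin. repeat destruct (Rle_dec _ _);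
    unfold Rabs; repeat destruct (Rcase_abs _); lra.
Qed.

Lemma clamp_id t : Rabs t < h -> clamp t = t.
Proof.
  intros Ht. apply Rabs_def2 in Ht. unfold clamp. rewrite Rmin_right, Rmax_right; lra.
Qed.

Lemma pic_integrand Y i x : lip Y -> (i < N)%nat -> continuous (fun s => f (Y s) i) x.
Proof.
  intros HY Hi. apply (continuous_of_lipschitz _ (L * M)). intros s t.
  rewrite Rmult_assoc. apply flip; auto.
Qed.

Lemma pic_lip Y : lip Y -> lip (pic Y).
Proof.
  intros HY s t i Hi. unfold pic.
  assert (Hex : forall a b, ex_RInt (fun s => f (Y s) i) a b).
  { intros. apply (ex_RInt_continuous (fun s => f (Y s) i)). intros. apply pic_integrand; auto. }
  rewrite <- (RInt_Chasles _ 0 (clamp t) (clamp s)) by auto.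
  match goal with |- Rabs (_ + plus ?a ?b - _) <= _ => change (plus a b) with (a + b) end.
  assert (E : forall a b c : R, a + (b + c) - (a + b) = c) by (intros; ring).
  rewrite E.
  eapply Rle_trans.
  - apply abs_RInt_le_cst; [intros; apply pic_integrand; auto|]. intros; apply fbound; auto.
  - apply Rmult_le_compat_l; auto. apply clamp_lip.
Qed.

Lemma pic_contract Y Z d :
  lip Y -> lip Z ->
  (forall t i, (i < N)%nat -> Rabs (Y t i - Z t i) <= d) ->
  forall t i, (i < N)%nat -> Rabs (pic Y t i - pic Z t i) <= d / 2.
Proof.
  intros HY HZ Hd t i Hi. unfold pic.
  assert (Hex : forall W a b, lip W -> ex_RInt (fun s => f (W s) i) a b).
  { intros. apply (ex_RInt_continuous (fun s => f (W s) i)). intros. apply pic_integrand; auto. }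
  assert (E : forall a b c : R, a + b - (a + c) = b - c) by (intros; ring).
  assert (EM : RInt (fun s => f (Y s) i - f (Z s) i) 0 (clamp t)
    = RInt (fun s => f (Y s) i) 0 (clamp t) - RInt (fun s => f (Z s) i) 0 (clamp t)).
  { apply (RInt_minus (V := R_CompleteNormedModule)); auto. }
  rewrite E, <- EM.
  assert (Hd0 : 0 <= d) by (eapply Rle_trans; [apply Rabs_pos|apply (Hd 0 i Hi)]).
  apply Rle_trans with (L * d * Rabs (clamp t - 0)).
  - apply abs_RInt_le_cst.
    + intros x. apply (continuous_minus (fun s => f (Y s) i) (fun s => f (Z s) i));
        apply pic_integrand; auto.
    + intros x. apply flip; auto.
  - rewrite Rminus_0_r. pose proof (clamp_bound t).
    apply Rle_trans with (L * d * h).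
    + apply Rmult_le_compat_l; [apply Rmult_le_pos; auto|auto].
    + replace (L * d * h) with (d * (h * L)) by ring.
      apply Rmult_le_compat_l; auto.
Qed.

Let U := fix U (n : nat) : R -> nat -> R :=
  match n with O => fun _ i => x0 i | S n => pic (U n) end.

Lemma iter_lip n : lip (U n).
Proof.
  induction n as [|n IH]; [|apply pic_lip; auto].
  intros s t i Hi. simpl. rewrite Rminus_diag, Rabs_R0.
  apply Rmult_le_pos; auto using Rabs_pos.
Qed.

Let D := M * h.

Lemma iter_step n t i : (i < N)%nat -> Rabs (U (S n) t i - U n t i) <= D * (/ 2) ^ n.
Proof.
  revert t i. induction n as [|n IH]; intros t i Hi.
  - simpl. unfold pic. rewrite Rmult_1_r.
    assert (E : forall a b : R, a + b - a = b) by (intros; ring). rewrite E.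
    apply Rle_trans with (M * Rabs (clamp t - 0)).
    + apply abs_RInt_le_cst; [|auto]. intros x. apply (pic_integrand (U 0)); auto. apply iter_lip.
    + rewrite Rminus_0_r. apply Rmult_le_compat_l; auto. apply clamp_bound.
  - replace (D * (/ 2) ^ S n) with (D * (/ 2) ^ n / 2) by (simpl; field).
    apply (pic_contract (U (S n)) (U n)); auto using iter_lip.
Qed.

(** The subtracted term records the part of the geometric tail not yet spent, which lets the
    induction on [k] close. *)
Lemma iter_cauchy n k t i :
  (i < N)%nat -> Rabs (U (n + k) t i - U n t i) <= 2 * D * (/ 2) ^ n - 2 * D * (/ 2) ^ (n + k).
Proof.
  intros Hi. induction k as [|k IH].
  - rewrite Nat.add_0_r, !Rminus_diag, Rabs_R0. lra.
  - rewrite Nat.add_succ_r. pose proof (iter_step (n + k) t i Hi) as Hs.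
    replace (U (S (n + k)) t i - U n t i) with
      ((U (S (n + k)) t i - U (n + k) t i) + (U (n + k) t i - U n t i)) by ring.
    eapply Rle_trans; [apply Rabs_triang|].
    replace ((/ 2) ^ S (n + k)) with ((/ 2) ^ (n + k) / 2) by (simpl; field). lra.
Qed.

Let Y (t : R) (i : nat) : R := real (Lim_seq (fun n => U n t i)).

Lemma half_pow_lim c : is_lim_seq (fun n => c * (/ 2) ^ n) 0.
Proof.
  replace (Finite 0) with (Rbar_mult c 0) by (simpl; f_equal; ring).
  apply is_lim_seq_scal_l. apply is_lim_seq_geom. rewrite Rabs_pos_eq; lra.
Qed.

Lemma D_nonneg : 0 <= D.
Proof. apply Rmult_le_pos; lra. Qed.

Lemma iter_lim t i : (i < N)%nat -> is_lim_seq (fun n => U n t i) (Y t i).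
Proof.
  intros Hi. apply Lim_seq_correct'. apply ex_lim_seq_cauchy_corr. intros eps.
  pose proof (half_pow_lim (2 * D)) as Hl. apply is_lim_seq_spec in Hl.
  assert (He : 0 < eps / 2) by (pose proof (cond_pos eps); lra).
  destruct (Hl (mkposreal _ He)) as (n0 & Hn0). simpl in Hn0.
  specialize (Hn0 n0 (Nat.le_refl _)). rewrite Rminus_0_r in Hn0. apply Rabs_def2 in Hn0.
  assert (Hb : forall n, (n0 <= n)%nat -> Rabs (U n t i - U n0 t i) < eps / 2).
  { intros n Hn. replace n with (n0 + (n - n0))%nat by lia.
    eapply Rle_lt_trans; [apply iter_cauchy; auto|].
    assert (0 <= 2 * D * (/ 2) ^ (n0 + (n - n0))).
    { apply Rmult_le_pos; [pose proof D_nonneg; lra|apply pow_le; lra]. }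
    lra. }
  exists n0. intros n k Hn Hk.
  replace (U n t i - U k t i) with ((U n t i - U n0 t i) - (U k t i - U n0 t i)) by ring.
  eapply Rle_lt_trans; [apply Rabs_triang|]. rewrite Rabs_Ropp.
  pose proof (Hb n Hn). pose proof (Hb k Hk). lra.
Qed.

Lemma limit_close n t i : (i < N)%nat -> Rabs (Y t i - U n t i) <= 2 * D * (/ 2) ^ n.
Proof.
  intros Hi.
  assert (H : Rbar_le (Rabs (Y t i - U n t i)) (2 * D * (/ 2) ^ n)); [|exact H].
  apply (is_lim_seq_le (fun k => Rabs (U (n + k)%nat t i - U n t i)) (fun _ => 2 * D * (/ 2) ^ n)).
  - intros k. eapply Rle_trans; [apply iter_cauchy; auto|].
    assert (0 <= 2 * D * (/ 2) ^ (n + k)).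
    { apply Rmult_le_pos; [pose proof D_nonneg; lra|apply pow_le; lra]. }
    lra.
  - apply (is_lim_seq_abs _ (Y t i - U n t i)).
    apply is_lim_seq_minus'; [|apply is_lim_seq_const].
    apply (is_lim_seq_ext (fun k => U (k + n)%nat t i)); [intros; f_equal; lia|].
    apply (is_lim_seq_incr_n (fun k => U k t i) n). apply iter_lim; auto.
  - apply is_lim_seq_const.
Qed.

Lemma limit_lip : lip Y.
Proof.
  intros s t i Hi.
  assert (H : Rbar_le (Rabs (Y s i - Y t i)) (M * Rabs (s - t))); [|exact H].
  apply (is_lim_seq_le (fun n => Rabs (U n s i - U n t i)) (fun _ => M * Rabs (s - t))).
  - intros n. apply iter_lip; auto.
  - apply (is_lim_seq_abs _ (Y s i - Y t i)).
    apply is_lim_seq_minus'; apply iter_lim; auto.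
  - apply is_lim_seq_const.
Qed.

Lemma limit_fixed t i : (i < N)%nat -> Y t i = pic Y t i.
Proof.
  intros Hi. apply Rminus_diag_uniq.
  assert (Hz : forall n, Rabs (Y t i - pic Y t i) <= 2 * D * (/ 2) ^ n).
  { intros n.
    replace (Y t i - pic Y t i) with ((Y t i - U (S n) t i) + (pic (U n) t i - pic Y t i))
      by (simpl; ring).
    eapply Rle_trans; [apply Rabs_triang|].
    pose proof (limit_close (S n) t i Hi) as H1.
    pose proof (pic_contract (U n) Y (2 * D * (/ 2) ^ n) (iter_lip n) limit_lip) as H2.
    specialize (H2 ltac:(intros; rewrite Rabs_minus_sym; apply limit_close; auto) t i Hi).
    replace ((/ 2) ^ S n) with ((/ 2) ^ n / 2) in H1 by (simpl; field). lra. }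
  assert (H : Rbar_le (Rabs (Y t i - pic Y t i)) 0).
  { apply (is_lim_seq_le (fun _ => Rabs (Y t i - pic Y t i)) (fun n => 2 * D * (/ 2) ^ n)); auto.
    - apply is_lim_seq_const.
    - apply half_pow_lim. }
  simpl in H. pose proof (Rabs_pos (Y t i - pic Y t i)).
  destruct (Req_dec (Y t i - pic Y t i) 0) as [E|E]; auto.
  apply Rabs_pos_lt in E. lra.
Qed.

Lemma picard_solution :
  exists Y : R -> nat -> R,
    (forall i, (i < N)%nat -> Y 0 i = x0 i) /\
    (forall t i, (i < N)%nat -> Rabs (Y t i - x0 i) <= M * Rabs t) /\
    (forall t i, (i < N)%nat -> Rabs t < h -> is_derive (fun s => Y s i) t (f (Y t) i)).
Proof.
  exists Y.
  assert (H0 : forall i, (i < N)%nat -> Y 0 i = x0 i).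
  { intros i Hi. rewrite limit_fixed by auto. unfold pic.
    rewrite clamp_id by (rewrite Rabs_R0; auto). rewrite RInt_point.
    unfold zero; simpl. ring. }
  split; [exact H0|split].
  - intros t i Hi. rewrite <- H0 by auto. pose proof (limit_lip t 0 i Hi) as H. rewrite Rminus_0_r in H. exact H.
  - intros t i Hi Ht.
    apply (is_derive_ext_loc (fun s => x0 i + RInt (fun u => f (Y u) i) 0 s)).
    + assert (Hl : locally t (fun s => Rabs s < h)).
      { apply (continuous_Rabs t (fun y => y < h)). apply (open_lt h). exact Ht. }
      revert Hl. apply filter_imp. intros s Hs.
      rewrite (limit_fixed s i Hi). unfold pic. rewrite clamp_id by auto. reflexivity.
    + replace (f (Y t) i) with (0 + f (Y t) i) by ring.
      apply (is_derive_plus (V := R_NormedModule)); [apply (is_derive_const (V := R_NormedModule))|].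
      apply (is_derive_RInt (fun u => f (Y u) i) (fun s => RInt (fun u => f (Y u) i) 0 s) 0).
      * apply filter_forall. intros s. apply (RInt_correct (V := R_CompleteNormedModule)).
        apply (ex_RInt_continuous (fun u => f (Y u) i)). intros.
        apply pic_integrand; auto. apply limit_lip.
      * apply pic_integrand; auto. apply limit_lip.
Qed.

End Picard.

(** Freezing the kernel below [rho] makes the field bounded and globally Lipschitz, as the Picard
    iteration requires, without changing it where all gaps are at least [rho]. *)
Definition trunc_pw (rho m x : R) : R := pw m (Rmax rho x).

Lemma Rpower_lipschitz rho m u v :
  0 < rho -> 0 < m -> rho <= u -> rho <= v ->
  Rabs (Rpower u (- m) - Rpower v (- m)) <= m * Rpower rho (- (m + 1)) * Rabs (u - v).
Proof.
  intros Hr Hm Hu Hv.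
  assert (Hmin : rho <= Rmin v u) by (apply Rmin_glb; auto).
  destruct (MVT_gen (fun x => Rpower x (- m)) v u (fun x => - m * Rpower x (- m - 1)))
    as (c & Hc & E).
  - intros x Hx. apply is_derive_Rpower. lra.
  - intros x Hx. apply continuity_pt_filterlim.
    apply (ex_derive_continuous (V := R_NormedModule) (fun x => Rpower x (- m)) x).
    eexists. apply (is_derive_Rpower (- m) x). lra.
  - rewrite E, Rabs_mult. apply Rmult_le_compat_r; [apply Rabs_pos|].
    rewrite Rabs_mult, Rabs_Ropp, !Rabs_pos_eq by (try (left; apply Rpower_pos); lra).
    apply Rmult_le_compat_l; [lra|]. replace (- m - 1) with (- (m + 1)) by ring.
    apply Rpower_opp_le; lra.
Qed.

Lemma trunc_pw_lipschitz rho m x y :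
  0 < rho -> 0 < m ->
  Rabs (trunc_pw rho m x - trunc_pw rho m y) <= m * Rpower rho (- (m + 1)) * Rabs (x - y).
Proof.
  intros Hr Hm. unfold trunc_pw, pw.
  eapply Rle_trans; [apply (Rpower_lipschitz rho); auto; apply Rmax_l|].
  apply Rmult_le_compat_l.
  - apply Rmult_le_pos; [lra|left; apply Rpower_pos].
  - unfold Rmax. repeat destruct (Rle_dec _ _);
      unfold Rabs; repeat destruct (Rcase_abs _); lra.
Qed.

Lemma force_trunc_bound N chi rho m X i :
  0 < rho -> 0 < m ->
  Rabs (force N (kap chi) (trunc_pw rho m) X i)
  <= INR N * ((2 * Rabs chi + 1) * Rpower rho (- m)).
Proof.
  intros Hr Hm. apply rsum_abs. intros j Hj. pose proof (Rabs_pos chi).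
  assert (0 < Rpower rho (- m)) by apply Rpower_pos.
  destruct (i =? j)%nat; [rewrite Rabs_R0; nra|].
  rewrite !Rabs_mult, Rabs_sgn, Rmult_1_r.
  apply Rmult_le_compat; auto using Rabs_pos, kap_bound.
  unfold trunc_pw, pw. rewrite Rabs_pos_eq by (left; apply Rpower_pos).
  apply Rpower_opp_le; [lra|auto|apply Rmax_l].
Qed.

Lemma force_trunc_lipschitz N chi rho m X Y d i :
  0 < rho -> 0 < m -> (i < N)%nat ->
  (forall j, (j < N)%nat -> Rabs (X j - Y j) <= d) ->
  Rabs (force N (kap chi) (trunc_pw rho m) X i - force N (kap chi) (trunc_pw rho m) Y i)
  <= INR N * ((2 * Rabs chi + 1) * (m * Rpower rho (- (m + 1)) * 2)) * d.
Proof.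
  intros Hr Hm Hi Hd. unfold force.
  match goal with |- Rabs (rsum N ?F - rsum N ?G) <= _ =>
    replace (rsum N F - rsum N G) with (rsum N (fun j => F j + -1 * G j))
      by (rewrite rsum_plus, rsum_scal; ring) end.
  rewrite Rmult_assoc. apply rsum_abs. intros j Hj. cbv beta.
  assert (Hd0 : 0 <= d) by (eapply Rle_trans; [apply Rabs_pos|apply (Hd i Hi)]).
  pose proof (Rabs_pos chi). assert (0 < Rpower rho (- (m + 1))) by apply Rpower_pos.
  assert (HK : 0 <= m * Rpower rho (- (m + 1))) by (apply Rmult_le_pos; lra).
  destruct (i =? j)%nat.
  - rewrite Rmult_0_r, Rplus_0_l, Rabs_R0. repeat apply Rmult_le_pos; lra.
  - match goal with |- Rabs (?k * ?s * ?a + -1 * (?k * ?s * ?b)) <= _ =>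
      replace (k * s * a + -1 * (k * s * b)) with (k * s * (a - b)) by ring end.
    rewrite !Rabs_mult, Rabs_sgn, Rmult_1_r, Rmult_assoc.
    apply Rmult_le_compat; auto using Rabs_pos, kap_bound.
    eapply Rle_trans; [apply trunc_pw_lipschitz; auto|].
    rewrite (Rmult_assoc (m * _)). apply Rmult_le_compat_l; auto.
    eapply Rle_trans; [apply Rabs_triang_inv2|].
    replace (X j - X i - (Y j - Y i)) with ((X j - Y j) - (X i - Y i)) by ring.
    eapply Rle_trans; [apply Rabs_triang|]. rewrite Rabs_Ropp.
    pose proof (Hd i Hi). pose proof (Hd j Hj). lra.
Qed.

Lemma force_trunc_eq N ka rho m X i :
  0 < rho -> (forall k, (S k < N)%nat -> rho <= X (S k) - X k) -> (i < N)%nat ->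
  force N ka (trunc_pw rho m) X i = force N ka (pw m) X i.
Proof.
  intros Hr Hg Hi. apply rsum_ext. intros j Hj.
  destruct (Nat.eqb_spec i j) as [Hij|Hij]; [reflexivity|].
  assert (HX : incr N X) by (intros k Hk; specialize (Hg k Hk); lra).
  assert (Hfar : forall a b, (a < b)%nat -> (b < N)%nat -> rho <= X b - X a).
  { intros a b Hab Hb. pose proof (Hg a ltac:(lia)).
    pose proof (incr_le N X (S a) b HX Hab Hb). lra. }
  unfold trunc_pw. rewrite Rmax_right; [reflexivity|].
  destruct (lt_eq_lt_dec i j) as [[H|H]|H]; [|lia|].
  - eapply Rle_trans; [|apply Rle_abs]. auto.
  - rewrite Rabs_minus_sym. eapply Rle_trans; [|apply Rle_abs]. auto.
Qed.

(** [tau] depends on the gap bound [d] and not on [x0]; this uniformity permits continuation past a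
    finite time. Derivatives are two-sided even at [t = 0], because the Picard solution extends to
    negative times, and the gluing of solutions relies on it. *)
Lemma local_solution N m chi d :
  1 < m -> 0 < d ->
  exists tau, 0 < tau /\ forall x0, inR N x0 ->
    (forall k, (S k < N)%nat -> d <= x0 (S k) - x0 k) ->
    exists Y : R -> nat -> R, (forall i, (i < N)%nat -> Y 0 i = x0 i) /\
      forall t, 0 <= t < tau -> inR N (Y t) /\
        forall i, (i < N)%nat -> is_derive (fun s => Y s i) t (vfield N m chi (Y t) i).
Proof.
  intros Hm Hd. set (rho := d / 2). assert (Hr : 0 < rho) by (unfold rho; lra).
  set (M := INR N * ((2 * Rabs chi + 1) * Rpower rho (- m))).
  set (L := INR N * ((2 * Rabs chi + 1) * (m * Rpower rho (- (m + 1)) * 2))).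
  pose proof (Rabs_pos chi) as Hchi. pose proof (pos_INR N) as HN.
  assert (HM : 0 <= M).
  { unfold M. repeat apply Rmult_le_pos; try lra. left; apply Rpower_pos. }
  assert (HL : 0 <= L).
  { unfold L. repeat apply Rmult_le_pos; try lra. left; apply Rpower_pos. }
  set (h := / (2 * (L + 1))). assert (Hh : 0 < h) by (apply Rinv_0_lt_compat; lra).
  assert (HhL : h * L <= / 2).
  { apply Rle_trans with (h * (L + 1)); [apply Rmult_le_compat_l; lra|].
    apply Req_le. unfold h. field. lra. }
  (* [h] is the Picard time. Up to the second time each particle moves by at most [d / 4], so the
     gaps remain at least [d / 2 = rho] and the truncation is inactive. *)
  exists (Rmin h (d / (4 * (M + 1)))).
  assert (Hq : 0 < d / (4 * (M + 1))) by (apply Rdiv_lt_0_compat; lra).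
  split; [apply Rmin_glb_lt; auto|]. intros x0 Hx0 Hgap.
  destruct (picard_solution N (force N (kap chi) (trunc_pw rho m)) M L h x0)
    as (Y & HY0 & HYb & DY); auto.
  { intros X i Hi. apply force_trunc_bound; lra. }
  { intros X Z e i Hi He. apply force_trunc_lipschitz; auto; lra. }
  exists Y. split; auto. intros t Ht.
  assert (Hth : t < h) by (eapply Rlt_le_trans; [apply Ht|apply Rmin_l]).
  assert (Htd : t < d / (4 * (M + 1))) by (eapply Rlt_le_trans; [apply Ht|apply Rmin_r]).
  assert (HMt : M * t <= d / 4).
  { apply Rle_trans with ((M + 1) * (d / (4 * (M + 1)))).
    - apply Rmult_le_compat; lra.
    - apply Req_le. field. lra. }
  assert (Hg : forall k, (S k < N)%nat -> rho <= Y t (S k) - Y t k).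
  { intros k Hk. pose proof (HYb t k ltac:(lia)) as H1. pose proof (HYb t (S k) Hk) as H2.
    rewrite (Rabs_pos_eq t) in H1, H2 by lra. apply Rabs_le_between in H1, H2.
    specialize (Hgap k Hk). unfold rho. lra. }
  assert (HYi : incr N (Y t)) by (intros k Hk; specialize (Hg k Hk); lra).
  split; [split|]; auto.
  (* The zero sum required by [inR] persists because symmetric forces cancel, with the truncated
     kernel as well. *)
  - assert (Dsum : forall s, 0 <= s <= t -> is_derive (fun s => rsum N (Y s)) s 0).
    { intros s Hs. rewrite <- (force_sum N (kap chi) (trunc_pw rho m) (Y s) (kap_sym chi)).
      apply (rsum_is_derive N (fun i s => Y s i)). intros i Hi. apply DY; auto.
      rewrite Rabs_pos_eq; lra. }
    assert (E0 : rsum N (Y 0) = 0).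
    { transitivity (rsum N x0); [apply rsum_ext; auto|apply Hx0]. }
    destruct (Rle_lt_or_eq_dec 0 t) as [Hlt|Heq]; [lra| |].
    + transitivity (rsum N (Y 0)); [|exact E0]. symmetry.
      apply (eq_is_derive (fun s => rsum N (Y s)) 0 t); auto.
    + rewrite <- Heq. exact E0.
  - intros i Hi. rewrite vfield_force, <- (force_trunc_eq N _ rho) by auto.
    apply DY; auto. rewrite Rabs_pos_eq; lra.
Qed.

Lemma is_derive_glue (f g : R -> R) t0 l :
  f t0 = g t0 -> is_derive f t0 l -> is_derive g t0 l ->
  is_derive (fun t => if Rlt_dec t t0 then f t else g t) t0 l.
Proof.
  intros E Df Dg. apply is_derive_Reals in Df, Dg. apply is_derive_Reals.
  intros eps Heps. destruct (Df eps Heps) as [d1 H1]. destruct (Dg eps Heps) as [d2 H2].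
  exists (mkposreal _ (Rmin_stable_in_posreal d1 d2)). simpl. intros h Hh Hhd.
  destruct (Rlt_dec t0 t0) as [Hc|_]; [lra|].
  destruct (Rlt_dec (t0 + h) t0).
  - rewrite <- E. apply H1; auto. eapply Rlt_le_trans; [exact Hhd|apply Rmin_l].
  - apply H2; auto. eapply Rlt_le_trans; [exact Hhd|apply Rmin_r].
Qed.

Lemma maximal_sol_blows_up N m chi X0 X (T : R) :
  1 < m -> is_maximal_sol N m chi X0 X T -> blows_up N X T.
Proof.
  intros Hm [(HT & HX0 & HXR & HXd & HX0l) Hmax].
  apply Classical_Prop.NNPP. intros Hn.
  destruct (not_blows_up N X T) as (s & d & Hs & HsT & Hd & Hg); auto.
  { intros t Ht HtT. apply inR_incr. auto. }
  simpl in HT, HsT.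
  destruct (local_solution N m chi d Hm Hd) as (tau & Htau & Hloc).
  (* After [s], where gaps are at least [d], and within [tau] of [T]: the solution restarted at [t0]
     lives until [t0 + tau > T], against maximality. *)
  set (t0 := (Rmax s (T - tau) + T) / 2).
  assert (Hs0 : s <= Rmax s (T - tau)) by apply Rmax_l.
  assert (Hs1 : T - tau <= Rmax s (T - tau)) by apply Rmax_r.
  assert (Hs2 : Rmax s (T - tau) < T) by (apply Rmax_lub_lt; lra).
  assert (Ht0 : s < t0 < T /\ T - t0 < tau) by (unfold t0; lra).
  destruct (Hloc (X t0)) as (Y & HY0 & HY).
  { apply HXR; simpl; lra. }
  { intros k Hk. apply Hg; simpl; auto; lra. }
  set (Z := fun t i => if Rlt_dec t t0 then X t i else Y (t - t0) i).
  assert (HZ : is_sol N m chi X0 Z (t0 + tau)).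
  { split; [simpl; lra|]. split; [|split; [|split]].
    - intros i Hi. unfold Z. destruct (Rlt_dec 0 t0); [auto|lra].
    - intros t Ht HtT. simpl in HtT. unfold Z. destruct (Rlt_dec t t0).
      + apply (HXR t); simpl; lra.
      + apply (HY (t - t0)). lra.
    - intros i Hi t Ht HtT. simpl in HtT.
      assert (DY : forall t, t0 <= t < t0 + tau ->
        is_derive (fun s => Y (s - t0) i) t (vfield N m chi (Y (t - t0)) i)).
      { clear t Ht HtT. intros t Ht.
        replace (vfield N m chi (Y (t - t0)) i) with (1 * vfield N m chi (Y (t - t0)) i) by ring.
        apply (is_derive_comp (fun s => Y s i) (fun s => s - t0)).
        - apply HY; auto. lra.
        - auto_derive; auto; ring. }
      destruct (total_order_T t t0) as [[Hlt|Heq]|Hgt].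
      + replace (vfield N m chi (Z t) i) with (vfield N m chi (X t) i).
        * apply (is_derive_ext_loc (fun s => X s i)); [|apply HXd; simpl; auto; lra].
          generalize (open_lt t0 t Hlt). apply filter_imp. intros u Hu. unfold Z.
          destruct (Rlt_dec u t0); [reflexivity|lra].
        * unfold Z. destruct (Rlt_dec t t0); [reflexivity|lra].
      + subst t.
        assert (E : vfield N m chi (X t0) i = vfield N m chi (Y (t0 - t0)) i).
        { rewrite !vfield_force; auto.
          - apply rsum_ext. intros j Hj. rewrite Rminus_diag, !HY0 by auto. reflexivity.
          - apply inR_incr. apply HY. lra.
          - apply inR_incr. apply HXR; simpl; lra. }
        replace (vfield N m chi (Z t0) i) with (vfield N m chi (X t0) i).
        * apply (is_derive_glue (fun s => X s i) (fun s => Y (s - t0) i)).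
          -- rewrite Rminus_diag, HY0; auto.
          -- apply HXd; simpl; auto; lra.
          -- rewrite E. apply DY. lra.
        * rewrite E. unfold Z. destruct (Rlt_dec t0 t0); [lra|reflexivity].
      + replace (vfield N m chi (Z t) i) with (vfield N m chi (Y (t - t0)) i).
        * apply (is_derive_ext_loc (fun s => Y (s - t0) i)); [|apply DY; lra].
          generalize (open_gt t0 t Hgt). apply filter_imp. intros u Hu. unfold Z.
          destruct (Rlt_dec u t0); [lra|reflexivity].
        * unfold Z. destruct (Rlt_dec t t0); [lra|reflexivity].
    - intros i Hi. apply (filterlim_ext_loc (fun s => X s i)); [|auto].
      assert (Hp : 0 < t0) by lra. exists (mkposreal t0 Hp). intros u Hu Hu0.
      unfold Z. destruct (Rlt_dec u t0) as [|Hc]; [reflexivity|].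
      apply Rabs_lt_between in Hu. simpl in Hu. unfold minus, plus, opp in Hu. simpl in Hu. lra. }
  specialize (Hmax Z (t0 + tau) HZ). simpl in Hmax. lra.
Qed.

(** * Conclusion *)

Lemma global_sol_critical N m chi X0 X :
  1 < m -> (2 <= N)%nat -> Cp N m < chi -> is_sol N m chi X0 X p_infty ->
  exists p Z, (2 <= p <= N - 1)%nat /\ is_critical_point p m chi Z.
Proof.
  intros Hm HN Hchi HX.
  pose proof (Cp_pos N m Hm HN) as HC.
  destruct (renorm_blows_up N m chi X0 X Hm HN Hchi HX) as (i0 & t & Hi0 & Ht & Lt & Lg).
  destruct (rel_blowup_set_extraction N (fun n => renorm N X (t n)) i0)
    as (phi & l & r & Hphi & Hrel); auto.
  { intros n. apply (renorm_unit N m chi X0 X); auto. apply Ht. }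
  destruct (renorm_profile_critical N m chi X0 X (fun n => t (phi n)) l r)
    as (Z & _ & HZ & _); auto.
  { intros n. apply Ht. }
  { apply (is_lim_seq_subseq t p_infty phi); auto. }
  pose proof Hrel as (Hlr & HrN & _).
  exists (r - l + 1)%nat, Z. split; auto. split; [lia|].
  (* A block of all [N] particles would give a critical point of size [N], hence [chi = C_N], which
     is excluded. *)
  destruct (Nat.eq_dec (r - l + 1) N) as [E|E]; [|lia].
  rewrite E in HZ. pose proof (critical_Cp N m chi Z Hm HN ltac:(lra) HZ). lra.
Qed.

Theorem theorem1p4 (m chi : R) (N : nat) (X0 : nat -> R)
    (X : R -> nat -> R) (T : Rbar) :
  1 < m -> (2 <= N)%nat -> Cp N m < chi -> inR N X0 ->
  is_maximal_sol N m chi X0 X T ->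
  ((forall p : nat, (1 <= p <= N - 1)%nat -> (2 <= p)%nat -> chi <> Cp p m) ->
     blows_up_finite_time N X T)
  /\
  (forall p : nat, (1 <= p <= N - 1)%nat -> (2 <= p)%nat -> chi = Cp p m ->
     blows_up_finite_time N X T
     \/ (T = p_infty /\
         blows_up N (renorm N X) p_infty /\
         (forall (t : nat -> R) (l r : nat),
            (forall n, 0 <= t n) -> is_lim_seq t p_infty ->
            rel_blowup_set N (fun n => renorm N X (t n)) l r ->
            (r - l + 1 = p)%nat /\
            exists Z : nat -> R,
              limit_profile (fun n => renorm N X (t n)) l r Z /\
              is_critical_point p m chi Z /\
              (forall Z' : nat -> R,
                 is_critical_point p m chi Z' -> gap_normalized p Z' ->
                 forall i, (i < p)%nat -> Z' i = Z i)))).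
Proof.
  intros Hm HN Hchi _ HX.
  pose proof (Cp_pos N m Hm HN) as HC.
  destruct T as [T| |].
  - assert (HB : blows_up_finite_time N X T).
    { split; [apply (maximal_sol_blows_up N m chi X0); auto|reflexivity]. }
    split; [intros _; exact HB|intros; left; exact HB].
  - destruct HX as [HX _]. split.
    (* A global solution would yield a critical point of some size [p < N], hence [chi = C_p],
       against the assumption; infinite [T] is thus impossible here. *)
    + intros Hp. destruct (global_sol_critical N m chi X0 X) as (p & Z & Hp2 & HZ); auto.
      exfalso. apply (Hp p); [lia|lia|]. symmetry. apply (critical_Cp p m chi Z); auto; [lia|lra].
    + intros p Hp Hp2 Ep. right. split; [reflexivity|]. split.
      { apply (renorm_blows_up N m chi X0 X); auto. }
      intros t l r Ht Lt Hrel.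
      destruct (renorm_profile_critical N m chi X0 X t l r) as (Z & HL & HZ & HZn); auto.
      pose proof Hrel as (Hlr & _).
      (* The profile is critical for the same [chi], and [chi = C_p] leaves [p] as the only possible
         size. *)
      assert (E : (r - l + 1)%nat = p).
      { apply (critical_size p (r - l + 1) m chi Z); auto; [lia|lra]. }
      rewrite E in *. split; [reflexivity|].
      exists Z. split; auto. split; auto. intros Z' HZ' HZn'.
      apply (critical_unique p m chi Z Z'); auto. lra.
  - destruct HX as [[HT _] _]. contradiction.
Qed.
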